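(* For $p\in E_e$, the grading $\Gamma(p)$ is a good grading for $e$ if and only if $|\alpha(p)|<d(\alpha)$ for all $\alpha\in\Phi_e^+$, where $d(\alpha)=1+\min\{i\ge 0\mid m(\alpha,i)\ne 0\}$, that is, the minimal dimension of an irreducible $\mathfrak s$-submodule of the $\alpha$-weight space of $\mathfrak g$ with respect to $\mathfrak t_e$.
   Context: Let $G$ be a connected semisimple algebraic group over $\mathbb C$ with Lie algebra $\mathfrak g$, and let $e\in\mathfrak g$ be nilpotent. An $\mathbb R$-grading $\mathfrak g=\bigoplus_{j\in\mathbb R}\mathfrak g_j$ (with $[\mathfrak g_i,\mathfrak g_j]\subseteq\mathfrak g_{i+j}$) is a good grading for $e$ if $e\in\mathfrak g_2$ and $\operatorname{ad}e:\mathfrak g_j\to\mathfrak g_{j+2}$ is injective for all $j\le-1$ and surjective for all $j\ge-1$. Embed $e$ into an $\mathfrak{sl}_2$-subalgebra $\mathfrak s=\langle e,h,f\rangle$, so $[h,e]=2e$, $[h,f]=-2f$, $[e,f]=h$. Let $C$ be the centralizer of $h$ in $G$ and $C_e$ the centralizer of $e$ in $C$. Let $T$ be a maximal torus of $G$ contained in $C$ and containing a maximal torus of $C_e$, let $\mathfrak t$ be its Lie algebra (so $h\in\mathfrak t$), and let $\mathfrak t_e$ be the centralizer of $e$ in $\mathfrak t$. Let $E_e$ be the real vector space of all $p\in\mathfrak t_e$ such that the eigenvalues of $\operatorname{ad}p$ on $\mathfrak g$ are real; it is an $\mathbb R$-form of $\mathfrak t_e$. For $p\in E_e$, $\Gamma(p)$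 denotes the $\mathbb R$-grading of $\mathfrak g$ whose degree $j$ piece is the $j$-eigenspace of $\operatorname{ad}(h+p)$. Let $L$ be the centralizer of $\mathfrak t_e$ in $G$ (a Levi subgroup). Fix a parabolic subgroup $P$ of $G$ having $L$ as a Levi factor, with unipotent radical $U$ and $\mathfrak u=\operatorname{Lie}(U)$. $\Phi_e\subset\mathfrak t_e^*$ is the set of non-zero weights of $\mathfrak t_e$ on the centralizer $\mathfrak g_e$ of $e$ in $\mathfrak g$ (equivalently, on $\mathfrak g$), and $\Phi_e^+$ is the set of weights of $\mathfrak t_e$ on $\mathfrak u$, so that $\Phi_e=\Phi_e^+\sqcup(-\Phi_e^+)$. For $\alpha\in\mathfrak t_e^*$ and $i\ge 0$, let $L(\alpha,i)$ be the irreducible $\mathfrak t_e\oplus\mathfrak s$-module of dimension $i+1$ on which $\mathfrak t_e$ acts by weight $\alpha$; $m(\alpha,i)$ denotes the multiplicity of $L(\alpha,i)$ in $\mathfrak g$, i.e. $\mathfrak g\cong\bigoplus_{\alpha}\bigoplus_{i\ge0}m(\alpha,i)L(\alpha,i)$. *)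

(* Defs.v *)
(* The base field is the field R[i] of complex numbers over
   R : realType.  mpoly is used through qualified names only, since its
   notations clash with those of MathComp-Analysis. *)
From mathcomp Require Import all_boot all_order all_algebra.
From mathcomp Require Import complex.
From mathcomp Require Import boolp classical_sets reals.
From mathcomp Require mpoly.

Set Implicit Arguments.
Unset Strict Implicit.
Unset Printing Implicit Defensive.

Import Order.TTheory GRing.Theory Num.Theory.
Local Open Scope classical_set_scope.
Local Open Scope ring_scope.

(** * Linear algebraic groups over R[i]

    An affine algebraic group is a Zariski closed subgroup of some GL_n; it is
    represented by its set of matrices. *)

Definition mxcoord (R : realType) (n : nat) (A : 'M[R[i]]_n) : 'I_(n * n) -> R[i] :=
  fun k => mxvec A 0 k.

Definition mxpolyeval (R : realType) (n : nat)
    (f : mpoly.mpoly (n * n) R[i]) (A : 'M[R[i]]_n) : R[i] :=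
  mpoly.meval (mxcoord A) f.

(* Closed subsets of GL_n; inverting the determinant adds no closed subsets, so
   polynomials in the matrix entries suffice. *)
Definition zariski_closed (R : realType) (n : nat) (Z : set 'M[R[i]]_n) : Prop :=
  exists S : set (mpoly.mpoly (n * n) R[i]),
    Z = [set A | A \in unitmx /\ forall f, S f -> mxpolyeval f A = 0].

Definition subgroup (R : realType) (n : nat) (H : set 'M[R[i]]_n) : Prop :=
  [/\ H `<=` [set A | A \in unitmx],
      H 1%:M,
      forall A B, H A -> H B -> H (A *m B)
    & forall A, H A -> H (invmx A)].

Definition closed_subgroup (R : realType) (n : nat) (H : set 'M[R[i]]_n) : Prop :=
  subgroup H /\ zariski_closed H.

Definition zariski_connected (R : realType) (n : nat) (H : set 'M[R[i]]_n) : Prop :=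
  forall Z1 Z2 : set 'M[R[i]]_n, zariski_closed Z1 -> zariski_closed Z2 ->
    H `<=` Z1 `|` Z2 -> H `&` Z1 `&` Z2 = set0 -> H `<=` Z1 \/ H `<=` Z2.

Definition Ad (R : realType) (n : nat) (g x : 'M[R[i]]_n) : 'M[R[i]]_n :=
  g *m x *m invmx g.

Definition normal_in (R : realType) (n : nat) (H G : set 'M[R[i]]_n) : Prop :=
  H `<=` G /\ forall g x, G g -> H x -> H (Ad g x).

Inductive generated (R : realType) (n : nat) (S : set 'M[R[i]]_n) :
    'M[R[i]]_n -> Prop :=
| Gen_in A of S A : generated S A
| Gen_one : generated S 1%:M
| Gen_mul A B of generated S A & generated S B : generated S (A *m B)
| Gen_inv A of generated S A : generated S (invmx A).

Definition derived_subgroup (R : realType) (n : nat) (H : set 'M[R[i]]_n) :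
    set 'M[R[i]]_n :=
  generated [set D | exists A B, [/\ H A, H B & D = A *m B *m invmx A *m invmx B]].

Definition solvable_group (R : realType) (n : nat) (H : set 'M[R[i]]_n) : Prop :=
  exists k, iter k (@derived_subgroup R n) H `<=` [set 1%:M].

Definition connected_semisimple (R : realType) (n : nat) (G : set 'M[R[i]]_n) : Prop :=
  [/\ closed_subgroup G, zariski_connected G
    & forall H, closed_subgroup H -> zariski_connected H -> solvable_group H ->
        normal_in H G -> H = [set 1%:M]].

(* Torus = connected diagonalizable group. *)
Definition is_torus (R : realType) (n : nat) (T : set 'M[R[i]]_n) : Prop :=
  [/\ closed_subgroup T, zariski_connected T
    & exists2 Q : 'M[R[i]]_n, Q \in unitmx &
        forall A, T A -> is_diag_mx (Q *m A *m invmx Q)].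

Definition maximal_torus (R : realType) (n : nat) (H T : set 'M[R[i]]_n) : Prop :=
  [/\ is_torus T, T `<=` H
    & forall T', is_torus T' -> T' `<=` H -> T `<=` T' -> T' = T].

Definition borel_subgroup (R : realType) (n : nat) (G B : set 'M[R[i]]_n) : Prop :=
  let csc H := [/\ closed_subgroup H, zariski_connected H, solvable_group H
                 & H `<=` G] in
  csc B /\ forall B', csc B' -> B `<=` B' -> B' = B.

Definition parabolic_subgroup (R : realType) (n : nat) (G P : set 'M[R[i]]_n) : Prop :=
  [/\ closed_subgroup P, P `<=` G
    & exists2 B, borel_subgroup G B & B `<=` P].

Definition nilpotent_mx (R : realType) (n : nat) (x : 'M[R[i]]_n) : Prop :=
  exists k, x ^+ k = 0.

Definition unipotent_group (R : realType) (n : nat) (H : set 'M[R[i]]_n) : Prop :=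
  forall A, H A -> nilpotent_mx (A - 1%:M).

Definition unipotent_radical (R : realType) (n : nat) (P U : set 'M[R[i]]_n) : Prop :=
  let cun H := [/\ closed_subgroup H, zariski_connected H, unipotent_group H
                 & normal_in H P] in
  cun U /\ forall H, cun H -> H `<=` U.

(* P is the semidirect product of L and its unipotent radical U. *)
Definition levi_factor (R : realType) (n : nat) (P U L : set 'M[R[i]]_n) : Prop :=
  [/\ closed_subgroup L, L `<=` P, L `&` U = [set 1%:M]
    & forall g, P g -> exists l u, [/\ L l, U u & g = l *m u]].

(** * Lie algebras *)

Definition br (R : realType) (n : nat) (x y : 'M[R[i]]_n) : 'M[R[i]]_n :=
  x *m y - y *m x.

(* Lie(H) is the tangent space at 1: the common kernel of the differentials at
   1 of the polynomials vanishing on H. *)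
Definition Lie (R : realType) (n : nat) (H : set 'M[R[i]]_n) : set 'M[R[i]]_n :=
  [set X | forall f : mpoly.mpoly (n * n) R[i],
     (forall A, H A -> mxpolyeval f A = 0) ->
     \sum_(k < n * n) mxpolyeval (mpoly.mderiv k f) 1%:M * mxcoord X k = 0].

Definition sl2_triple (R : realType) (n : nat) (e h f : 'M[R[i]]_n) : Prop :=
  [/\ br h e = 2%:R *: e, br h f = - 2%:R *: f & br e f = h].

Definition group_centralizer (R : realType) (n : nat)
    (H S : set 'M[R[i]]_n) : set 'M[R[i]]_n :=
  [set g | H g /\ forall x, S x -> Ad g x = x].

Definition lie_centralizer (R : realType) (n : nat)
    (t : set 'M[R[i]]_n) (e : 'M[R[i]]_n) : set 'M[R[i]]_n :=
  [set x | t x /\ br x e = 0].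

(** * R-gradings *)

Definition is_grading (R : realType) (n : nat)
    (g : set 'M[R[i]]_n) (Gam : R -> set 'M[R[i]]_n) : Prop :=
  [/\ forall j, [/\ Gam j `<=` g, Gam j 0
        & forall (c : R[i]) x y, Gam j x -> Gam j y -> Gam j (c *: x + y)],
      forall i j x y, Gam i x -> Gam j y -> Gam (i + j) (br x y),
      forall x, g x -> exists (s : seq R) (y : R -> 'M[R[i]]_n),
        (forall j, Gam j (y j)) /\ x = \sum_(j <- s) y j
    & forall (s : seq R) (y : R -> 'M[R[i]]_n), uniq s ->
        (forall j, Gam j (y j)) -> \sum_(j <- s) y j = 0 ->
        forall j, j \in s -> y j = 0].

Definition good_grading (R : realType) (n : nat)
    (g : set 'M[R[i]]_n) (e : 'M[R[i]]_n) (Gam : R -> set 'M[R[i]]_n) : Prop :=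
  [/\ is_grading g Gam,
      Gam 2%:R e,
      forall j, j <= -1 -> forall x y, Gam j x -> Gam j y ->
        br e x = br e y -> x = y
    & forall j, -1 <= j -> forall y, Gam (j + 2%:R) y ->
        exists2 x, Gam j x & br e x = y].

(* The eigenspaces of ad z on g for real eigenvalues. *)
Definition ad_eigen_grading (R : realType) (n : nat)
    (g : set 'M[R[i]]_n) (z : 'M[R[i]]_n) : R -> set 'M[R[i]]_n :=
  fun j => [set x | g x /\ br z x = (j%:C)%C *: x].

Definition real_form (R : realType) (n : nat)
    (g te : set 'M[R[i]]_n) : set 'M[R[i]]_n :=
  [set p | te p /\ forall (c : R[i]) x, g x -> x != 0 -> br p x = c *: x ->
     exists r : R, c = (r%:C)%C].

(** * Weights and multiplicities

    An element of the dual of te is given by a linear form alpha on all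
    matrices, of which only the restriction to te matters. *)

Definition weight_space (R : realType) (n : nat)
    (te V : set 'M[R[i]]_n) (alpha : {scalar 'M[R[i]]_n}) : set 'M[R[i]]_n :=
  [set x | V x /\ forall t, te t -> br t x = alpha t *: x].

Definition is_weight (R : realType) (n : nat)
    (te V : set 'M[R[i]]_n) (alpha : {scalar 'M[R[i]]_n}) : Prop :=
  exists2 x, weight_space te V alpha x & x != 0.

Definition s_stable (R : realType) (n : nat) (e h f : 'M[R[i]]_n)
    (V : {vspace 'M[R[i]]_n}) : Prop :=
  forall x, x \in V -> [/\ br e x \in V, br h x \in V & br f x \in V].

Definition s_irreducible (R : realType) (n : nat) (e h f : 'M[R[i]]_n)
    (V : {vspace 'M[R[i]]_n}) : Prop :=
  [/\ V != 0%VS, s_stable e h f V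
    & forall W : {vspace 'M[R[i]]_n}, (W <= V)%VS -> s_stable e h f W ->
        W = 0%VS \/ W = V].

(* V is a submodule of g isomorphic to L(alpha, i).  As te acts by scalars on
   V, irreducibility under te and s together is irreducibility under s. *)
Definition is_L (R : realType) (n : nat) (g te : set 'M[R[i]]_n)
    (e h f : 'M[R[i]]_n) (alpha : {scalar 'M[R[i]]_n}) (i : nat)
    (V : {vspace 'M[R[i]]_n}) : Prop :=
  [/\ forall x, x \in V -> weight_space te g alpha x,
      s_irreducible e h f V & \dim V = i.+1].

(* k is the number of summands isomorphic to L(alpha, i) in some decomposition
   of g as a direct sum of submodules L(beta, j). *)
Definition is_multiplicity (R : realType) (n : nat) (g te : set 'M[R[i]]_n)
    (e h f : 'M[R[i]]_n) (alpha : {scalar 'M[R[i]]_n}) (i k : nat) : Prop :=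
  exists (r : nat) (beta : 'I_r -> {scalar 'M[R[i]]_n}) (d : 'I_r -> nat)
         (V : 'I_r -> {vspace 'M[R[i]]_n}),
    [/\ forall a, is_L g te e h f (beta a) (d a) (V a),
        directv (\sum_(a < r) V a),
        forall x, g x <-> x \in (\sum_(a < r) V a)%VS
      & k = #|[pred a : 'I_r | `[< forall t, te t -> beta a t = alpha t >]
                              && (d a == i)]|].

Definition multiplicity (R : realType) (n : nat) (g te : set 'M[R[i]]_n)
    (e h f : 'M[R[i]]_n) (alpha : {scalar 'M[R[i]]_n}) (i : nat) : nat :=
  xget 0%N [set k | is_multiplicity g te e h f alpha i k].

(* The value of the minimum on the empty set is the dummy 0. *)
Definition min_nat (A : set nat) : nat :=
  xget 0%N [set i | A i /\ forall j, A j -> (i <= j)%N].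

Definition dmin (R : realType) (n : nat) (g te : set 'M[R[i]]_n)
    (e h f : 'M[R[i]]_n) (alpha : {scalar 'M[R[i]]_n}) : nat :=
  (1 + min_nat [set i | multiplicity g te e h f alpha i != 0%N])%N.

Definition min_irreducible_dim (R : realType) (n : nat) (g te : set 'M[R[i]]_n)
    (e h f : 'M[R[i]]_n) (alpha : {scalar 'M[R[i]]_n}) (d : nat) : Prop :=
  let sub V := s_irreducible e h f V /\
               forall x, x \in V -> weight_space te g alpha x in
  (exists2 V, sub V & \dim V = d) /\ (forall V, sub V -> (d <= \dim V)%N).

(* Main.v *)
(* Under [s] and [te], [g] is spanned by strings [x, f x, .., f^i x], where [x] is
   a vector of weight [alpha] with [e x = 0] and [h x = i x].  The degree of [f^k x]
   in the grading of [p] is [i - 2k + alpha(p)].  Since [ad e] kills only the top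
   of a string and misses only its bottom, the grading is good if and only if
   every top has degree [> -1] and every bottom degree [< 1], that is, if
   [|alpha(p)| < i + 1] for all the strings.  The trace form of the ambient
   matrices is nondegenerate on [g], so the bottom of a string pairs with the top
   of a string of weight [- alpha] and the same length: a good grading cannot have
   a bottom in the image of [ad e], and the condition for [alpha] is the one for
   [- alpha].

   It remains to see that for each nonzero weight [alpha] on [g], [alpha] or
   [- alpha] is a weight on [u = Lie U].  For a generic [t0] in [te], the weight
   vectors in [Lie P] for nonzero weights lie in [u], so it is enough that
   the orthogonal of [Lie P] in [g] lies in [Lie P].  All this relies on the fact
   that a closed subgroup contains the exponentials of the nilpotent elements of
   its Lie algebra and enough of the torus generated by a semisimple part. *)
From HB Require Import structures.
Require Import Defs.
From mathcomp Require Import all_boot all_order all_algebra.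
From mathcomp Require Import complex.
From mathcomp Require Import boolp classical_sets reals.
From mathcomp Require Import mpoly.
From mathcomp Require exp.
From mathcomp Require Import zify ring lra.

Set Implicit Arguments.
Unset Strict Implicit.
Unset Printing Implicit Defensive.

Import Order.TTheory GRing.Theory Num.Theory.
Local Open Scope classical_set_scope.
Local Open Scope ring_scope.

(** * Linear subsets and polynomial functions *)

Section LinearSubsets.
Variables (F : fieldType).

(** [Lie H] is given only by the differentials at 1 of the polynomials vanishing on [H], so every
    passage between [H] and [Lie H] goes through polynomial functions on curves. For [X = s + N] in
    [Lie H], all iterated left-invariant derivatives along [X] of such a polynomial vanish at 1. On
    a formal exponential of [X], with one free variable per eigenvalue, the polynomial becomes an
    exponential polynomial, and these derivatives force the sum of its coefficients of each weight
    to vanish. Any substitution that respects the additive relations between the eigenvalues is then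
    allowed: a character of the additive group of [R[i]] gives points of [H], so that the real
    exponential suffices, and an additive map of [R[i]] gives elements of [Lie H]. Complex
    conjugation, taken as this additive map, turns vanishing traces into nilpotency, and lets the
    trace form of the ambient matrices do the work of the Killing form. No root system is used for
    [P]: the orthogonal of [Lie P] is controlled by the maximality of a Borel subgroup. *)

Definition linsub (V : lmodType F) (S : set V) : Prop :=
  S 0 /\ forall (a : F) x y, S x -> S y -> S (a *: x + y).

Section Lmod.
Variables (V : lmodType F) (S : set V).
Hypothesis hS : linsub S.

Lemma linsub0 : S 0. Proof. by case: hS. Qed.

Lemma linsubD x y : S x -> S y -> S (x + y).
Proof. by move=> Sx Sy; rewrite -[x]scale1r; apply: hS.2. Qed.

Lemma linsubZ a x : S x -> S (a *: x).
Proof. by move=> Sx; rewrite -[_ *: _]addr0; apply: hS.2 => //; exact: linsub0. Qed.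

Lemma linsubN x : S x -> S (- x).
Proof. by move=> Sx; rewrite -scaleN1r; apply: linsubZ. Qed.

Lemma linsubB x y : S x -> S y -> S (x - y).
Proof. by move=> Sx Sy; apply: linsubD => //; apply: linsubN. Qed.

Lemma linsub_sum (I : Type) (r : seq I) (P : pred I) (f : I -> V) :
  (forall i, P i -> S (f i)) -> S (\sum_(i <- r | P i) f i).
Proof. by move=> Sf; apply: big_ind => //; [exact: linsub0 | exact: linsubD]. Qed.

End Lmod.

Lemma scalar_ex (V : lmodType F) (phi : V -> F) :
  scalar phi -> exists l : {scalar V}, l =1 phi.
Proof.
move=> hphi; pose L := GRing.isLinear.Build _ _ _ _ phi hphi.
by pose l : {scalar V} := HB.pack phi L; exists l.
Qed.

(** A subspace of maximal dimension inside [S] absorbs every line of [S]. This gives sets cut out by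
    conditions, such as [Lie H], access to dimensions and projections. *)
Lemma linsub_vspace (V : vectType F) (S : set V) :
  linsub S -> exists U : {vspace V}, forall x, S x <-> x \in U.
Proof.
move=> hS.
pose A : set nat := [set k | exists2 U : {vspace V}, (forall x, x \in U -> S x) & \dim U = k].
have A0 : A 0%N.
  exists 0%VS; last exact: dimv0.
  by move=> x; rewrite memv0 => /eqP ->; apply: linsub0.
have bA k : A k -> (k <= \dim {:V})%N by case=> U _ <-; apply/dimvS/subvf.
have exA : exists k, `[< A k >] by exists 0%N; apply/asboolP.
have ubA k : `[< A k >] -> (k <= \dim {:V})%N by move/asboolP; exact: bA.
case: (ex_maxnP exA ubA) => k /asboolP [U US dU] kmax.
exists U => x; split=> [Sx|]; last exact: US.
have : A (\dim (U + <[x]>)%VS).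
  exists (U + <[x]>)%VS => // y /memv_addP [u uU [v /vlineP [c ->] ->]].
  by apply: linsubD => //; [apply: US | apply: linsubZ].
move/asboolP/kmax => le_dim.
have /eqP -> : (U == U + <[x]>)%VS by rewrite eqEdim addvSl dU.
by apply: (subvP (addvSr U <[x]>)); rewrite memv_line.
Qed.

(** Take a coordinate of [x - projv U x] that does not vanish at [v]. Membership in a linear subset
    thus becomes a polynomial condition. *)
Lemma linsub_sep (V : vectType F) (S : set V) v : linsub S -> ~ S v ->
  exists l : {scalar V}, (forall x, S x -> l x = 0) /\ l v != 0.
Proof.
move=> hS nSv; have [U hU] := linsub_vspace hS.
pose w := projv (U^C)%VS v.
pose p : V -> V := fun x => x - projv U x.
have p_lin : linear p by move=> a x y; rewrite /p linearP /= scalerBr opprD addrACA.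
have pv : p v != 0.
  apply/eqP => /eqP; rewrite subr_eq0 => /eqP e; apply: nSv; apply/hU.
  by rewrite e memv_proj.
have [j pj] : exists j, coord (vbasis {:V}) j (p v) != 0.
  apply: contra_neqP pv => /forallNP h; rewrite (coord_vbasis (memvf (p v))) big1 // => i _.
  by have /negP := h i; rewrite negbK => /eqP ->; rewrite scale0r.
have l_lin : scalar (fun x => coord (vbasis {:V}) j (p x)).
  by move=> a x y; rewrite p_lin linearP.
have [l le] := scalar_ex l_lin.
exists l; rewrite le; split=> [x /hU xU|] //.
by rewrite le /p projv_id // subrr linear0.
Qed.

End LinearSubsets.

(** In characteristic 0 the natural numbers are infinitely many points. Identities known for the
    powers [A ^+ m] extend in this way to all parameters. *)
Lemma poly_nat_eq0 (F : numFieldType) (p : {poly F}) :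
  (forall k : nat, p.[k%:R] = 0) -> p = 0.
Proof.
move=> p0; apply/eqP; apply: contraT => pn0.
have /= := max_poly_roots (rs := [seq k%:R | k <- iota 0 (size p)]) pn0.
rewrite size_map size_iota ltnn => -> //.
  by apply/allP => _ /mapP [k _ ->]; apply/eqP.
by rewrite map_inj_uniq ?iota_uniq // => i j /eqP; rewrite eqr_nat => /eqP.
Qed.

Lemma poly_nat_inj (F : numFieldType) (p q : {poly F}) :
  (forall k : nat, p.[k%:R] = q.[k%:R]) -> p = q.
Proof.
move=> pq; apply/eqP; rewrite -subr_eq0; apply/eqP/poly_nat_eq0 => k.
by rewrite !hornerE pq subrr.
Qed.

Lemma deriv_eq0 (F : numFieldType) (p : {poly F}) : p^`() = 0 -> p = (p.[0])%:P.
Proof.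
move=> p'0; apply/polyP => -[|i]; rewrite coefC -?horner_coef0 ?horner_coef0 //=.
have := coef_deriv p i; rewrite p'0 coef0 => /esym/eqP.
by rewrite mulrn_eq0 /= => /eqP.
Qed.

(** A vector space over an infinite field is not a finite union of proper hyperplanes: on the line
    [y + k x] each form vanishes for at most one [k]. *)
Lemma linsub_avoid (F : numFieldType) (V : lmodType F) (S : set V)
    (I : eqType) (r : seq I) (l : I -> {scalar V}) :
  linsub S -> (forall i, i \in r -> exists2 x, S x & l i x != 0) ->
  exists2 x, S x & forall i, i \in r -> l i x != 0.
Proof.
move=> hS; elim: r => [_|i0 r IH hl]; first by exists 0 => //; apply: linsub0.
have [i ir|x Sx hx] := IH; first by apply: hl; rewrite inE ir orbT.
have [y Sy l0y] := hl i0 (mem_head _ _).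
pose P := \prod_(i <- i0 :: r) ((l i y)%:P + (l i x) *: 'X).
have Pn0 : P != 0.
  rewrite prodf_seq_neq0; apply/allP => i; rewrite inE => /orP [/eqP ->|ir] /=.
    apply: contra l0y => /eqP e; have := congr1 (fun q => q.[0]) e.
    by rewrite !hornerE => ->.
  apply: contra (hx i ir) => /eqP e; have := congr1 (fun q : {poly F} => q`_1) e.
  by rewrite coefD coefC coefZ coefX /= add0r mulr1 coef0 => ->.
have [k Pk] : exists k : nat, P.[k%:R] != 0.
  apply: contra_neqP Pn0 => /forallNP h; apply: poly_nat_eq0 => k.
  by have /negP := h k; rewrite negbK => /eqP.
exists (y + k%:R *: x); first by apply: linsubD => //; apply: linsubZ.
move=> i ir; rewrite linearD linearZ /=.
move: Pk; rewrite horner_prod prodf_seq_neq0 => /allP /(_ i ir) /=.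
by rewrite !hornerE mulrC.
Qed.

(** * Polynomial algebras: induction and the chain rule *)

Section MPolyTools.
Variables (N : nat) (K : comNzRingType).
Local Notation MP := (mpoly.mpoly N K).
Local Notation var i := (mpoly.mpolyX K (mpoly.mnm1 i)).

Lemma mpoly_alg_ind (P : MP -> Prop) :
  (forall c, P (mpoly.mpolyC N c)) -> (forall i, P (var i)) ->
  (forall p q, P p -> P q -> P (p + q)) -> (forall p q, P p -> P q -> P (p * q)) ->
  forall p, P p.
Proof.
move=> PC PX PD PM; apply: (@mpoly.mpolyind N K P) => [|c m q _ _ Pq].
  by rewrite -mpoly.mpolyC0; apply: PC.
apply: (PD) => //; rewrite -mpoly.mul_mpolyC; apply: (PM) => //.
rewrite mpoly.mpolyXE_id; apply: big_ind => [|p r|i _]; [by rewrite -mpoly.mpolyC1; apply: PC|exact: PM|].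
elim: (m i) => [|k IH]; first by rewrite expr0 -mpoly.mpolyC1; apply: PC.
by rewrite exprS; apply: (PM _ _ (PX i)).
Qed.

Lemma mderiv_var i k : mpoly.mderiv k (var i) = ((k == i)%:R : MP).
Proof.
rewrite mpoly.mderivX mpoly.mnm1E eq_sym; case: eqP => [->|_]; last by rewrite scale0r.
rewrite scale1r (_ : mpoly.mnm_sub _ _ = mpoly.mnm0) ?mpoly.mpolyX0 //.
by apply/mpoly.mnmP => j; rewrite mpoly.mnmBE subnn mpoly.mnm0E.
Qed.

(** The twist by [g] covers both derivations of a ring ([g] the identity) and derivatives followed
    by evaluation at a point ([g] the evaluation). *)
Lemma mmap_chain (S S' : comNzRingType) (f : {rmorphism K -> S}) (g : {rmorphism S -> S'})
    (v : 'I_N -> S) (d : S -> S') :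
  {morph d : x y / x + y} -> (forall x y, d (x * y) = d x * g y + g x * d y) ->
  (forall c, d (f c) = 0) -> forall p : MP,
  d (mpoly.mmap f v p)
  = \sum_(k < N) g (mpoly.mmap f v (mpoly.mderiv k p)) * d (v k).
Proof.
move=> dD dM dC; elim/mpoly_alg_ind => [c|i|p q IHp IHq|p q IHp IHq].
- rewrite mpoly.mmapC dC big1 // => k _.
  by rewrite mpoly.mderivC !raddf0 mul0r.
- rewrite mpoly.mmapX mpoly.mmap1U (bigD1 i) //= big1 => [|k ki].
    by rewrite mderiv_var eqxx !rmorph1 mul1r addr0.
  by rewrite mderiv_var (negPf ki) !raddf0 mul0r.
- rewrite raddfD dD IHp IHq -big_split /=; apply: eq_bigr => k _.
  by rewrite mpoly.mderivD !raddfD /= mulrDl.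
- rewrite rmorphM dM IHp IHq mulr_suml mulr_sumr -big_split /=; apply: eq_bigr => k _.
  rewrite mpoly.mderivM raddfD /= !rmorphM rmorphD !rmorphM /= mulrDl.
  by congr (_ + _); rewrite -!mulrA //; congr (_ * _); rewrite mulrC.
Qed.

Lemma rmorph_mmap (S S' : comNzRingType) (f : {rmorphism K -> S}) (g : {rmorphism S -> S'})
    (v : 'I_N -> S) (p : MP) :
  g (mpoly.mmap f v p) = mpoly.mmap (g \o f) (g \o v) p.
Proof.
elim/mpoly_alg_ind: p => [c|i|p q IHp IHq|p q IHp IHq].
- by rewrite !mpoly.mmapC.
- by rewrite !mpoly.mmapX !mpoly.mmap1U.
- by rewrite !raddfD /= IHp IHq.
- by rewrite !rmorphM /= IHp IHq.
Qed.

Lemma mmap_ext (S : comNzRingType) (f f' : {rmorphism K -> S}) (v v' : 'I_N -> S) (p : MP) :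
  f =1 f' -> v =1 v' -> mpoly.mmap f v p = mpoly.mmap f' v' p.
Proof.
move=> ff vv; elim/mpoly_alg_ind: p => [c|i|p q IHp IHq|p q IHp IHq].
- by rewrite !mpoly.mmapC; exact: ff.
- by rewrite !mpoly.mmapX !mpoly.mmap1U.
- by rewrite !raddfD /= IHp IHq.
- by rewrite !rmorphM /= IHp IHq.
Qed.

Lemma mmap_meval (v : 'I_N -> K) (p : MP) : mpoly.mmap idfun v p = mpoly.meval v p.
Proof. by []. Qed.

End MPolyTools.

(** * Polynomial functions of a matrix and tangent vectors *)

Section PolynomialFunctions.
Variables (R : realType) (n : nat).
Local Notation C := R[i].
Local Notation M := 'M[C]_n.

Lemma mxcoordE (A : M) i j : mxcoord A (mxvec_index i j) = A i j.
Proof. exact: mxvecE. Qed.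

(** Functions rather than polynomials, so that composing with matrix operations requires no explicit
    polynomial. *)
Definition polyfun (phi : M -> C) : Prop :=
  exists f : mpoly.mpoly (n * n) C, forall A, phi A = mxpolyeval f A.

Lemma polyfun_ext phi psi : phi =1 psi -> polyfun phi -> polyfun psi.
Proof. by move=> e [f hf]; exists f => A; rewrite -e. Qed.

Lemma polyfun_cst c : polyfun (fun _ => c).
Proof. by exists (mpoly.mpolyC _ c) => A; rewrite /mxpolyeval mpoly.mevalC. Qed.

Lemma polyfunD phi psi : polyfun phi -> polyfun psi -> polyfun (fun A => phi A + psi A).
Proof.
by move=> [f hf] [g hg]; exists (f + g) => A; rewrite /mxpolyeval mpoly.mevalD hf hg.
Qed.

Lemma polyfunM phi psi : polyfun phi -> polyfun psi -> polyfun (fun A => phi A * psi A).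
Proof.
by move=> [f hf] [g hg]; exists (f * g) => A; rewrite /mxpolyeval mpoly.mevalM hf hg.
Qed.

Lemma polyfun_sum (I : Type) (r : seq I) (P : pred I) (phi : I -> M -> C) :
  (forall i, P i -> polyfun (phi i)) -> polyfun (fun A => \sum_(i <- r | P i) phi i A).
Proof.
move=> h; elim: r => [|i r IH].
  by apply: polyfun_ext (polyfun_cst 0) => A; rewrite big_nil.
case Pi: (P i).
  by apply: polyfun_ext (polyfunD (h i Pi) IH) => A; rewrite big_cons Pi.
by apply: polyfun_ext IH => A; rewrite big_cons Pi.
Qed.

Lemma polyfun_prod (I : Type) (r : seq I) (P : pred I) (phi : I -> M -> C) :
  (forall i, P i -> polyfun (phi i)) -> polyfun (fun A => \prod_(i <- r | P i) phi i A).
Proof.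
move=> h; elim: r => [|i r IH].
  by apply: polyfun_ext (polyfun_cst 1) => A; rewrite big_nil.
case Pi: (P i).
  by apply: polyfun_ext (polyfunM (h i Pi) IH) => A; rewrite big_cons Pi.
by apply: polyfun_ext IH => A; rewrite big_cons Pi.
Qed.

Lemma polyfunX phi k : polyfun phi -> polyfun (fun A => phi A ^+ k).
Proof.
move=> h; elim: k => [|k IH]; first by apply: polyfun_ext (polyfun_cst 1).
by apply: polyfun_ext (polyfunM h IH) => A; rewrite exprS.
Qed.

Lemma polyfun_coord k : polyfun (fun A => mxcoord A k).
Proof.
by exists (mpoly.mpolyX _ (mpoly.mnm1 k)) => A; rewrite /mxpolyeval mpoly.mevalXU.
Qed.

Lemma polyfun_entry i j : polyfun (fun A => A i j).
Proof. by apply: polyfun_ext (polyfun_coord (mxvec_index i j)) => A; rewrite mxcoordE. Qed.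

Lemma polyfun_scalar (phi : M -> C) : scalar phi -> polyfun phi.
Proof.
move=> hphi; have [l le] := scalar_ex hphi.
apply: (@polyfun_ext (fun A => \sum_i \sum_j A i j * l (delta_mx i j))) => [A|].
  rewrite -le [in RHS](matrix_sum_delta A) linear_sum; apply: eq_bigr => i _.
  by rewrite linear_sum; apply: eq_bigr => j _; rewrite linearZ.
apply: polyfun_sum => i _; apply: polyfun_sum => j _.
by apply: polyfunM; [exact: polyfun_entry | exact: polyfun_cst].
Qed.

(** The parameter type [T] is free: pullbacks along polynomial curves, along polynomial maps and
    along maps involving the inverse matrix are all instances. *)
Lemma polyfun_ind (T : Type) (P : (T -> C) -> Prop) (Phi : T -> M) :
  (forall c, P (fun _ => c)) -> (forall f g, P f -> P g -> P (fun t => f t + g t)) ->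
  (forall f g, P f -> P g -> P (fun t => f t * g t)) ->
  (forall i j, P (fun t => Phi t i j)) ->
  forall phi, polyfun phi -> P (fun t => phi (Phi t)).
Proof.
move=> PC PD PM PX phi [f hf].
have -> : (fun t => phi (Phi t)) = (fun t => mxpolyeval f (Phi t)) by apply: funext.
rewrite /mxpolyeval.
elim/mpoly_alg_ind: f {hf} => [c|k|p q IHp IHq|p q IHp IHq].
- by have := PC c; congr P; apply: funext => t; rewrite mpoly.mevalC.
- case/mxvec_indexP: k => i j; have := PX i j; congr P; apply: funext => t.
  by rewrite mpoly.mevalXU mxcoordE.
- by have := PD _ _ IHp IHq; congr P; apply: funext => t; rewrite mpoly.mevalD.
- by have := PM _ _ IHp IHq; congr P; apply: funext => t; rewrite mpoly.mevalM.
Qed.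

Lemma polyfun_comp (Phi : M -> M) phi :
  (forall i j, polyfun (fun A => Phi A i j)) -> polyfun phi -> polyfun (fun A => phi (Phi A)).
Proof.
move=> hPhi; apply: polyfun_ind => //; [exact: polyfun_cst | exact: polyfunD | exact: polyfunM].
Qed.

Lemma polyfun_mulmx m p q (B : M -> 'M[C]_(m, p)) (D : M -> 'M[C]_(p, q)) :
  (forall i j, polyfun (fun A => B A i j)) -> (forall i j, polyfun (fun A => D A i j)) ->
  forall i j, polyfun (fun A => (B A *m D A) i j).
Proof.
move=> hB hD i j.
apply: (@polyfun_ext (fun A => \sum_k B A i k * D A k j)) => [A|]; first by rewrite mxE.
by apply: polyfun_sum => k _; apply: polyfunM.
Qed.

Lemma polyfun_det m (B : M -> 'M[C]_m) :
  (forall i j, polyfun (fun A => B A i j)) -> polyfun (fun A => \det (B A)).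
Proof.
move=> hB; rewrite /determinant; apply: polyfun_sum => s _.
by apply: polyfunM; [exact: polyfun_cst | apply: polyfun_prod].
Qed.

Lemma polyfun_adj m (B : M -> 'M[C]_m) :
  (forall i j, polyfun (fun A => B A i j)) -> forall i j, polyfun (fun A => (\adj (B A)) i j).
Proof.
move=> hB i j.
have h : polyfun (fun A => cofactor (B A) j i).
  rewrite /cofactor; apply: polyfunM; first exact: polyfun_cst.
  apply: polyfun_det => a b.
  by apply: polyfun_ext (hB (lift j a) (lift i b)) => A; rewrite !mxE.
by apply: polyfun_ext h => A; rewrite mxE.
Qed.

Definition vanishes (H : set M) (phi : M -> C) : Prop := forall A, H A -> phi A = 0.

Lemma zariski_closedP (H : set M) : zariski_closed H ->
  forall A, A \in unitmx -> (forall phi, polyfun phi -> vanishes H phi -> phi A = 0) -> H A.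
Proof.
move=> [S hS] A uA h; rewrite hS; split=> // f Sf.
apply: (h (mxpolyeval f)); first by exists f.
by move=> B; rewrite {1}hS => -[_]; apply.
Qed.

Lemma closed_polyfuns (Phi : set (M -> C)) : (forall phi, Phi phi -> polyfun phi) ->
  zariski_closed [set A | A \in unitmx /\ forall phi, Phi phi -> phi A = 0].
Proof.
move=> hPhi; exists [set f | exists2 phi, Phi phi & phi = mxpolyeval f].
apply/seteqP; split=> A /= [uA h]; split=> //.
  by move=> f [phi Pphi <-]; apply: h.
move=> phi Pphi; have [f hf] := hPhi _ Pphi.
by rewrite hf; apply: h; exists phi => //; apply: funext.
Qed.

Definition mxat (Mt : 'M[{poly C}]_n) (t : C) : M := map_mx (horner_eval t) Mt.

Lemma mxatE Mt t i j : mxat Mt t i j = (Mt i j).[t].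
Proof. by rewrite mxE /horner_eval. Qed.

Lemma polyfun_curve phi (Mt : 'M[{poly C}]_n) : polyfun phi ->
  exists q : {poly C}, forall t, phi (mxat Mt t) = q.[t].
Proof.
apply: (polyfun_ind (P := fun u => exists q : {poly C}, forall t, u t = q.[t])).
- by move=> c; exists c%:P => t; rewrite hornerC.
- by move=> f g [p hp] [q hq]; exists (p + q) => t; rewrite hornerD hp hq.
- by move=> f g [p hp] [q hq]; exists (p * q) => t; rewrite hornerM hp hq.
- by move=> i j; exists (Mt i j) => t; rewrite mxatE.
Qed.

(** The chain rule along a polynomial curve links the partial derivatives that define [Lie] to
    derivatives in one variable. *)
Lemma mxpolyeval_curve f (Mt : 'M[{poly C}]_n) : exists q : {poly C},
  (forall t, mxpolyeval f (mxat Mt t) = q.[t]) /\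
  q^`().[0] = \sum_(k < n * n) mxpolyeval (mpoly.mderiv k f) (mxat Mt 0)
                * mxcoord (mxat (map_mx deriv Mt) 0) k.
Proof.
pose v k := mxvec Mt 0 k.
have hv t k : (v k).[t] = mxcoord (mxat Mt t) k.
  by case/mxvec_indexP: k => i j; rewrite /v mxvecE mxcoordE mxatE.
exists (mpoly.mmap (@polyC C) v f).
have ev g t : mxpolyeval g (mxat Mt t) = (mpoly.mmap (@polyC C) v g).[t].
  rewrite -[RHS]/(horner_eval t _) (rmorph_mmap (@polyC C) (horner_eval t)).
  rewrite /mxpolyeval -mmap_meval; apply: (@mmap_ext _ _ _ idfun (horner_eval t \o @polyC C)).
    by move=> c /=; rewrite /horner_eval hornerC.
  by move=> k /=; rewrite /horner_eval hv.
split=> //; pose d (p : {poly C}) := p^`().[0].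
rewrite -[LHS]/(d (mpoly.mmap (@polyC C) v f)).
rewrite (@mmap_chain (n * n) C {poly C} C (@polyC C) (horner_eval 0) v d).
- apply: eq_bigr => k _; rewrite ev; congr (_ * _).
  by case/mxvec_indexP: k => i j; rewrite /d /v mxvecE mxcoordE !mxE.
- by move=> p q; rewrite /d derivD hornerD.
- by move=> p q; rewrite /d derivM hornerD !hornerM.
- by move=> c; rewrite /d derivC hornerC.
Qed.

Definition line (A X : M) : 'M[{poly C}]_n := map_mx polyC A + 'X *: map_mx polyC X.

Lemma mxat_line A X t : mxat (line A X) t = A + t *: X.
Proof. by apply/matrixP => i j; rewrite !mxE /horner_eval !hornerE. Qed.

(** Tangent vectors are tested on the lines [1 + t X]: this lemma and its converse [LieP] replace
    all partial derivatives from here on. *)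
Lemma Lie_line (H : set M) (X : M) phi (q : {poly C}) :
  Lie H X -> polyfun phi -> vanishes H phi ->
  (forall t, phi (1%:M + t *: X) = q.[t]) -> q^`().[0] = 0.
Proof.
move=> HX [f hf] vphi hq; have [q' [e d]] := mxpolyeval_curve f (line 1%:M X).
have -> : q = q'.
  by apply: poly_nat_inj => k; rewrite -hq -e hf mxat_line.
rewrite d -[RHS](HX f) => [|A HA]; last by rewrite -hf vphi.
apply: eq_bigr => k _; rewrite mxat_line scale0r addr0; congr (_ * _).
case/mxvec_indexP: k => i j.
by rewrite !mxcoordE !mxE /horner_eval !(derivD, derivC, derivM, derivX) !hornerE.
Qed.

Lemma LieP (H : set M) (X : M) :
  (forall phi (q : {poly C}), polyfun phi -> vanishes H phi ->
    (forall t, phi (1%:M + t *: X) = q.[t]) -> q^`().[0] = 0) -> Lie H X.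
Proof.
move=> h f vf; have [q [e d]] := mxpolyeval_curve f (line 1%:M X).
have e0 : q^`().[0] = 0.
  apply: (h (mxpolyeval f)) => //; first by exists f.
  by move=> t; rewrite -e mxat_line.
rewrite -[RHS]e0 d mxat_line scale0r addr0; apply: eq_bigr => k _; congr (_ * _).
case/mxvec_indexP: k => i j.
by rewrite !mxcoordE !mxE /horner_eval !(derivD, derivC, derivM, derivX) !hornerE.
Qed.

(** Natural parameters suffice, since a polynomial vanishing at all of them is 0. *)
Lemma Lie_curve (H : set M) (Mt : 'M[{poly C}]_n) :
  mxat Mt 0 = 1%:M -> (forall k : nat, H (mxat Mt k%:R)) -> Lie H (mxat (map_mx deriv Mt) 0).
Proof.
move=> M0 HM f vf; have [q [e d]] := mxpolyeval_curve f Mt.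
rewrite -M0 -d (_ : q = 0) ?deriv0 ?horner0 //.
by apply: poly_nat_eq0 => k; rewrite -e vf.
Qed.

Lemma Lie_linsub (H : set M) : linsub (Lie H).
Proof.
split=> [f _|a x y Hx Hy f vf].
  by rewrite big1 // => k _; case/mxvec_indexP: k => i j; rewrite mxcoordE mxE mulr0.
have := congr2 (fun u v => a * u + v) (Hx f vf) (Hy f vf).
rewrite mulr0 addr0 mulr_sumr -big_split => e0; rewrite -[RHS]e0; apply: eq_bigr => k _ /=.
by case/mxvec_indexP: k => i j; rewrite !mxcoordE !mxE; ring.
Qed.

Lemma LieS (H K : set M) : H `<=` K -> Lie H `<=` Lie K.
Proof. by move=> HK x Hx f vf; apply: Hx => A /HK; apply: vf. Qed.

Lemma Lie_scalar (H : set M) (l : M -> C) c x :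
  scalar l -> (forall A, H A -> l A = c) -> Lie H x -> l x = 0.
Proof.
move=> hl hc Hx; have [l' le] := scalar_ex hl.
have := @Lie_line H x (fun A => l A - c) ((l 1%:M - c)%:P + (l x) *: 'X) Hx.
rewrite derivD derivC add0r derivZ derivX !hornerE; apply.
- by apply: polyfunD; [exact: polyfun_scalar | exact: polyfun_cst].
- by move=> A HA; rewrite hc ?subrr.
- by move=> t; rewrite -!le linearD linearZ /= !hornerE; ring.
Qed.

End PolynomialFunctions.

(** * Jordan decomposition and exponentials *)

Section JordanChevalley.
Variable F : closedFieldType.

Lemma poly_crt (rs : seq F) (N : nat) : uniq rs ->
  exists S : {poly F}, forall r, r \in rs -> ('X - r%:P) ^+ N %| S - r%:P.
Proof.
elim: rs => [|r0 rs IH] /=; first by exists 0.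
move=> /andP [r0rs /IH [S hS]].
pose P := \prod_(r <- rs) ('X - r%:P) ^+ N.
have /Bezout_eq1_coprimepP [u hu] : coprimep P (('X - r0%:P) ^+ N).
  apply: coprimep_expr; rewrite coprimep_XsubC rootE horner_prod prodf_seq_neq0.
  apply/allP => r rrs /=; rewrite horner_exp !hornerE expf_neq0 // subr_eq0.
  by apply: contraNneq r0rs => ->.
exists (S + P * (u.1 * (r0%:P - S))) => r; rewrite inE => /orP [/eqP ->|rrs].
  have -> : S + P * (u.1 * (r0%:P - S)) - r0%:P = ('X - r0%:P) ^+ N * (u.2 * (S - r0%:P)).
    transitivity ((S - r0%:P) * (1 - u.1 * P)); first by ring.
    by rewrite -hu; ring.
  exact: dvdp_mulr.
rewrite addrAC dvdp_add ?hS // dvdp_mulr // /P (big_rem r) //=.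
exact: dvdp_mulr.
Qed.

(** The semisimple part is [S(x)] for a polynomial [S] congruent to each eigenvalue [r] modulo a
    high power of [X - r], so it commutes with the commutant of [x]. The product of the [S - r] is a
    multiple of the characteristic polynomial, which makes [S(x)] diagonalizable; [X - S] is
    divisible by every [X - r], which makes [x - S(x)] nilpotent. *)
Lemma jordan_chevalley (n : nat) (x : 'M[F]_n) : exists (Q : 'M[F]_n) (lam : 'rV[F]_n),
  let s := invmx Q *m diag_mx lam *m Q in
  [/\ Q \in unitmx, forall B, B *m x = x *m B -> B *m s = s *m B & exists k, (x - s) ^+ k = 0].
Proof.
case: n x => [|n] x.
  exists 1%:M, 0; split; first exact: unitmx1.
    by move=> B _; apply/matrixP => -[].
  by exists 1%N; apply/matrixP => -[].
have [rs hrs] := closed_field_poly_normal (char_poly x).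
rewrite (monicP (char_poly_monic x)) scale1r in hrs.
have szrs : size rs = n.+1.
  by have := size_char_poly x; rewrite hrs size_prod_XsubC => -[].
have [S hS] := poly_crt n.+1 (undup_uniq rs).
pose s := horner_mx x S.
have dvd1 p : (forall r, r \in undup rs -> ('X - r%:P) %| p) -> char_poly x %| p ^+ n.+1.
  move=> hp; rewrite hrs -szrs.
  elim: {hrs szrs hS} rs hp => [|r rs IH] hp; first by rewrite big_nil dvd1p.
  rewrite big_cons exprS dvdp_mul //; first by apply: hp; rewrite mem_undup mem_head.
  by apply: IH => r'; rewrite mem_undup => r's; apply: hp; rewrite mem_undup inE r's orbT.
have zero p : char_poly x %| p -> horner_mx x p = 0.
  by move/dvdpP => [q ->]; rewrite rmorphM /= Cayley_Hamilton mulr0.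
have [P Pu /(diagonalizable_forLR Pu) [d sd]] : diagonalizable s.
  apply/diagonalizableP; exists (undup rs); first exact: undup_uniq.
  apply: mxminpoly_min; rewrite rmorph_prod /=.
  transitivity (horner_mx x (\prod_(r <- undup rs) (S - r%:P))).
    rewrite [RHS]rmorph_prod; apply: eq_bigr => r _.
    by rewrite !rmorphB /= horner_mx_X !horner_mx_C.
  apply: zero; apply: (@dvdp_trans _ (\prod_(r <- undup rs) ('X - r%:P) ^+ n.+1)).
    rewrite prodrXl; apply: dvd1 => r rrs.
    by rewrite (big_rem r) //= dvdp_mulr.
  elim: (undup rs) hS => [|r l IH] hS; first by rewrite !big_nil.
  rewrite !big_cons dvdp_mul ?hS ?mem_head //; apply: IH => r' r'l.
  by apply: hS; rewrite inE r'l orbT.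
have sE : invmx P *m diag_mx d *m P = s by rewrite sd mxpoly.conjVmx.
exists P, d; rewrite /= sE; split=> // [B Bx|].
  by have := comm_mx_horner S Bx.
exists n.+1; rewrite -[x in x - _]horner_mx_X -rmorphB -rmorphXn /=.
apply: zero; apply: dvd1 => r rrs.
have -> : 'X - S = ('X - r%:P) - (S - r%:P) by ring.
rewrite dvdp_sub //; apply: dvdp_trans (hS r rrs).
by rewrite exprS dvdp_mulr.
Qed.

End JordanChevalley.

(** * Derivations of matrix products and exponentials of nilpotent matrices *)

Section Derivations.
Variables (S : comNzRingType) (d : S -> S).
Hypothesis dD : {morph d : x y / x + y}.
Hypothesis dM : forall x y, d (x * y) = d x * y + x * d y.

Lemma derivation0 : d 0 = 0.
Proof. by apply: (addIr (d 0)); rewrite -dD !add0r. Qed.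

Lemma derivation_sum (I : Type) (r : seq I) (P : pred I) (f : I -> S) :
  d (\sum_(i <- r | P i) f i) = \sum_(i <- r | P i) d (f i).
Proof. by apply: (big_morph d dD derivation0). Qed.

Lemma derivation_mulmx m n p (A : 'M[S]_(m, n)) (B : 'M[S]_(n, p)) :
  map_mx d (A *m B) = map_mx d A *m B + A *m map_mx d B.
Proof.
apply/matrixP => i j; rewrite !mxE derivation_sum -big_split /=.
by apply: eq_bigr => k _; rewrite dM !mxE.
Qed.

(** The shape is that of a curve [Q^-1 * diag * Q * exp(t N)], in which only the diagonal factor and
    the last one vary. *)
Lemma derivation_mulmx4 n (A D D' B E N : 'M[S]_n) :
  map_mx d A = 0 -> map_mx d B = 0 -> map_mx d D = D *m D' -> map_mx d E = E *m N ->
  map_mx d (A *m D *m B *m E) = A *m D *m (D' *m B) *m E + A *m D *m B *m E *m N.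
Proof.
move=> dA dB eD dE; rewrite !derivation_mulmx dA dB eD dE.
by rewrite mul0mx mulmx0 addr0 add0r !mulmxA.
Qed.

Lemma mulmx4_comm n (A D D' B E s : 'M[S]_n) : B *m A = 1%:M -> s = A *m D' *m B ->
  s *m E = E *m s -> A *m D *m (D' *m B) *m E = A *m D *m B *m E *m s.
Proof.
move=> BA -> com; rewrite -[RHS]mulmxA -com !mulmxA; congr (_ *m E).
by rewrite -[A *m D *m B *m A]mulmxA BA mulmx1.
Qed.
End Derivations.

Section NilpotentExponential.
Variables (F : numFieldType) (n : nat).

(* [nexp f K N T] is the exponential of [T N] truncated at order [K], with scalars
   extended along [f]; it is the exponential when [N ^+ K = 0]. *)
Definition nexp (S : comNzRingType) (f : {rmorphism F -> S}) (K : nat) (N : 'M[F]_n) (T : S) :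
    'M[S]_n :=
  \sum_(k < K) T ^+ k *: map_mx f ((k`!%:R)^-1 *: (N ^+ k : 'M_n)).

Lemma nexp_map (S S' : comNzRingType) (f : {rmorphism F -> S}) (g : {rmorphism S -> S'}) K N T :
  map_mx g (nexp f K N T) = nexp (g \o f : {rmorphism F -> S'}) K N (g T).
Proof.
rewrite /nexp; apply/matrixP => i j; rewrite !mxE !summxE rmorph_sum.
by apply: eq_bigr => k _; rewrite !mxE !rmorphM rmorphXn.
Qed.

Lemma nexp0 (S : comNzRingType) (f : {rmorphism F -> S}) K N : nexp f K.+1 N 0 = 1%:M.
Proof.
rewrite /nexp big_ord_recl big1 => [|k _]; last by rewrite expr0n scale0r.
by rewrite expr0 scale1r fact0 invr1 scale1r addr0 map_mx1.
Qed.

Lemma nexp_deriv (S : comNzRingType) (f : {rmorphism F -> S}) (d : S -> S) K (N : 'M[F]_n) T :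
  {morph d : x y / x + y} -> (forall x y, d (x * y) = d x * y + x * d y) ->
  (forall c, d (f c) = 0) -> d T = 1 -> N ^+ K = 0 ->
  map_mx d (nexp f K N T) = nexp f K N T *m map_mx f N.
Proof.
move=> dD dM dC dT NK.
have dX k : d (T ^+ k) = T ^+ k.-1 *+ k.
  elim: k => [|k IH]; first by rewrite expr0 mulr0n -(rmorph1 f) dC.
  rewrite exprS dM dT IH mul1r /= mulrS; congr (_ + _).
  by case: k {IH} => [|k]; rewrite ?mulr0n ?mulr0 // mulrnAr -exprS.
have dsum := derivation_sum dD.
have -> : map_mx d (nexp f K N T) =
    \sum_(k < K) (T ^+ k.-1 *+ k) *: map_mx f ((k`!%:R)^-1 *: (N ^+ k : 'M_n)).
  rewrite /nexp; apply/matrixP => i j; rewrite !mxE !summxE dsum.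
  by apply: eq_bigr => k _; rewrite !mxE dM dX dC mulr0 addr0.
rewrite /nexp mulmx_suml; case: K NK => [|K] NK; first by rewrite !big_ord0.
rewrite big_ord_recl /= mulr0n scale0r add0r big_ord_recr /=.
have -> : (T ^+ K *: map_mx f (K`!%:R^-1 *: (N ^+ K : 'M_n))) *m map_mx f N = 0.
  rewrite -scalemxAl -map_mxM -scalemxAl; have -> : N ^+ K *m N = 0 by rewrite -NK exprSr.
  by rewrite scaler0 raddf0 scaler0.
rewrite addr0; apply: eq_bigr => k _; rewrite /bump /= add1n.
rewrite -scalemxAl -map_mxM -scalemxAl (_ : N ^+ k *m N = N ^+ k.+1); last by rewrite exprSr.
rewrite -scalerMnl scalerMnr; congr (_ *: _); rewrite -raddfMn scalerMnl; congr (map_mx f (_ *: _)).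
by rewrite factS natrM invfM mulrC -mulr_natr -mulrA mulVf ?mulr1 // pnatr_eq0.
Qed.

(** The product of the two curves has derivative 0, so it keeps its value at 0. *)
Lemma nexpN (K : nat) (N : 'M[F]_n) t : N ^+ K = 0 -> (0 < K)%N ->
  nexp idfun K N t *m nexp idfun K (- N) t = 1%:M.
Proof.
case: K => // K NK _.
have NNK : (- N) ^+ K.+1 = 0 by rewrite exprNn NK mulr0.
pose E := nexp (@polyC F) K.+1 N 'X; pose E' := nexp (@polyC F) K.+1 (- N) 'X.
have dD : {morph @deriv F : x y / x + y} by move=> x y; rewrite derivD.
have dM (x y : {poly F}) : deriv (x * y) = deriv x * y + x * deriv y by rewrite derivM.
have dC c : deriv (polyC c : {poly F}) = 0 by rewrite derivC.
have dT : deriv ('X : {poly F}) = 1 by rewrite derivX.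
have com : E' *m map_mx polyC N = map_mx polyC N *m E'.
  rewrite /E' /nexp mulmx_suml mulmx_sumr; apply: eq_bigr => k _.
  rewrite -scalemxAl -scalemxAr -!map_mxM -scalemxAl -scalemxAr.
  suff -> : (- N) ^+ k *m N = N *m (- N) ^+ k by [].
  by apply/esym; apply: (@commrX _ N (- N) k); apply: commrN.
have dP : map_mx deriv (E *m E') = 0.
  rewrite (derivation_mulmx dD dM).
  have -> : map_mx deriv E = E *m map_mx polyC N.
    exact: (@nexp_deriv _ (@polyC F) (@deriv F) K.+1 N 'X dD dM dC dT NK).
  have -> : map_mx deriv E' = E' *m map_mx polyC (- N).
    exact: (@nexp_deriv _ (@polyC F) (@deriv F) K.+1 (- N) 'X dD dM dC dT NNK).
  by rewrite raddfN /= !mulmxN com mulmxA subrr.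
have PE s : map_mx (horner_eval s) (E *m E') = nexp idfun K.+1 N s *m nexp idfun K.+1 (- N) s.
  have hs : horner_eval s 'X = s by rewrite /horner_eval hornerX.
  rewrite map_mxM !nexp_map /nexp /= hs.
  by congr (_ *m _); apply: eq_bigr => k _; congr (_ *: _); apply/matrixP => i j;
     rewrite !mxE /= /horner_eval hornerC.
rewrite -PE; have <- : map_mx (horner_eval 0) (E *m E') = 1%:M by rewrite PE !nexp0 mulmx1.
apply/matrixP => i j; rewrite ![map_mx _ _ _ _]mxE /horner_eval.
rewrite (deriv_eq0 (p := (E *m E') i j)) ?hornerC //.
by have /matrixP /(_ i j) := dP; rewrite !mxE.
Qed.

End NilpotentExponential.

(** * Exponential polynomials with formal exponentials *)

Section ExponentialPolynomials.
Variable F : numFieldType.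

(* [exp (mu t) * twist mu q] is the derivative of [exp (mu t) * q]. *)
Definition twist (mu : F) (q : {poly F}) : {poly F} := q^`() + mu *: q.

Lemma twist0 mu : twist mu 0 = 0.
Proof. by rewrite /twist deriv0 scaler0 addr0. Qed.

Lemma twistD mu p q : twist mu (p + q) = twist mu p + twist mu q.
Proof. by rewrite /twist derivD scalerDr addrACA. Qed.

Lemma twistB mu c p q : twist mu (p - c *: q) = twist mu p - c *: twist mu q.
Proof. by rewrite /twist derivB derivZ -!mul_polyC; ring. Qed.

Lemma size_deriv_char0 (q : {poly F}) : q != 0 -> (size q^`() < size q)%N.
Proof. exact: lt_size_deriv. Qed.

(** Induction on the total size: applying [d/dt - nu], for a nonzero [q nu], lowers the degree of
    [q nu] and raises no other. This is the linear independence of the functions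
    [exp (mu t) * q(t)], tested only by derivatives at 0. *)
Lemma exp_poly_indep (ws : seq F) (q : F -> {poly F}) : uniq ws ->
  (forall k, \sum_(mu <- ws) (iter k (twist mu) (q mu)).[0] = 0) ->
  forall mu, mu \in ws -> q mu = 0.
Proof.
move=> uws; have [N leN] := ubnP (\sum_(mu <- ws) size (q mu))%N.
elim: N q leN => // N IH q leN hq.
have [/allP h|/allPn [nu nuws nunz]] := boolP (all (fun mu => q mu == 0) ws).
  by move=> mu /h /eqP.
pose q' mu := twist (mu - nu) (q mu).
have iter_q' k mu : iter k (twist mu) (q' mu) =
    iter k.+1 (twist mu) (q mu) - nu *: iter k (twist mu) (q mu).
  elim: k => [|k IHk]; first by rewrite /= /q' /twist scalerBl addrA.
  by rewrite iterS IHk twistB.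
have sz mu : (size (q' mu) <= size (q mu))%N.
  rewrite /q' /twist; have [->|qnz] := eqVneq (q mu) 0.
    by rewrite deriv0 scaler0 addr0.
  apply: leq_trans (size_polyD _ _) _; rewrite geq_max (ltnW (size_deriv_char0 qnz)) /=.
  exact: size_scale_leq.
have q'0 : forall mu, mu \in ws -> q' mu = 0.
  apply: IH => [|k].
    rewrite -ltnS; apply: leq_trans leN; rewrite ltnS.
    rewrite (big_rem nu) //= [X in (_ < X)%N](big_rem nu) //= -addSn leq_add //.
      by rewrite /q' subrr /twist scale0r addr0 size_deriv_char0.
    by apply: leq_sum => i _; exact: sz.
  rewrite (eq_bigr (fun mu => (iter k.+1 (twist mu) (q mu)).[0] - nu * (iter k (twist mu) (q mu)).[0])).
    by rewrite sumrB -mulr_sumr !hq mulr0 subrr.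
  by move=> mu _; rewrite iter_q' !hornerE.
(* For [mu != nu] the polynomial [(mu - nu) q] has larger degree than the derivative of [q], so
   [twist (mu - nu)] is injective. *)
have q0 mu : mu \in ws -> mu != nu -> q mu = 0.
  move=> muws munu; apply/eqP; apply: contraT => qnz.
  have := size_deriv_char0 qnz; have /eqP := q'0 mu muws.
  rewrite /q' /twist addr_eq0 => /eqP ->; rewrite size_polyN size_scale ?ltnn //.
  by rewrite subr_eq0.
have := hq 0%N; rewrite (big_rem nu) //= big_seq big1 => [|mu]; last first.
  by rewrite mem_rem_uniq // inE => /andP [munu muws]; rewrite q0 // horner0.
rewrite addr0 => qnu0; have := q'0 nu nuws.
rewrite /q' subrr /twist scale0r addr0 => /deriv_eq0; rewrite qnu0 => e.
by rewrite e eqxx in nunz.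
Qed.

Variables (r : nat) (lam : 'I_r -> F).
Local Notation S := (mpoly.mpoly r {poly F}).

(** The ring [S] models functions of [t]: the variable of [{poly F}] is [t], and the variable of
    index [j] is [exp (lam j * t)]. The monomial [m] then stands for [exp (mweight m * t)], and
    [expderiv] is [d/dt]. *)
Definition mweight (m : mpoly.multinom r) : F := \sum_j lam j *+ m j.

Definition expderiv (p : S) : S :=
  \sum_(m <- mpoly.msupp p)
     mpoly.mpolyC r (twist (mweight m) (mpoly.mcoeff m p)) * mpoly.mpolyX _ m.

Lemma mcoeff_expderiv m p :
  mpoly.mcoeff m (expderiv p) = twist (mweight m) (mpoly.mcoeff m p).
Proof.
rewrite /expderiv raddf_sum /=.
rewrite (eq_bigr (fun m' => twist (mweight m') (mpoly.mcoeff m' p) *+ (m' == m))); last first.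
  by move=> m' _; rewrite mpoly.mcoeffCM mpoly.mcoeffX mulr_natr.
have [msp|msp] := boolP (m \in mpoly.msupp p).
  rewrite (big_rem m) //= eqxx big_seq big1 ?addr0 // => m'.
  by rewrite mem_rem_uniq ?mpoly.msupp_uniq // inE => /andP [/negPf -> _].
rewrite mpoly.memN_msupp_eq0 // twist0 big_seq big1 // => m' m's.
by case: eqP => // e; rewrite -e m's in msp.
Qed.

Lemma expderivD : {morph expderiv : p q / p + q}.
Proof.
move=> p q; apply/mpoly.mpolyP => m; rewrite mpoly.mcoeffD !mcoeff_expderiv mpoly.mcoeffD.
by rewrite /twist derivD scalerDr addrACA.
Qed.

Lemma expderivM p q : expderiv (p * q) = expderiv p * q + p * expderiv q.
Proof.
apply/mpoly.mpolyP => m; rewrite mpoly.mcoeffD !mcoeff_expderiv !mpoly.mcoeffM.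
rewrite -big_split /= /twist raddf_sum scaler_sumr -big_split /=.
apply: eq_bigr => k /eqP mk; rewrite !mcoeff_expderiv /twist derivM.
have -> : mweight m = mweight k.1 + mweight k.2.
  rewrite [in LHS]mk -big_split; apply: eq_bigr => j _; by rewrite mpoly.mnmDE mulrnDr.
by rewrite -!mul_polyC rmorphD /=; ring.
Qed.

Lemma expderivC c : expderiv (mpoly.mpolyC r c%:P) = 0.
Proof.
apply/mpoly.mpolyP => m; rewrite mcoeff_expderiv mpoly.mcoeff0 mpoly.mcoeffC.
have [->|_] := eqVneq m mpoly.mnm0; last by rewrite mulr0 twist0.
rewrite mulr1 /twist derivC add0r /mweight big1 ?scale0r // => j _.
by rewrite mpoly.mnm0E mulr0n.
Qed.

Lemma expderivT : expderiv (mpoly.mpolyC r 'X) = 1.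
Proof.
apply/mpoly.mpolyP => m; rewrite mcoeff_expderiv mpoly.mcoeffC mpoly.mcoeff1.
have [->|_] := eqVneq m mpoly.mnm0; last by rewrite mulr0 twist0.
rewrite mulr1 /twist derivX /mweight big1 ?scale0r ?addr0 // => j _.
by rewrite mpoly.mnm0E mulr0n.
Qed.

Lemma expderivX j : expderiv (mpoly.mpolyX _ (mpoly.mnm1 j)) =
  mpoly.mpolyC r (lam j)%:P * mpoly.mpolyX _ (mpoly.mnm1 j).
Proof.
apply/mpoly.mpolyP => m; rewrite mcoeff_expderiv mpoly.mcoeffCM mpoly.mcoeffX.
have [<-|_] := eqVneq (mpoly.mnm1 j) m; last by rewrite mulr0 twist0.
rewrite /twist derivC add0r -mul_polyC mulr1 mulr1; congr (_%:P).
rewrite /mweight (bigD1 j) //= mpoly.mnm1E eqxx mulr1n big1 ?addr0 // => i ij.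
by rewrite mpoly.mnm1E eq_sym (negPf ij) mulr0n.
Qed.

Definition mweights (p : S) : seq F := undup (map mweight (mpoly.msupp p)).

(** Different monomials have the same weight as soon as the [lam j] satisfy integral relations, so a
    function of [t] determines only these sums and not the single coefficients. *)
Definition mpart (p : S) (mu : F) : {poly F} :=
  \sum_(m <- mpoly.msupp p | mweight m == mu) mpoly.mcoeff m p.

Lemma msum_by_weight (V : nmodType) (p : S) (G : F -> {poly F} -> V) :
  (forall mu, G mu 0 = 0) -> (forall mu, {morph G mu : x y / x + y}) ->
  \sum_(m <- mpoly.msupp p) G (mweight m) (mpoly.mcoeff m p) =
  \sum_(mu <- mweights p) G mu (mpart p mu).
Proof.
move=> G0 GD; rewrite (eq_bigr (fun mu => \sum_(m <- mpoly.msupp p | mweight m == mu)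
   G mu (mpoly.mcoeff m p))); last first.
  by move=> mu _; rewrite /mpart (big_morph (G mu) (GD mu) (G0 mu)).
rewrite (exchange_big_dep predT) //= big_seq [RHS]big_seq; apply: eq_bigr => m msp.
rewrite big_mkcond (bigD1_seq (mweight m)) /= ?undup_uniq ?mem_undup ?map_f // eqxx.
by rewrite big1 ?addr0 // => mu; rewrite eq_sym => /negPf ->.
Qed.

Definition expeval (t : F) (z : 'I_r -> F) (p : S) : F := mpoly.mmap (horner_eval t) z p.

Lemma expevalE t z p (chi : F -> F) :
  (forall m : mpoly.multinom r, \prod_j z j ^+ m j = chi (mweight m)) ->
  expeval t z p = \sum_(mu <- mweights p) chi mu * (mpart p mu).[t].
Proof.
move=> hz; rewrite -(msum_by_weight p (G := fun mu q => chi mu * q.[t])).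
- by apply: eq_bigr => m _; rewrite /horner_eval mulrC -hz.
- by move=> mu; rewrite horner0 mulr0.
- by move=> mu x y; rewrite hornerD mulrDr.
Qed.

Lemma expeval1_iter k p :
  expeval 0 (fun => 1) (iter k expderiv p) =
  \sum_(mu <- mweights p) (iter k (twist mu) (mpart p mu)).[0].
Proof.
have coef m : mpoly.mcoeff m (iter k expderiv p) = iter k (twist (mweight m)) (mpoly.mcoeff m p).
  by elim: k => //= k IH; rewrite mcoeff_expderiv IH.
have tw0 mu : iter k (twist mu) 0 = 0 by elim: k {coef} => //= k ->; rewrite twist0.
have twD mu : {morph iter k (twist mu) : x y / x + y}.
  move=> x y; elim: k {coef tw0} => //= k ->.
  by rewrite /twist derivD scalerDr addrACA.
rewrite -(msum_by_weight p (G := fun mu q => (iter k (twist mu) q).[0])); last 2 first.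
- by move=> mu; rewrite tw0 horner0.
- by move=> mu x y; rewrite twD hornerD.
rewrite /expeval /mpoly.mmap.
transitivity (\sum_(m <- mpoly.msupp (iter k expderiv p)) (mpoly.mcoeff m (iter k expderiv p)).[0]).
  apply: eq_bigr => m _; rewrite /horner_eval /mpoly.mmap1 big1 ?mulr1 // => j _.
  by rewrite expr1n.
have sub : {subset mpoly.msupp (iter k expderiv p) <= mpoly.msupp p}.
  move=> m; rewrite !mpoly.mcoeff_msupp coef; apply: contraNneq => ->.
  by rewrite tw0.
rewrite [RHS](eq_bigr (fun m => (mpoly.mcoeff m (iter k expderiv p)).[0])); last first.
  by move=> m _; rewrite coef.
rewrite [RHS](bigID (fun m => m \in mpoly.msupp (iter k expderiv p))) /=.
rewrite [X in _ = _ + X]big1 ?addr0 => [|m /mpoly.memN_msupp_eq0 ->]; last by rewrite horner0.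
rewrite -[RHS]big_filter; apply: perm_big; apply: uniq_perm.
- exact: mpoly.msupp_uniq.
- by rewrite filter_uniq // mpoly.msupp_uniq.
by move=> m; rewrite mem_filter andb_idr // => /sub.
Qed.

Lemma exp_parts_eq0 p :
  (forall k, expeval 0 (fun => 1) (iter k expderiv p) = 0) ->
  forall mu, mu \in mweights p -> mpart p mu = 0.
Proof.
move=> h; apply: exp_poly_indep; first exact: undup_uniq.
by move=> k; rewrite -expeval1_iter.
Qed.

End ExponentialPolynomials.

(** * Nilpotent traces, commutants and Vandermonde systems *)

Section MatrixLemmas.

Lemma mxtrace_nilpotent (F : closedFieldType) n (A : 'M[F]_n) k : A ^+ k = 0 -> \tr A = 0.
Proof.
case: n A => [|n] A Ak; first by rewrite /mxtrace big_ord0.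
have [rs hrs] := closed_field_poly_normal (char_poly A).
rewrite (monicP (char_poly_monic A)) scale1r in hrs.
have rs0 z : z \in rs -> z = 0.
  move=> zrs; have : eigenvalue A z.
    by rewrite eigenvalue_root_char hrs root_prod_XsubC.
  case/eigenvalueP => v vA v0.
  have vAk j : v *m A ^+ j = z ^+ j *: v.
    elim: j => [|j IH]; first by rewrite !expr0 mulmx1 scale1r.
    have -> : A ^+ j.+1 = A *m A ^+ j by rewrite exprS.
    by rewrite mulmxA vA -scalemxAl IH scalerA -exprS.
  have /eqP := vAk k; rewrite Ak mulmx0 eq_sym scaler_eq0 (negPf v0) orbF.
  by rewrite expf_eq0 => /andP [_ /eqP].
have szrs : size rs = n.+1.
  by have := size_char_poly A; rewrite hrs size_prod_XsubC => -[].
have := char_poly_trace A (ltn0Sn n); rewrite hrs big_seq.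
rewrite (eq_bigr (fun=> 'X)) => [|z /rs0 ->]; last by rewrite subr0.
rewrite -big_seq big_const_seq count_predT szrs iter_mulr_1 coefXn /= => /eqP.
by rewrite ltn_eqF // eq_sym oppr_eq0 => /eqP.
Qed.

(** [B] has nonzero entries only at positions where [lam] agrees, hence where [mu] agrees. *)
Lemma diag_comm_fun (F : fieldType) n (lam mu : 'rV[F]_n) (B : 'M[F]_n) :
  (forall i j, lam 0 i = lam 0 j -> mu 0 i = mu 0 j) ->
  B *m diag_mx lam = diag_mx lam *m B -> B *m diag_mx mu = diag_mx mu *m B.
Proof.
move=> h /matrixP e; apply/matrixP => i j; have := e i j.
rewrite !mul_mx_diag !mul_diag_mx !mxE => /eqP; rewrite mulrC -subr_eq0 -mulrBl mulf_eq0.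
case/orP => [|/eqP ->]; last by rewrite mul0r mulr0.
by rewrite subr_eq0 => /eqP /h ->; rewrite mulrC.
Qed.

Lemma conj_comm_fun (F : fieldType) n (Q B : 'M[F]_n) (lam mu : 'rV[F]_n) :
  Q \in unitmx -> (forall i j, lam 0 i = lam 0 j -> mu 0 i = mu 0 j) ->
  B *m (invmx Q *m diag_mx lam *m Q) = (invmx Q *m diag_mx lam *m Q) *m B ->
  B *m (invmx Q *m diag_mx mu *m Q) = (invmx Q *m diag_mx mu *m Q) *m B.
Proof.
move=> Qu h e; pose B' := Q *m B *m invmx Q.
have BE : B = invmx Q *m B' *m Q by rewrite /B' !mulmxA mulVmx // mul1mx mulmxKV.
have mulE (D D' : 'M[F]_n) : (invmx Q *m D *m Q) *m (invmx Q *m D' *m Q) = invmx Q *m (D *m D') *m Q.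
  by rewrite !mulmxA mulmxK.
move: e; rewrite BE !mulE => e; congr (_ *m _ *m _); apply: (diag_comm_fun h).
have := congr1 (fun Z => Q *m Z *m invmx Q) e.
by rewrite !mulmxA !mulmxV // !mul1mx !mulmxK.
Qed.

(** Combine the relations with the coefficients of a product of linear factors that vanishes at all
    the nodes but one. *)
Lemma vandermonde_indep (F : fieldType) (T : eqType) (ws : seq T) (c a : T -> F) :
  uniq ws -> {in ws &, injective c} ->
  (forall k, \sum_(x <- ws) c x ^+ k * a x = 0) -> forall x, x \in ws -> a x = 0.
Proof.
move=> uws injc h x xws.
have hp (p : {poly F}) : \sum_(y <- ws) p.[c y] * a y = 0.
  under eq_bigr do rewrite horner_coef mulr_suml.
  rewrite exchange_big big1 //= => i _; under eq_bigr do rewrite -mulrA.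
  by rewrite -mulr_sumr h mulr0.
pose p := \prod_(y <- ws | y != x) ('X - (c y)%:P).
have := hp p; rewrite (bigD1_seq x) //= big_seq_cond big1 ?addr0 => [|y /andP [yws yx]].
  move/eqP; rewrite mulf_eq0 => /orP [|/eqP //].
  rewrite horner_prod prodf_seq_eq0 => /hasP [y yws /andP [yx]].
  rewrite !hornerE subr_eq0 => /eqP /(injc _ _ xws yws) e.
  by rewrite e eqxx in yx.
suff -> : p.[c y] = 0 by rewrite mul0r.
apply/eqP; rewrite horner_prod prodf_seq_eq0; apply/hasP; exists y => //.
by rewrite yx !hornerE subrr eqxx.
Qed.

End MatrixLemmas.

(** * Polynomials along the formal exponential of a matrix *)

Section LieExponential.
Variables (C : numFieldType) (n : nat).
Local Notation M := 'M[C]_n.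
Local Notation MP := (mpoly.mpoly (n * n) C).

Definition mxpeval (p : MP) (A : M) : C := mpoly.meval (fun k => mxvec A 0 k) p.

Definition mxsub_poly (S : comNzRingType) (f : {rmorphism C -> S}) (g : 'M[S]_n) (p : MP) : S :=
  mpoly.mmap f (fun k => mxvec g 0 k) p.

Lemma mxsub_poly_eval (S : comNzRingType) (f : {rmorphism C -> S}) (h : {rmorphism S -> C}) g p :
  h \o f =1 id -> h (mxsub_poly f g p) = mxpeval p (map_mx h g).
Proof.
move=> hf; rewrite /mxsub_poly rmorph_mmap /mxpeval -mmap_meval.
apply: (@mmap_ext _ _ _ (h \o f) idfun) => // k.
by case/mxvec_indexP: k => i j /=; rewrite !mxvecE mxE.
Qed.

Definition genmx : 'M[MP]_n := vec_mx (\row_k mpoly.mpolyX C (mpoly.mnm1 k)).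

(* The left-invariant derivation attached to [X]: its value at [A] is the
   differential at [A] in the direction [A X]. *)
Definition invderiv (X : M) (p : MP) : MP :=
  \sum_k mpoly.mderiv k p * mxvec (genmx *m map_mx (@mpoly.mpolyC (n * n) C) X) 0 k.

Lemma mxsub_poly_invderiv (S : comNzRingType) (f : {rmorphism C -> S}) g X p :
  mxsub_poly f g (invderiv X p) =
  \sum_k mxsub_poly f g (mpoly.mderiv k p) * mxvec (g *m map_mx f X) 0 k.
Proof.
rewrite /invderiv /mxsub_poly raddf_sum /=; apply: eq_bigr => k _; rewrite rmorphM /=.
congr (_ * _); case/mxvec_indexP: k => i j; rewrite !mxvecE !mxE raddf_sum /=.
apply: eq_bigr => l _; rewrite rmorphM /= !mxE mpoly.mmapC mpoly.mmapX mpoly.mmap1U.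
by rewrite mxvecE.
Qed.

Lemma mxsub_poly_deriv (S : comNzRingType) (f : {rmorphism C -> S}) (d : S -> S) g X p :
  {morph d : x y / x + y} -> (forall x y, d (x * y) = d x * y + x * d y) ->
  (forall c, d (f c) = 0) -> map_mx d g = g *m map_mx f X ->
  d (mxsub_poly f g p) = mxsub_poly f g (invderiv X p).
Proof.
move=> dD dM dC dg; rewrite mxsub_poly_invderiv /mxsub_poly.
rewrite (@mmap_chain _ _ _ _ f idfun _ d dD dM dC); apply: eq_bigr => k _; congr (_ * _).
by rewrite -dg; case/mxvec_indexP: k => i j; rewrite !mxvecE mxE.
Qed.

Lemma mxpeval_invderiv X p A :
  mxpeval (invderiv X p) A =
  \sum_k mxpeval (mpoly.mderiv k p) A * mxvec (A *m X) 0 k.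
Proof.
have ev q B : mxpeval q B = mxsub_poly idfun B q by [].
by rewrite ev mxsub_poly_invderiv map_mx_id.
Qed.

Section JordanData.
Variables (X Q N : M) (lam : 'rV[C]_n) (K : nat).
Let s := invmx Q *m diag_mx lam *m Q.
Hypothesis (Qu : Q \in unitmx) (XE : X = s + N) (com : s *m N = N *m s).
Hypothesis (NK : N ^+ K = 0) (K0 : (0 < K)%N).

Local Notation S := (mpoly.mpoly n {poly C}).

Definition expconst : {rmorphism C -> S} := @mpoly.mpolyC n {poly C} \o (@polyC C).

(** The exponential of [t X] in which each [exp (lam j * t)] has become a free variable. These
    variables can then be specialised independently of [t]. *)
Definition expgen : 'M[S]_n :=
  map_mx expconst (invmx Q) *m diag_mx (\row_j mpoly.mpolyX _ (mpoly.mnm1 j))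
   *m map_mx expconst Q *m nexp expconst K N (mpoly.mpolyC n 'X).

Definition exppoint (t : C) (z : 'I_n -> C) : M :=
  invmx Q *m diag_mx (\row_j z j) *m Q *m nexp idfun K N t.

Lemma exppoint01 : exppoint 0 (fun => 1) = 1%:M.
Proof.
rewrite /exppoint; case: K K0 => // k _; rewrite nexp0 mulmx1.
have -> : \row_(j < n) (1 : C) = const_mx 1 by apply/rowP => j; rewrite !mxE.
by rewrite diag_const_mx mulmx1 mulVmx.
Qed.

Lemma exppoint_unit t z : (forall j, z j != 0) -> exppoint t z \in unitmx.
Proof.
move=> z0; rewrite /exppoint !unitmx_mul unitmx_inv Qu /=; apply/andP; split.
  rewrite andbT unitmxE det_diag unitfE; apply/prodf_neq0 => j _.
  by rewrite mxE.
by have /mulmx1_unit [] := nexpN t NK K0.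
Qed.

Lemma map_diag_mx_row (S1 S2 : comNzRingType) (f : {rmorphism S1 -> S2}) (u : 'I_n -> S1) :
  map_mx f (diag_mx (\row_j u j)) = diag_mx (\row_j f (u j)).
Proof. by rewrite map_diag_mx; congr diag_mx; apply/rowP => j; rewrite !mxE. Qed.

Lemma expgen_eval t z : map_mx (expeval t z) expgen = exppoint t z.
Proof.
pose h : {rmorphism S -> C} := mpoly.mmap (horner_eval t) z.
have hc c : h (expconst c) = c by rewrite /h /expconst /= mpoly.mmapC /= /horner_eval hornerC.
have hm (A : M) : map_mx h (map_mx expconst A) = A.
  by apply/matrixP => i j; rewrite !mxE hc.
rewrite -[map_mx _ _]/(map_mx h expgen) /expgen !map_mxM map_diag_mx_row !hm nexp_map.
have -> : h (mpoly.mpolyC n 'X) = t by rewrite /h /= mpoly.mmapC /= /horner_eval hornerX.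
congr (_ *m diag_mx _ *m _ *m _).
  by apply/rowP => j; rewrite !mxE /h /= mpoly.mmapX mpoly.mmap1U.
apply: eq_bigr => k _; congr (_ *: _); apply/matrixP => i j.
by rewrite !mxE; apply: hc.
Qed.

(** The exponents [mu] need not be the eigenvalues [lam]: changing them yields tangent directions
    other than [X]. *)
Lemma expgen_deriv (mu : 'I_n -> C) :
  map_mx (expderiv mu) expgen =
  map_mx expconst (invmx Q) *m diag_mx (\row_j mpoly.mpolyX _ (mpoly.mnm1 j))
    *m map_mx expconst (diag_mx (\row_j mu j) *m Q) *m nexp expconst K N (mpoly.mpolyC n 'X)
  + expgen *m map_mx expconst N.
Proof.
have dD := expderivD mu; have dM := expderivM mu.
have dC c : expderiv mu (expconst c) = 0 by exact: expderivC.
have d0 (A : M) : map_mx (expderiv mu) (map_mx expconst A) = 0.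
  by apply/matrixP => i j; rewrite !mxE dC.
have dN := @nexp_deriv C n S expconst (expderiv mu) K N (mpoly.mpolyC n 'X) dD dM dC (expderivT mu) NK.
rewrite map_mxM; apply: (derivation_mulmx4 dD dM (d0 _) (d0 _) _ dN).
have d00 : expderiv mu 0 = 0 by exact: (derivation0 dD).
apply/matrixP => i j; rewrite map_diag_mx_row mul_diag_mx !mxE.
have [->|ij] := eqVneq i j; rewrite ?mulr0n ?mulr0 ?mulr1n //.
by rewrite expderivX mulrC.
Qed.

Lemma nexp_comm (S1 : comNzRingType) (f : {rmorphism C -> S1}) (B : M) T :
  B *m N = N *m B -> map_mx f B *m nexp f K N T = nexp f K N T *m map_mx f B.
Proof.
move=> BN; rewrite /nexp mulmx_suml mulmx_sumr; apply: eq_bigr => k _.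
rewrite -scalemxAl -scalemxAr -!map_mxM -scalemxAl -scalemxAr.
suff -> : B *m N ^+ k = N ^+ k *m B by [].
exact: (commrX k BN).
Qed.

Lemma expgen_deriv_lam : map_mx (expderiv (lam 0)) expgen = expgen *m map_mx expconst X.
Proof.
have h1 : map_mx expconst X = map_mx expconst s + map_mx expconst N by rewrite XE raddfD.
rewrite expgen_deriv h1 mulmxDr; congr (_ + _).
rewrite map_mxM; apply: mulmx4_comm.
- by rewrite -map_mxM mulmxV // map_mx1.
- rewrite -!map_mxM; have -> : \row_j lam 0 j = lam by apply/rowP => j; rewrite mxE.
  by [].
- exact: nexp_comm.
Qed.

Definition exppoly (p : MP) : S := mxsub_poly expconst expgen p.

Lemma exppoly_eval t z p : expeval t z (exppoly p) = mxpeval p (exppoint t z).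
Proof.
rewrite -expgen_eval; apply: (mxsub_poly_eval (h := mpoly.mmap (horner_eval t) z)) => c /=.
by rewrite mpoly.mmapC /= /horner_eval hornerC.
Qed.

Lemma exppoly_deriv p : expderiv (lam 0) (exppoly p) = exppoly (invderiv X p).
Proof.
exact: (@mxsub_poly_deriv S expconst (expderiv (lam 0)) expgen X p (expderivD (lam 0))
  (expderivM (lam 0)) (expderivC (lam 0)) expgen_deriv_lam).
Qed.

(** The hypothesis says that [p] evaluated at [exp (t X)] has zero Taylor series at 0;
    [exp_parts_eq0] then applies. *)
Lemma exppoly_parts p : (forall k, mxpeval (iter k (invderiv X) p) 1%:M = 0) ->
  forall mu, mu \in mweights (lam 0) (exppoly p) -> mpart (lam 0) (exppoly p) mu = 0.
Proof.
move=> vp; apply: exp_parts_eq0 => k.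
have -> : iter k (expderiv (lam 0)) (exppoly p) = exppoly (iter k (invderiv X) p).
  elim: k => [|k IH]; first exact: erefl.
  have -> : iter k.+1 (expderiv (lam 0)) (exppoly p) = expderiv (lam 0) (exppoly (iter k (invderiv X) p)).
    by rewrite iterS IH.
  exact: exppoly_deriv.
by rewrite exppoly_eval exppoint01.
Qed.

Lemma map_mx4 (S1 S2 : comNzRingType) (h : {rmorphism S1 -> S2}) (A D B E : 'M[S1]_n)
    (A' D' B' E' : 'M[S2]_n) :
  map_mx h A = A' -> map_mx h D = D' -> map_mx h B = B' -> map_mx h E = E' ->
  map_mx h (A *m D *m B *m E) = A' *m D' *m B' *m E'.
Proof. by move=> <- <- <- <-; rewrite !map_mxM. Qed.

Lemma exppoly_deriv1 (mu : 'I_n -> C) p :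
  expeval 0 (fun => 1) (expderiv mu (exppoly p)) =
  \sum_(k < n * n) mxpeval (mpoly.mderiv k p) 1%:M
     * mxvec (invmx Q *m diag_mx (\row_j mu j) *m Q + N) 0 k.
Proof.
pose h : {rmorphism S -> C} := mpoly.mmap (horner_eval 0) (fun => 1).
have hc c : h (expconst c) = c by rewrite /h /expconst /= mpoly.mmapC /= /horner_eval hornerC.
rewrite -[LHS]/(h (expderiv mu (mpoly.mmap expconst _ p))).
rewrite (@mmap_chain _ _ _ _ expconst idfun _ _ (expderivD mu) (expderivM mu)); last exact: expderivC.
rewrite rmorph_sum; apply: eq_bigr => k _; rewrite rmorphM.
congr (_ * _); first by rewrite -exppoint01 -exppoly_eval.
have e0 : map_mx h expgen = 1%:M by rewrite -exppoint01 -expgen_eval.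
have hm (A : M) : map_mx h (map_mx expconst A) = A.
  by apply/matrixP => i j; rewrite !mxE hc.
case/mxvec_indexP: k => i j; rewrite !mxvecE.
have mD (A B : 'M[S]_n) : map_mx h (A + B) = map_mx h A + map_mx h B.
  by apply/matrixP => a b; rewrite !mxE raddfD.
have hT : h (mpoly.mpolyC n 'X) = 0 by rewrite /h /= mpoly.mmapC /= /horner_eval hornerX.
have hE : map_mx h (nexp expconst K N (mpoly.mpolyC n 'X)) = 1%:M.
  by rewrite nexp_map hT; case: K K0 => // k _; rewrite nexp0.
have hZ : map_mx h (diag_mx (\row_j mpoly.mpolyX _ (mpoly.mnm1 j))) = 1%:M.
  rewrite map_diag_mx_row -diag_const_mx; congr diag_mx.
  by apply/rowP => l; rewrite !mxE /h /= mpoly.mmapX mpoly.mmap1U.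
have e1 := map_mx4 (hm (invmx Q)) hZ (hm (diag_mx (\row_j mu j) *m Q)) hE.
have e2 : map_mx h (expgen *m map_mx expconst N) = N.
  by apply: etrans (map_mxM _ _ _) _; rewrite e0 mul1mx; exact: hm.
have e3 : map_mx h (map_mx (expderiv mu) expgen) = invmx Q *m diag_mx (\row_j mu j) *m Q + N.
  apply: etrans (f_equal (map_mx h) (expgen_deriv mu)) _; apply: etrans (mD _ _) _.
  by apply: etrans (f_equal2 +%R e1 e2) _; rewrite !mulmx1 mulmxA.
apply: etrans (f_equal (fun A : M => A i j) e3).
by rewrite [RHS]mxE; congr (h _); rewrite [RHS]mxE.
Qed.

Lemma mweight_additive (phi : {additive C -> C}) (m : mpoly.multinom n) :
  mweight (fun j => phi (lam 0 j)) m = phi (mweight (lam 0) m).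
Proof. by rewrite /mweight raddf_sum; apply: eq_bigr => j _; rewrite raddfMn. Qed.

(** An additive [phi] preserves the integral relations between the [lam j], so monomials of equal
    weight keep equal weights, and the vanishing of the parts survives the change of eigenvalues.
    These modified matrices are replicas of [X] in the sense of Chevalley. *)
Lemma exppoly_additive (phi : {additive C -> C}) p :
  (forall k, mxpeval (iter k (invderiv X) p) 1%:M = 0) ->
  \sum_(k < n * n) mxpeval (mpoly.mderiv k p) 1%:M
     * mxvec (invmx Q *m diag_mx (\row_j phi (lam 0 j)) *m Q + N) 0 k = 0.
Proof.
move=> vp; rewrite -exppoly_deriv1.
have parts := exppoly_parts vp.
have := expeval1_iter (fun j => phi (lam 0 j)) 1 (exppoly p); rewrite /= => ->.
rewrite -(msum_by_weight _ (exppoly p) (G := fun mu q => (twist mu q).[0])); last 2 first.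
- by move=> mu; rewrite twist0 horner0.
- by move=> mu x y; rewrite twistD hornerD.
transitivity (\sum_(m <- mpoly.msupp (exppoly p))
  (twist (phi (mweight (lam 0) m)) (mpoly.mcoeff m (exppoly p))).[0]).
  by apply: eq_bigr => m _; rewrite mweight_additive.
rewrite (msum_by_weight _ (exppoly p) (G := fun mu q => (twist (phi mu) q).[0])).
- by rewrite big_seq big1 // => mu /parts ->; rewrite twist0 horner0.
- by move=> mu; rewrite twist0 horner0.
- by move=> mu x y; rewrite twistD hornerD.
Qed.

(** Such maps stand for [a -> exp (t a)]. They need not be holomorphic, since only additivity in the
    eigenvalues is used. *)
Definition is_char (chi : C -> C) : Prop :=
  [/\ chi 0 = 1, forall a b, chi (a + b) = chi a * chi b & forall a, chi a != 0].

Lemma char_mweight chi : is_char chi -> forall m : mpoly.multinom n,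
  \prod_j chi (lam 0 j) ^+ m j = chi (mweight (lam 0) m).
Proof.
move=> [c0 cD _] m; rewrite /mweight (big_morph chi cD c0); apply: eq_bigr => j _.
by elim: (m j) => [|k IH]; rewrite ?expr0 ?mulr0n // exprS mulrS cD IH.
Qed.

Lemma exppoly_char chi t p : is_char chi ->
  mxpeval p (exppoint t (fun j => chi (lam 0 j))) =
  \sum_(mu <- mweights (lam 0) (exppoly p)) chi mu * (mpart (lam 0) (exppoly p) mu).[t].
Proof. by move=> hchi; rewrite -exppoly_eval (expevalE t (exppoly p) (char_mweight hchi)). Qed.

End JordanData.
End LieExponential.

Section ExpData.
Variables (C : numClosedFieldType) (n : nat).
Local Notation M := 'M[C]_n.
Local Notation MP := (mpoly.mpoly (n * n) C).

Definition expdata (X Q : M) (lam : 'rV[C]_n) (N : M) (K : nat) : Prop :=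
  let s := invmx Q *m diag_mx lam *m Q in
  [/\ Q \in unitmx, X = s + N, s *m N = N *m s, N ^+ K = 0 /\ (0 < K)%N
    & forall B, B *m X = X *m B -> B *m s = s *m B /\ B *m N = N *m B].

Lemma expdata_ex (X : M) : exists Q lam N K, expdata X Q lam N K.
Proof.
have [Q [lam [Qu com [k hk]]]] := jordan_chevalley X.
have xs : X *m (invmx Q *m diag_mx lam *m Q) = (invmx Q *m diag_mx lam *m Q) *m X by exact: com.
exists Q, lam, (X - invmx Q *m diag_mx lam *m Q), k.+1; split => //.
- by rewrite addrC subrK.
- by rewrite mulmxBr mulmxBl xs.
- by split=> //; rewrite exprS hk mulr0.
- move=> B Bx; split; first exact: com.
  by rewrite mulmxBr mulmxBl Bx com.
Qed.

Lemma expdata_nilp (X : M) K : X ^+ K = 0 -> (0 < K)%N -> expdata X 1%:M 0 X K.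
Proof.
move=> XK K0; split; rewrite ?invmx1 ?mul1mx ?mulmx1 ?raddf0 ?unitmx1 ?add0r ?mul0mx ?mulmx0 //.
by move=> B BX; rewrite mul0mx mulmx0.
Qed.

Lemma exppoint_nilp (X : M) K t (z : 'I_n -> C) : (forall j, z j = 1) ->
  exppoint 1%:M X K t z = nexp idfun K X t.
Proof.
move=> z1; rewrite /exppoint invmx1 mul1mx mulmx1.
have -> : \row_(j < n) z j = const_mx 1 by apply/rowP => j; rewrite !mxE z1.
by rewrite diag_const_mx mul1mx.
Qed.

Variables (X Q : M) (lam : 'rV[C]_n) (N : M) (K : nat).
Hypothesis hX : expdata X Q lam N K.

Lemma expdata_unit chi t : is_char chi -> exppoint Q N K t (fun j => chi (lam 0 j)) \in unitmx.
Proof. by case: hX => Qu _ _ [NK K0] _ [_ _ c]; apply: exppoint_unit. Qed.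

Lemma expdata_char chi t (p : MP) : is_char chi ->
  (forall k, mxpeval (iter k (invderiv X) p) 1%:M = 0) ->
  mxpeval p (exppoint Q N K t (fun j => chi (lam 0 j))) = 0.
Proof.
case: hX => Qu XE com [NK K0] _ hchi vp.
rewrite (exppoly_char Q N lam K t p hchi) big_seq big1 // => mu /(exppoly_parts Qu XE com NK K0 vp) ->.
by rewrite horner0 mulr0.
Qed.

Lemma expdata_additive (phi : {additive C -> C}) (p : MP) :
  (forall k, mxpeval (iter k (invderiv X) p) 1%:M = 0) ->
  \sum_(k < n * n) mxpeval (mpoly.mderiv k p) 1%:M
     * mxvec (invmx Q *m diag_mx (\row_j phi (lam 0 j)) *m Q + N) 0 k = 0.
Proof. by case: hX => Qu XE com [NK K0] _; exact: (exppoly_additive Qu XE com NK K0). Qed.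

(** This goes back from points to the tangent vector. The powers of one separating character form a
    Vandermonde system in the parts, so vanishing at all the points makes each part vanish, and with
    them the derivative along [X]. *)
Lemma expdata_tangent (p : MP) :
  (forall ws : seq C, exists2 chi : C -> C, is_char chi & {in ws &, injective chi}) ->
  (forall chi t, is_char chi -> mxpeval p (exppoint Q N K t (fun j => chi (lam 0 j))) = 0) ->
  \sum_(k < n * n) mxpeval (mpoly.mderiv k p) 1%:M * mxvec X 0 k = 0.
Proof.
case: hX => Qu XE com [NK K0] _ sep vp.
have [chi hchi inj] := sep (mweights (lam 0) (exppoly Q N K p)).
have parts mu : mu \in mweights (lam 0) (exppoly Q N K p) ->
    mpart (lam 0) (exppoly Q N K p) mu = 0.
  move=> muws; apply: poly_nat_eq0 => l.
  apply: (vandermonde_indep (c := chi) (a := fun mu => (mpart (lam 0) (exppoly Q N K p) mu).[l%:R])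
    (undup_uniq _) inj) muws => k.
  have hk : is_char (fun a => chi a ^+ k).
    case: hchi => [c0 cD cN]; split; first by rewrite c0 expr1n.
      by move=> a b; rewrite cD exprMn.
    by move=> a; rewrite expf_neq0.
  by rewrite -(exppoly_char Q N lam K l%:R p hk); exact: (vp _ l%:R hk).
have := exppoly_deriv1 Qu NK K0 (lam 0) p.
have -> : \row_j lam 0 j = lam by apply/rowP => j; rewrite mxE.
rewrite -XE => <-.
have := expeval1_iter (lam 0) 1 (exppoly Q N K p); rewrite /= => ->.
by rewrite big_seq big1 // => mu /parts ->; rewrite twist0 horner0.
Qed.

(** [N] commutes with the conjugate semisimple matrix, so their product is nilpotent and has trace
    0. What remains is the sum of the squared moduli of the eigenvalues. *)
Lemma expdata_trace :
  \tr (X *m (invmx Q *m diag_mx (\row_j (lam 0 j)^*) *m Q)) = 0 -> X ^+ K = 0.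
Proof.
case: hX => Qu XE com [NK K0] _; set mu := \row_j (lam 0 j)^*.
rewrite XE mulmxDl mxtraceD.
have -> : \tr (N *m (invmx Q *m diag_mx mu *m Q)) = 0.
  apply: (@mxtrace_nilpotent _ _ _ K).
  have cN : N *m (invmx Q *m diag_mx mu *m Q) = (invmx Q *m diag_mx mu *m Q) *m N.
    by apply: (conj_comm_fun (lam := lam)) => // i j; rewrite !mxE => ->.
  have -> : N *m (invmx Q *m diag_mx mu *m Q) = N * (invmx Q *m diag_mx mu *m Q) by [].
  by rewrite exprMn_comm // NK mul0r.
have -> : invmx Q *m diag_mx lam *m Q *m (invmx Q *m diag_mx mu *m Q) =
    invmx Q *m (diag_mx lam *m diag_mx mu) *m Q by rewrite !mulmxA mulmxK.
rewrite -mulmxA mxtrace_mulC mulmxK // mulmx_diag mxtrace_diag addr0.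
move/eqP; rewrite psumr_eq0 => [/allP h|j _]; last by rewrite !mxE -normCK exprn_ge0.
have l0 : lam = 0.
  apply/rowP => j; have := h j (mem_index_enum j); rewrite !mxE -normCK.
  by rewrite expf_eq0 normr_eq0 => /eqP.
by rewrite l0 raddf0 mulmx0 mul0mx add0r.
Qed.

End ExpData.

(** * Lie algebras of closed subgroups: exponentials, replicas, centralisers *)

Section LieClosedSubgroups.
Variables (R : realType) (n : nat).
Local Notation C := R[i].
Local Notation M := 'M[C]_n.

Lemma is_char_exp (kap : R) :
  is_char (fun a : C => ((sequences.expR (complex.Re a + kap * complex.Im a))%:C)%C).
Proof.
split.
- by rewrite /= mulr0 addr0 exp.expR0.
- move=> [a b] [c d] /=; rewrite -rmorphM -exp.expRD; congr (_%:C)%C; congr sequences.expR.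
  by ring.
- by move=> a; rewrite -(rmorph0 (real_complex R)) (inj_eq (@complexI R)) exp.expR_eq0.
Qed.

(** The real exponential is injective, and the real forms [Re + k Im] separate finitely many complex
    numbers for all but finitely many [k]. *)
Lemma char_separating (ws : seq C) :
  exists2 chi : C -> C, is_char chi & {in ws &, injective chi}.
Proof.
pose ds := [seq d <- [seq x - y | x <- ws, y <- ws] | d != 0].
pose P := \prod_(d <- ds) ((complex.Re d)%:P + complex.Im d *: 'X : {poly R}).
have Pn0 : P != 0.
  rewrite prodf_seq_neq0; apply/allP => -[a b]; rewrite mem_filter => /andP [d0 _] /=.
  apply: contra d0 => /eqP e; rewrite eq_complex /=; apply/andP; split; apply/eqP.
    by have := congr1 (fun q => q.[0]) e; rewrite !hornerE.
  have := congr1 (fun q : {poly R} => q`_1) e.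
  by rewrite coefD coefC coefZ coefX /= add0r mulr1 coef0.
have [k Pk] : exists k : nat, P.[k%:R] != 0.
  apply: contra_neqP Pn0 => /forallNP h; apply: poly_nat_eq0 => k.
  by have /negP := h k; rewrite negbK => /eqP.
exists (fun a => ((sequences.expR (complex.Re a + k%:R * complex.Im a))%:C)%C); first exact: is_char_exp.
move=> x y xws yws /= /complexI /exp.expR_inj e; apply/eqP; rewrite -subr_eq0.
apply: contraT => d0; move: Pk; rewrite horner_prod prodf_seq_neq0 => /allP /(_ (x - y)).
rewrite mem_filter d0 /= => /(_ (allpairs_f _ xws yws)).
rewrite !hornerE; case: x y e {xws yws d0} => [a b] [c d] /= e.
suff -> : a - c + (b - d) * k%:R = 0 by rewrite eqxx.
by rewrite [X in _ + X]mulrC mulrBr addrACA e -opprD subrr.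
Qed.

(** The new value at [A] is the derivative at 1 along [X] of [B -> p (A B)], which vanishes on [H]
    because [H] is closed under products. *)
Lemma vanishes_invderiv (H : set M) X p :
  (forall A B, H A -> H B -> H (A *m B)) -> Lie H X ->
  vanishes H (mxpolyeval p) -> vanishes H (mxpolyeval (invderiv X p)).
Proof.
move=> HM HX vp A HA; rewrite -[LHS]/(mxpeval _ A) mxpeval_invderiv.
have [q [e d]] := mxpolyeval_curve p (line A (A *m X)).
rewrite mxat_line scale0r addr0 in d.
have e0 : q^`().[0] = 0.
  apply: (Lie_line HX (phi := fun B => mxpolyeval p (A *m B))).
  - apply: polyfun_comp; last by exists p.
    apply: polyfun_mulmx => i j; [exact: polyfun_cst | exact: polyfun_entry].
  - by move=> B HB; apply: vp; apply: HM.
  - by move=> t; rewrite -e mxat_line mulmxDr mulmx1 scalemxAr.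
rewrite -[RHS]e0 d; apply: eq_bigr => k _; congr (_ * _).
case/mxvec_indexP: k => i j.
by rewrite mxvecE mxcoordE !mxE /horner_eval !(derivD, derivC, derivM, derivX) !hornerE.
Qed.

Lemma iter_invderiv_at1 (H : set M) X p k :
  H 1%:M -> (forall A B, H A -> H B -> H (A *m B)) -> Lie H X ->
  vanishes H (mxpolyeval p) -> mxpeval (iter k (invderiv X) p) 1%:M = 0.
Proof.
move=> H1 HM HX vp.
have : vanishes H (mxpolyeval (iter k (invderiv X) p)).
  by elim: k => //= k IH; apply: vanishes_invderiv.
by apply.
Qed.

Lemma exp_mem (H : set M) X Q lam N K chi t : closed_subgroup H -> Lie H X ->
  expdata X Q lam N K -> is_char chi -> H (exppoint Q N K t (fun j => chi (lam 0 j))).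
Proof.
move=> [[_ H1 HM _] Hc] HX hX hchi; apply: (zariski_closedP Hc).
  exact: (expdata_unit hX t hchi).
move=> phi [f hf] vf; rewrite hf; apply: (expdata_char hX t hchi) => k.
by apply: (iter_invderiv_at1 (H := H)) => // A HA; rewrite -hf vf.
Qed.

Lemma nexp_mem (H : set M) X K t : closed_subgroup H -> Lie H X ->
  X ^+ K = 0 -> (0 < K)%N -> H (nexp idfun K X t).
Proof.
move=> hH HX XK K0; have hchi : is_char (fun _ : C => 1 : C).
  by split=> [||a]; rewrite ?mulr1 ?oner_neq0.
have := exp_mem t hH HX (expdata_nilp XK K0) hchi.
by rewrite exppoint_nilp.
Qed.

(** Subtract the replica for [phi = 0], which is [N], from the replica for complex conjugation. *)
Lemma Lie_conj (H : set M) X Q lam N K : H 1%:M -> (forall A B, H A -> H B -> H (A *m B)) ->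
  Lie H X -> expdata X Q lam N K ->
  Lie H (invmx Q *m diag_mx (\row_j (lam 0 j)^*) *m Q).
Proof.
move=> H1 HM HX hX.
have h (phi : {additive C -> C}) : Lie H (invmx Q *m diag_mx (\row_j phi (lam 0 j)) *m Q + N).
  move=> f vf; apply: (expdata_additive hX) => k.
  exact: (iter_invderiv_at1 (H := H)).
have h0 : Lie H N.
  have := h (GRing.null_fun C : {additive C -> C}).
  have -> : \row_(j < n) (GRing.null_fun C : {additive C -> C}) (lam 0 j) = 0.
    by apply/rowP => j; rewrite !mxE.
  by rewrite raddf0 mulmx0 mul0mx add0r.
have := linsubB (Lie_linsub H) (h (Num.conj : {additive C -> C})) h0.
by rewrite addrK.
Qed.

(** A form of Cartan's criterion: the trace form is tested on the conjugate of the semisimple part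
    of [X], which also belongs to [Lie H]. *)
Lemma Lie_nilpotent (H : set M) X : H 1%:M -> (forall A B, H A -> H B -> H (A *m B)) ->
  Lie H X -> (forall Y, Lie H Y -> \tr (X *m Y) = 0) -> nilpotent_mx X.
Proof.
move=> H1 HM HX tr0; have [Q [lam [N [K hX]]]] := expdata_ex X.
exists K; apply: (expdata_trace hX); apply: tr0.
exact: (Lie_conj H1 HM HX hX).
Qed.

(** The trace is constant on [H], so differentiating [tr (A B)] in both arguments makes the trace
    form vanish on [Lie H]. *)
Lemma Lie_unipotent (H : set M) X : closed_subgroup H -> unipotent_group H -> Lie H X ->
  nilpotent_mx X.
Proof.
move=> [[_ H1 HM _] _] hu HX; apply: (Lie_nilpotent H1 HM HX) => Y HY.
have tr1 A : H A -> \tr A = n%:R.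
  move=> /hu [k hk]; have := mxtrace_nilpotent hk.
  by rewrite raddfB /= mxtrace1 => /eqP; rewrite subr_eq0 => /eqP.
rewrite mxtrace_mulC; apply: (Lie_scalar (H := H) (l := fun A => \tr (A *m X)) (c := 0)) => //.
  by move=> a A B; rewrite mulmxDl mxtraceD -scalemxAl mxtraceZ.
move=> A HA; apply: (Lie_scalar (H := H) (l := fun B => \tr (A *m B)) (c := n%:R)) => //.
  by move=> a B D; rewrite mulmxDr mxtraceD -scalemxAr mxtraceZ.
by move=> B HB; apply: tr1; apply: HM.
Qed.

(* In characteristic 0 centralisers are smooth. *)
Lemma Lie_centralizer (H K : set M) (S : set M) X : closed_subgroup H -> Lie H X ->
  (forall Y, S Y -> Y *m X = X *m Y) ->
  (forall A, H A -> (forall Y, S Y -> Y *m A = A *m Y) -> K A) -> Lie K X.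
Proof.
move=> hH HX hS hK f vf; have [Q [lam [N [J hX]]]] := expdata_ex X.
apply: (expdata_tangent hX); first exact: char_separating.
move=> chi t hchi; apply: (vf (exppoint Q N J t (fun j => chi (lam 0 j)))).
apply: hK; first exact: (exp_mem t hH HX hX hchi).
case: hX => Qu _ _ _ hcom Y SY; have [Ys YN] := hcom _ (hS _ SY).
set mu := \row_j chi (lam 0 j).
have Ymu : Y *m (invmx Q *m diag_mx mu *m Q) = (invmx Q *m diag_mx mu *m Q) *m Y.
  by apply: (conj_comm_fun (lam := lam)) => // i j; rewrite !mxE => ->.
have YE := nexp_comm J idfun t YN; rewrite map_mx_id // in YE.
exact: (comm_mxM Ymu YE).
Qed.

End LieClosedSubgroups.

(** * The adjoint action and Engel flags *)

(** The adjugate keeps the curve polynomial where the inverse would not; the derivative of the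
    determinant is the price, in the term [c *: s]. *)
Lemma adjugate_curve (F : numFieldType) n (x s : 'M[F]_n) :
  exists (Bt : 'M[{poly F}]_n) (c : F),
    (forall t, map_mx (horner_eval t) Bt = (1%:M + t *: x) *m s *m \adj (1%:M + t *: x)) /\
    map_mx (horner_eval 0) (map_mx (@deriv F) Bt) = x *m s - s *m x + c *: s.
Proof.
pose P : 'M[{poly F}]_n := map_mx (@polyC F) 1%:M + 'X *: map_mx (@polyC F) x.
have Pt t : map_mx (horner_eval t) P = 1%:M + t *: x.
  by apply/matrixP => i j; rewrite !mxE /horner_eval !hornerE.
have dD : {morph @deriv F : p q / p + q} by move=> p q; rewrite derivD.
have dM (p q : {poly F}) : deriv (p * q) = deriv p * q + p * deriv q by rewrite derivM.
have dP : map_mx (@deriv F) P = map_mx (@polyC F) x.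
  apply/matrixP => i j; rewrite !mxE derivD derivC derivM derivX derivC.
  by rewrite mul1r mulr0 addr0 add0r.
have hC (A : 'M[F]_n) : map_mx (horner_eval 0) (map_mx (@polyC F) A) = A.
  by apply/matrixP => i j; rewrite !mxE /horner_eval hornerC.
have dC (A : 'M[F]_n) : map_mx (@deriv F) (map_mx (@polyC F) A) = 0.
  by apply/matrixP => i j; rewrite !mxE derivC.
have adjt t : map_mx (horner_eval t) (\adj P) = \adj (1%:M + t *: x).
  by rewrite map_mx_adj Pt.
pose c := (deriv (\det P)).[0].
have dadj : map_mx (horner_eval 0) (map_mx (@deriv F) (\adj P)) = c%:M - x.
  have := congr1 (fun A => map_mx (horner_eval 0) (map_mx (@deriv F) A)) (mul_mx_adj P).
  rewrite (derivation_mulmx dD dM) map_mxD !map_mxM dP hC adjt Pt scale0r addr0 adj1 mulmx1 mul1mx.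
  have -> : map_mx (horner_eval 0) (map_mx (@deriv F) ((\det P)%:M : 'M_n)) = c%:M.
    apply/matrixP => i j; rewrite !mxE; case: eqP => _; first by rewrite !mulr1n.
    by rewrite !mulr0n deriv0 /horner_eval horner0.
  by move=> <-; rewrite addrC addKr.
exists (P *m map_mx (@polyC F) s *m \adj P), c; split=> [t|].
  rewrite !map_mxM adjt Pt; congr (_ *m _ *m _).
  by apply/matrixP => i j; rewrite !mxE /= /horner_eval hornerC.
rewrite !(derivation_mulmx dD dM) dP dC mulmx0 addr0 map_mxD !map_mxM !hC adjt Pt dadj.
rewrite scale0r addr0 adj1 mulmx1 mul1mx mulmxBr mul_mx_scalar.
by rewrite addrA addrAC.
Qed.

Lemma scalar_curve (F : numFieldType) n (l : {scalar 'M[F]_n}) (Bt : 'M[{poly F}]_n) :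
  exists q : {poly F}, (forall t, q.[t] = l (map_mx (horner_eval t) Bt)) /\
    q^`().[0] = l (map_mx (horner_eval 0) (map_mx (@deriv F) Bt)).
Proof.
have lE (A : 'M[F]_n) : l A = \sum_i \sum_j A i j * l (delta_mx i j).
  rewrite [in LHS](matrix_sum_delta A) linear_sum; apply: eq_bigr => i _.
  by rewrite linear_sum; apply: eq_bigr => j _; rewrite linearZ.
exists (\sum_i \sum_j Bt i j * (l (delta_mx i j))%:P); split=> [t|].
  rewrite lE horner_sum; apply: eq_bigr => i _; rewrite horner_sum; apply: eq_bigr => j _.
  by rewrite hornerM hornerC mxE.
rewrite lE (big_morph (@deriv F) (@derivD F) (@deriv0 F)) horner_sum; apply: eq_bigr => i _.
rewrite (big_morph (@deriv F) (@derivD F) (@deriv0 F)) horner_sum; apply: eq_bigr => j _.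
by rewrite derivM derivC mulr0 addr0 hornerM hornerC !mxE.
Qed.

Section AdjointAction.
Variables (R : realType) (n : nat).
Local Notation C := R[i].
Local Notation M := 'M[C]_n.

Lemma brDl (x y z : M) : br (x + y) z = br x z + br y z.
Proof. by rewrite /br mulmxDl mulmxDr opprD addrACA. Qed.

Lemma brDr (x y z : M) : br x (y + z) = br x y + br x z.
Proof. by rewrite /br mulmxDl mulmxDr opprD addrACA. Qed.

Lemma brZl a (x y : M) : br (a *: x) y = a *: br x y.
Proof. by rewrite /br -scalemxAl -scalemxAr scalerBr. Qed.

Lemma brZr a (x y : M) : br x (a *: y) = a *: br x y.
Proof. by rewrite /br -scalemxAl -scalemxAr scalerBr. Qed.

Lemma brC (x y : M) : br x y = - br y x.
Proof. by rewrite /br opprB. Qed.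

Lemma br0 (x : M) : br x 0 = 0.
Proof. by rewrite /br mulmx0 mul0mx subrr. Qed.

Lemma brA (x y z : M) : br x (br y z) = br (br x y) z + br y (br x z).
Proof.
rewrite /br !mulmxBr !mulmxBl !mulmxA.
set a := x *m y *m z; set b := x *m z *m y; set c := y *m z *m x; set d := z *m y *m x.
set u := y *m x *m z; set v := z *m x *m y.
by clearbody a b c d u v; apply/matrixP => i j; rewrite !mxE; ring.
Qed.

Lemma mxtrace_br (x y z : M) : \tr (br x y *m z) = - \tr (y *m br x z).
Proof.
have trB (A B : M) : \tr (A - B) = \tr A - \tr B by rewrite raddfB.
rewrite /br mulmxBl mulmxBr !trB opprB !mulmxA; congr (_ - _).
by rewrite -[x *m y *m z]mulmxA mxtrace_mulC.
Qed.

Lemma Lie_Ad (H K : set M) g y : g \in unitmx ->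
  (forall A, H A -> K (Ad g A)) -> Lie H y -> Lie K (Ad g y).
Proof.
move=> gu hK Hy; apply: LieP => phi q pphi vphi hq.
apply: (Lie_line Hy (phi := fun A => phi (Ad g A))).
- apply: polyfun_comp pphi; apply: polyfun_mulmx => [|i j]; last exact: polyfun_cst.
  by apply: polyfun_mulmx => i j; [exact: polyfun_cst | exact: polyfun_entry].
- by move=> A HA; apply: vphi; apply: hK.
- move=> t; rewrite -hq /Ad mulmxDr mulmxDl mulmx1 mulmxV //.
  by rewrite -scalemxAr -scalemxAl.
Qed.

(** Differentiate, along [A s adj(A)], a linear form that vanishes on [S] and not at [br x s]. On
    [H] the value is [det A] times the form at [Ad A s], hence 0, and the extra multiple of [s] is
    killed by the form. *)
Lemma Lie_ad (H : set M) (S : set M) x s : H `<=` [set A | A \in unitmx] -> linsub S ->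
  (forall A y, H A -> S y -> S (Ad A y)) -> Lie H x -> S s -> S (br x s).
Proof.
move=> Hu hS HS Hx Ss; apply: contrapT => nS.
have [l [lS /negP]] := linsub_sep hS nS; apply.
have [Bt [c [Bt_t dBt]]] := adjugate_curve x s.
have [q [qt dq]] := scalar_curve l Bt.
have : q^`().[0] = 0.
  apply: (Lie_line Hx (phi := fun A => l (A *m s *m \adj A))).
  - apply: (polyfun_comp (phi := l)); last by apply: polyfun_scalar => a u v; rewrite linearP.
    apply: polyfun_mulmx; last by apply: polyfun_adj => i j; exact: polyfun_entry.
    by apply: polyfun_mulmx => i j; [exact: polyfun_entry | exact: polyfun_cst].
  - move=> A HA; have uA := Hu _ HA.
    have -> : \adj A = \det A *: invmx A.
      by rewrite /invmx uA scalerA mulfV ?scale1r // -unitfE -unitmxE.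
    by rewrite -scalemxAr linearZ (lS _ (HS _ _ HA Ss)) /= mulr0.
  - by move=> t; rewrite qt Bt_t.
by rewrite dq dBt linearD linearZ (lS s Ss) /= mulr0 addr0 => ->; rewrite eqxx.
Qed.

Lemma Lie_bracket (H K : set M) x y : H `<=` [set A | A \in unitmx] ->
  (forall A B, H A -> K B -> K (Ad A B)) -> Lie H x -> Lie K y -> Lie K (br x y).
Proof.
move=> Hu HK Hx Ky; apply: (Lie_ad Hu (Lie_linsub K)) Hx Ky => A z HA.
by apply: Lie_Ad; [exact: Hu | move=> B; exact: HK].
Qed.

Lemma subgroup_Ad (H : set M) A B : subgroup H -> H A -> H B -> H (Ad A B).
Proof. by move=> [_ _ HM HV] HA HB; exact: (HM _ _ (HM _ _ HA HB) (HV _ HA)). Qed.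

End AdjointAction.

Section LinearSpan.
Variables (F : fieldType) (V : lmodType F).

Definition lspan (S : set V) : set V := fun v => forall U, linsub U -> S `<=` U -> U v.

Lemma lspan_linsub S : linsub (lspan S).
Proof.
split=> [U hU _|a x y hx hy U hU SU]; first exact: linsub0.
by apply: hU.2; [exact: hx | exact: hy].
Qed.

Lemma sub_lspan S : S `<=` lspan S.
Proof. by move=> v Sv U _; apply. Qed.

Lemma lspan_sub S U : linsub U -> S `<=` U -> lspan S `<=` U.
Proof. by move=> hU SU v; apply. Qed.

End LinearSpan.

(** * Flags of nilpotent sets of matrices and Engel's theorem *)

Section Flags.
Variables (F : numFieldType) (n : nat).
Local Notation M := 'M[F]_n.

(** Matrices act on row vectors from the right: [flag m j] is the span of all the [v w1 ... wj] with
    the [wi] in [m]. So [flag_nil] bounds the length of the nonzero products of elements of [m]. *)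
Fixpoint flag (m : set M) (j : nat) : set 'rV[F]_n :=
  if j is i.+1 then lspan [set v | exists u w, [/\ flag m i u, m w & v = u *m w]] else setT.

Definition flag_nil (m : set M) : Prop := exists K, forall v, flag m K v -> v = 0.

Lemma flag_linsub m j : linsub (flag m j).
Proof. by case: j => [|j]; [split | exact: lspan_linsub]. Qed.

Lemma flagM m j u w : flag m j u -> m w -> flag m j.+1 (u *m w).
Proof. by move=> hu hw; apply: sub_lspan; exists u, w. Qed.

Lemma flagS_ind m j (U : set 'rV[F]_n) : linsub U ->
  (forall u w, flag m j u -> m w -> U (u *m w)) -> flag m j.+1 `<=` U.
Proof. by move=> hU h; apply: lspan_sub => // v [u [w [hu hw ->]]]; apply: h. Qed.

Lemma flag_dec m j : flag m j.+1 `<=` flag m j.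
Proof.
elim: j => [//|j IH]; apply: flagS_ind; first exact: flag_linsub.
by move=> u w /IH hu; apply: flagM.
Qed.

Lemma flag_le m i j : (i <= j)%N -> flag m j `<=` flag m i.
Proof.
by move/subnK <-; elim: (j - i)%N => [|k IH] v; rewrite ?add0n // addSn => /flag_dec /IH.
Qed.

Lemma linsub_preim_mul p (U : set 'rV[F]_p) (A : 'M[F]_(n, p)) :
  linsub U -> linsub [set v : 'rV[F]_n | U (v *m A)].
Proof.
move=> hU; split=> [|a x y /= hx hy]; first by rewrite /= mul0mx; apply: linsub0.
by rewrite mulmxDl -scalemxAl; apply: hU.2.
Qed.

Lemma flag_conj_stable m A j v : A \in unitmx -> (forall w, m w -> m (invmx A *m w *m A)) ->
  flag m j v -> flag m j (v *m A).
Proof.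
move=> uA hA; elim: j v => [//|j IH]; apply: flagS_ind.
  exact: linsub_preim_mul (flag_linsub m j.+1).
move=> u w /IH hu hw.
have -> : u *m w *m A = (u *m A) *m (invmx A *m w *m A) by rewrite !mulmxA mulmxK.
by apply: flagM => //; apply: hA.
Qed.

Lemma flag_ad_stable m x j v : (forall w, m w -> m (w *m x - x *m w)) ->
  flag m j v -> flag m j (v *m x).
Proof.
move=> hx; elim: j v => [//|j IH]; apply: flagS_ind.
  exact: linsub_preim_mul (flag_linsub m j.+1).
move=> u w hu hw; have -> : u *m w *m x = u *m x *m w + u *m (w *m x - x *m w).
  by rewrite mulmxBr !mulmxA addrC subrK.
apply: (linsubD (flag_linsub m j.+1)); first by apply: flagM => //; apply: IH.
by apply: flagM => //; apply: hx.
Qed.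

Fixpoint word (m : set M) (k : nat) : set M :=
  if k is i.+1 then [set p | exists q w, [/\ word m i q, m w & p = q *m w]] else [set 1%:M].

Lemma wordM m a b p q : word m a p -> word m b q -> word m (a + b) (p *m q).
Proof.
move=> hp; elim: b q => [q -> |b IH q [q' [w [hq' hw ->]]]]; first by rewrite addn0 mulmx1.
by rewrite addnS; exists (p *m q'), w; split=> //; [exact: IH | rewrite mulmxA].
Qed.

Lemma wordS (m m' : set M) k : m `<=` m' -> word m k `<=` word m' k.
Proof.
move=> mm; elim: k => [//|k IH] p [q [w [/IH hq /mm hw ->]]].
by exists q, w.
Qed.

Lemma flag_word m j k v p : flag m j v -> word m k p -> flag m (j + k) (v *m p).
Proof.
move=> hv; elim: k p => [p ->|k IH p [q [w [hq hw ->]]]]; first by rewrite addn0 mulmx1.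
by rewrite addnS mulmxA; apply: flagM => //; apply: IH.
Qed.

Lemma flagD_ind m j k (U : set 'rV[F]_n) : linsub U ->
  (forall u p, flag m j u -> word m k p -> U (u *m p)) -> flag m (j + k) `<=` U.
Proof.
elim: k U => [|k IH] U hU h.
  by rewrite addn0 => v hv; rewrite -[v]mulmx1; apply: h.
rewrite addnS; apply: flagS_ind => // u w hu hw.
apply: (IH [set u | U (u *m w)]) hu; first exact: linsub_preim_mul.
move=> u' p hu' hp /=; rewrite -mulmxA; apply: h => //.
by exists p, w.
Qed.

Lemma mulmx_row_eq0 (p : M) : (forall v : 'rV[F]_n, v *m p = 0) -> p = 0.
Proof. by move=> h; apply/row_matrixP => i; rewrite rowE h raddf0. Qed.

Lemma flag_nil_word m K k p : (forall v, flag m K v -> v = 0) -> (K <= k)%N ->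
  word m k p -> p = 0.
Proof.
move=> hK Kk hp; apply: mulmx_row_eq0 => v; apply: hK; apply: (flag_le Kk).
by have := @flag_word m 0 k v p I hp; rewrite add0n.
Qed.

(** Modulo the next step of the flag of [m0], a product of elements [w + x] acts as the product of
    the [x]. Hence [r] factors go down at least one step. *)
Lemma flag_nil_extend (m0 X : set M) r : linsub m0 -> flag_nil m0 ->
  (forall w x, m0 w -> X x -> m0 (w *m x - x *m w)) -> (forall p, word X r p -> p = 0) ->
  flag_nil [set y | exists w x, [/\ m0 w, X x & y = w + x]].
Proof.
move=> hm0 [K hK] hX hr; set m := [set y | _].
have stab j x v : X x -> flag m0 j v -> flag m0 j (v *m x).
  by move=> Xx; apply: flag_ad_stable => w m0w; apply: hX.
have words k p : word m k p -> exists2 q, word X k q &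
    forall j v, flag m0 j v -> flag m0 j (v *m q) /\ flag m0 j.+1 (v *m p - v *m q).
  elim: k p => [p ->|k IH p [p' [y [hp' [w [x [m0w Xx ->]]] ->]]]].
    by exists 1%:M => // j v hv; rewrite !mulmx1 subrr; split=> //; apply: linsub0 (flag_linsub _ _).
  have [q hq h] := IH _ hp'.
  exists (q *m x); first by exists q, x.
  move=> j v hv; have [hvq hd] := h j v hv.
  split; first by rewrite mulmxA; apply: stab.
  have hvp : flag m0 j (v *m p').
    rewrite -[v *m p'](subrK (v *m q)); apply: (linsubD (flag_linsub m0 j)) => //; exact: flag_dec.
  have -> : v *m (p' *m (w + x)) - v *m (q *m x) = v *m p' *m w + (v *m p' - v *m q) *m x.
    by rewrite mulmxDr mulmxDr !mulmxA mulmxBl addrA.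
  by apply: (linsubD (flag_linsub m0 j.+1)); [exact: flagM | exact: stab].
have step i : flag m (i * r) `<=` flag m0 i.
  elim: i => [//|i IH]; rewrite mulSn addnC; apply: flagD_ind; first exact: flag_linsub.
  move=> u p /IH hu /words [q /hr q0 h].
  by have [_] := h i u hu; rewrite q0 mulmx0 subr0.
by exists (K * r)%N => v /step /hK.
Qed.

Definition mbr (x y : M) : M := x *m y - y *m x.

(** Otherwise brackets with [m] could be iterated forever inside [Bad]. But a bracket iterated [2K]
    times is a combination of terms [p x0 q] in which [p] or [q] is a product of at least [K]
    elements of [m], hence 0. In the applications [Bad] is a difference of two linear subsets. *)
Lemma ad_fixed (m : set M) (Bad : set M) x0 : flag_nil m -> Bad x0 -> ~ Bad 0 ->
  exists2 x, Bad x & forall w, m w -> ~ Bad (mbr w x).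
Proof.
move=> [K hK] B0 nB0; apply: contrapT => no.
pose T k : set M := lspan [set y | exists a b p q,
   [/\ (a + b)%N = k, word m a p, word m b q & y = p *m x0 *m q]].
have step k : exists2 z, Bad z & T k z.
  elim: k => [|k [z Bz Tz]].
    exists x0 => //; apply: sub_lspan; exists 0%N, 0%N, 1%:M, 1%:M; split=> //.
    by rewrite mul1mx mulmx1.
  have [w mw Bw] : exists2 w, m w & Bad (mbr w z).
    apply: contrapT => h; apply: no; exists z => // w mw Bw; apply: h.
    by exists w.
  exists (mbr w z) => //.
  apply: (Tz [set z | T k.+1 (mbr w z)]).
    split=> [|a x y /= hx hy]; first by rewrite /= /mbr mulmx0 mul0mx subrr; apply: linsub0 (lspan_linsub _).
    have -> : mbr w (a *: x + y) = a *: mbr w x + mbr w y.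
      by rewrite /mbr mulmxDr mulmxDl -scalemxAl -scalemxAr scalerBr opprD addrACA.
    exact: (lspan_linsub _).2.
  move=> y [a [b [p [q [abk hp hq ->]]]]] /=.
  rewrite /mbr; apply: (linsubB (lspan_linsub _)).
    apply: sub_lspan; exists a.+1, b, (w *m p), q; split=> //; first by rewrite addSn abk.
      have := @wordM m 1 a w p; rewrite add1n; apply=> //.
      by exists 1%:M, w; rewrite mul1mx.
    by rewrite !mulmxA.
  apply: sub_lspan; exists a, b.+1, p, (q *m w); split=> //; first by rewrite addnS abk.
    by exists q, w.
  by rewrite !mulmxA.
have [z Bz Tz] := step (K + K)%N.
have z0 : z = 0.
  apply: (Tz [set 0]); first by split=> [//|a x y -> ->] /=; rewrite scaler0 addr0.
  move=> y [a [b [p [q [abk hp hq ->]]]]] /=.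
  have [Ka|Ka] := leqP K a; first by rewrite (flag_nil_word hK Ka hp) !mul0mx.
  rewrite (flag_nil_word hK _ hq) ?mulmx0 //.
  by rewrite -(leq_add2l a) abk leq_add2r ltnW.
by rewrite z0 in Bz.
Qed.

(** Take a subalgebra [U] of maximal dimension among those with a nilpotent flag. If [U] is not [L],
    then [ad_fixed] gives a vector outside [U] that normalises it, and [flag_nil_extend] contradicts
    the maximality. *)
Theorem engel (L : set M) : linsub L -> (forall x y, L x -> L y -> L (mbr x y)) ->
  (forall x, L x -> exists k, x ^+ k = 0) -> flag_nil L.
Proof.
move=> hL Lbr Lnil.
pose good (U : {vspace M}) := [/\ forall x, x \in U -> L x,
  forall x y, x \in U -> y \in U -> mbr x y \in U & flag_nil [set x | x \in U]].
pose A : set nat := [set k | exists2 U, good U & \dim U = k].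
have A0 : exists k, `[< A k >].
  exists 0%N; apply/asboolP; exists 0%VS; last exact: dimv0.
  split.
  - by move=> x; rewrite memv0 => /eqP ->; apply: linsub0.
  - by move=> x y; rewrite !memv0 => /eqP -> _; rewrite /mbr mul0mx mulmx0 subrr.
  - exists 1%N; apply: flagS_ind.
      by split=> [//|a x y -> ->] /=; rewrite scaler0 addr0.
    by move=> u w _ /=; rewrite memv0 => /eqP ->; rewrite mulmx0.
have ubA k : `[< A k >] -> (k <= \dim {: M})%N.
  by move/asboolP => [U _ <-]; apply/dimvS/subvf.
case: (ex_maxnP A0 ubA) => k /asboolP [U [UL Ubr Unil] dU] kmax.
have [LU|nLU] := pselect (L `<=` [set x | x \in U]).
  have -> : L = [set x | x \in U] by apply/seteqP; split=> // x; apply: UL.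
  exact: Unil.
exfalso.
have [x0 [Lx0 Ux0]] : exists x, L x /\ ~ x \in U.
  apply: contrapT => h; apply: nLU => x Lx; apply: contrapT => nx; apply: h.
  by exists x.
have [||x [Lx nUx] hx] := @ad_fixed _ (fun x => L x /\ ~ x \in U) x0 Unil.
- by [].
- by case=> _; rewrite mem0v.
have Ux w : w \in U -> mbr w x \in U.
  move=> wU; apply: contrapT => h; apply: (hx w wU); split=> //.
  by apply: Lbr => //; apply: UL.
have [r xr] := Lnil x Lx.
have : A (\dim (U + <[x]>)%VS).
  exists (U + <[x]>)%VS => //; split.
  - move=> y /memv_addP [u uU [v /vlineP [c ->] ->]].
    by apply: linsubD => //; [exact: UL | exact: linsubZ].
  - move=> y z /memv_addP [u uU [v /vlineP [c ->] ->]].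
    move=> /memv_addP [u' u'U [v' /vlineP [c' ->] ->]].
    have -> : mbr (u + c *: x) (u' + c' *: x) = mbr u u' + (c' *: mbr u x - c *: mbr u' x).
      rewrite /mbr !mulmxDl !mulmxDr -!scalemxAl -!scalemxAr !scalerBr.
      set a := u *m u'; set b := u' *m u; set d := u *m x; set e := x *m u.
      set g := u' *m x; set i := x *m u'; set j := c *: (c' *: _); set l := c' *: (c *: _).
      have -> : j = l by rewrite /j /l !scalerA mulrC.
      by clearbody a b d e g i l; apply/matrixP => s t; rewrite !mxE; ring.
    apply: (subvP (addvSl U <[x]>)).
    by rewrite rpredD ?Ubr // rpredB // rpredZ // Ux.
  - have -> : [set y | y \in (U + <[x]>)%VS] =
        [set y | exists w z, [/\ w \in U, z \in <[x]>%VS & y = w + z]].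
      apply/seteqP; split=> y /=.
        by move=> /memv_addP [u uU [v vx ->]]; exists u, v.
      by move=> [w [z [wU zx ->]]]; apply: memv_add.
    apply: (@flag_nil_extend [set y | y \in U] [set y | y \in <[x]>%VS] r) => //.
    + by split=> [|a y z /= hy hz]; rewrite /= ?mem0v // rpredD // rpredZ.
    + move=> w y /= wU /vlineP [c ->].
      by rewrite -scalemxAl -scalemxAr -scalerBr rpredZ // Ux.
    + suff h j p : word [set y | y \in <[x]>%VS] j p -> exists c, p = c *: (x ^+ j : M).
        by move=> p /h [c ->]; rewrite xr scaler0.
      elim: j p => [p ->|j IH p [q [w [/IH [c ->] /vlineP [d ->] ->]]]].
        by exists 1; rewrite scale1r.
      by exists (d * c); rewrite exprSr -scalemxAl -scalemxAr scalerA mulrC.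
move/asboolP/kmax; apply/negP; rewrite -ltnNge -dU.
rewrite (ltn_leqif (dimv_leqif_sup (addvSl U <[x]>))).
by apply/negP => /subvP h; apply: nUx; apply: h; apply: (subvP (addvSr U <[x]>)); rewrite memv_line.
Qed.

End Flags.

(** * Closed connected solvable subgroups *)

Section InverseMatrices.
Variables (F : fieldType) (n : nat).
Implicit Types A B b m : 'M[F]_n.

Lemma invmx_mul A B : A \in unitmx -> B \in unitmx -> invmx (A *m B) = invmx B *m invmx A.
Proof.
move=> uA uB; have uAB : A *m B \in unitmx by rewrite unitmx_mul uA.
have := mulKmx uAB (invmx B *m invmx A).
by rewrite [A *m B *m _]mulmxA mulmxK // mulmxV // mulmx1.
Qed.

Lemma exp_invmx A k : A \in unitmx -> A ^+ k *m invmx A ^+ k = 1%:M.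
Proof.
move=> uA; elim: k => [|k IH]; first by rewrite !expr0 mulmx1.
have -> : A ^+ k.+1 = A *m A ^+ k by rewrite exprS.
have -> : invmx A ^+ k.+1 = invmx A ^+ k *m invmx A by rewrite exprSr.
by rewrite mulmxA -[A *m _ *m _]mulmxA IH mulmx1 mulmxV.
Qed.

(** The second factor belongs to any group that contains [m] and [m'] and is normalised by [b] and
    [b']. *)
Lemma commutator_mul b b' m m' : b \in unitmx -> b' \in unitmx -> m \in unitmx -> m' \in unitmx ->
  b *m m *m (b' *m m') *m invmx (b *m m) *m invmx (b' *m m') =
  b *m b' *m invmx b *m invmx b' *m
   (b' *m (b *m ((invmx b' *m m *m b') *m m' *m invmx m) *m invmx b *m invmx m') *m invmx b').
Proof.
move=> ub ub' um um'; rewrite !invmx_mul // !mulmxA.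
by rewrite !(mulmxK, mulmxKV).
Qed.

Lemma conj_fixP b A : b \in unitmx -> b *m A *m invmx b = A <-> b *m A = A *m b.
Proof. by move=> ub; split=> [e|->]; [rewrite -[in RHS]e mulmxKV | rewrite mulmxK]. Qed.

Lemma conj_diag_comm b (lam mu : 'rV[F]_n) : b \in unitmx ->
  invmx b *m diag_mx lam *m b *m (invmx b *m diag_mx mu *m b) =
  invmx b *m diag_mx mu *m b *m (invmx b *m diag_mx lam *m b).
Proof.
have comm (D D' : 'rV[F]_n) : b \in unitmx ->
    invmx b *m diag_mx D *m b *m (invmx b *m diag_mx D' *m b) =
    invmx b *m (diag_mx D *m diag_mx D') *m b by move=> ub; rewrite !mulmxA mulmxK.
by move=> ub; rewrite !comm // diag_mxC.
Qed.

Lemma commutator_comm b m m' : b \in unitmx -> m \in unitmx -> m' \in unitmx -> b *m m = m *m b ->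
  b *m (m *m m') *m invmx b *m invmx (m *m m') =
  m *m (b *m m' *m invmx b *m invmx m') *m invmx m.
Proof. by move=> ub um um' bm; rewrite invmx_mul // !mulmxA bm. Qed.

Lemma conj_mulmx b A B : b \in unitmx ->
  (b *m A *m invmx b) *m (b *m B *m invmx b) = b *m (A *m B) *m invmx b.
Proof. by move=> ub; rewrite !mulmxA mulmxKV. Qed.

End InverseMatrices.

(** * Powers of a unipotent matrix as a polynomial curve *)

Section UnipotentPowers.
Variables (F : numFieldType).

Definition binpoly (k : nat) : {poly F} := (k`!%:R^-1)%:P * \prod_(i < k) ('X - (i%:R)%:P).

Lemma binpoly_nat k m : (binpoly k).[m%:R] = 'C(m, k)%:R.
Proof.
have ff : (\prod_(i < k) ('X - (i%:R)%:P : {poly F})).[m%:R] = (m ^_ k)%:R.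
  elim: k => [|k IH]; first by rewrite big_ord0 hornerC ffactn0.
  rewrite big_ord_recr hornerM IH ffactnSr natrM !hornerE.
  have [lemk|ltkm] := leqP k m; first by rewrite natrB.
  by rewrite ffact_small // !mul0r.
rewrite /binpoly hornerM hornerC ff -bin_ffact natrM mulrC mulfK //.
by rewrite pnatr_eq0 -lt0n fact_gt0.
Qed.

(** By the binomial formula [A ^+ m] is the sum of the [N ^+ k *+ 'C(m, k)]. Nilpotency bounds [k]
    independently of [m], and the coefficients are polynomial in [m]. *)
Lemma unipotent_curve n (A : 'M[F]_n) K : (A - 1%:M) ^+ K = 0 ->
  exists Bt : 'M[{poly F}]_n, forall m : nat, map_mx (horner_eval m%:R) Bt = A ^+ m.
Proof.
set N := A - 1%:M => NK.
exists (\sum_(k < K) binpoly k *: map_mx (@polyC F) (N ^+ k : 'M_n)) => m.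
have -> : A = N + 1 by rewrite subrK.
rewrite exprD1n.
have NX k : (K <= k)%N -> N ^+ k = 0.
  by move=> Kk; rewrite -(subnK Kk) exprD NK mulr0.
transitivity (\sum_(k < m.+1 + K) (N ^+ k : 'M_n) *+ 'C(m, k)); last first.
  rewrite big_split_ord /= [X in _ + X]big1 ?addr0 // => k _.
  by rewrite bin_small ?mulr0n // leq_addr.
rewrite addnC big_split_ord /= [X in _ = _ + X]big1 ?addr0 => [|k _]; last first.
  by rewrite NX ?mul0rn // leq_addr.
apply/matrixP => i j; rewrite mxE !summxE /horner_eval horner_sum; apply: eq_bigr => k _.
by rewrite !mxE hornerM hornerC binpoly_nat mulr_natl mulmxnE.
Qed.

(** The polynomial [qs m] is the translate of [q] by [m], so the derivative of [q] vanishes at every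
    natural number. *)
Lemma horner_shift_const (q : {poly F}) (qs : nat -> {poly F}) :
  (forall m k : nat, q.[(k + m)%:R] = (qs m).[k%:R]) -> (forall m, (qs m)^`().[0] = 0) ->
  forall t, q.[t] = q.[0].
Proof.
move=> hq dq t.
have qm m : q \Po ('X + (m%:R)%:P) = qs m.
  by apply: poly_nat_inj => k; rewrite horner_comp !hornerE -natrD hq.
have : q^`() = 0.
  apply: poly_nat_eq0 => m; have := dq m; rewrite -qm deriv_comp !hornerE horner_comp !hornerE.
  by rewrite derivD derivX derivC addr0 hornerC mulr1.
by move/deriv_eq0 => ->; rewrite !hornerC.
Qed.

End UnipotentPowers.

(** * Zariski closure and connectedness *)

Section ZariskiClosure.
Variables (R : realType) (n : nat).
Local Notation C := R[i].
Local Notation M := 'M[C]_n.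

Definition zclosure (H : set M) : set M :=
  [set A | A \in unitmx /\ forall phi, polyfun phi -> vanishes H phi -> phi A = 0].

Lemma zclosure_closed H : zariski_closed (zclosure H).
Proof.
have := @closed_polyfuns R n [set phi | polyfun phi /\ vanishes H phi].
have -> : [set A | A \in unitmx /\ forall phi, [set phi | polyfun phi /\ vanishes H phi] phi -> phi A = 0]
   = zclosure H.
  apply/seteqP; split=> A /= [uA h]; split=> // phi; first by move=> pphi vphi; apply: h.
  by move=> [pphi vphi]; apply: h.
by apply=> phi [].
Qed.

Lemma sub_zclosure H : H `<=` [set A | A \in unitmx] -> H `<=` zclosure H.
Proof. by move=> Hu A HA; split=> [|phi _]; [exact: Hu | apply]. Qed.

Lemma zclosure_min (H Z : set M) : zariski_closed Z -> H `<=` Z -> zclosure H `<=` Z.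
Proof.
move=> cZ HZ A [uA hA]; apply: (zariski_closedP cZ) => // phi pphi vphi.
by apply: hA => // B /HZ; apply: vphi.
Qed.

Lemma zclosureS (H K : set M) : H `<=` K -> zclosure H `<=` zclosure K.
Proof.
by move=> HK A [uA hA]; split=> // phi pphi vphi; apply: hA => // B /HK; apply: vphi.
Qed.

Lemma closed_of_zclosure (H : set M) : H `<=` [set A | A \in unitmx] ->
  zclosure H `<=` H -> zariski_closed H.
Proof.
move=> Hu HH; have -> : H = zclosure H by apply/seteqP; split=> //; apply: sub_zclosure.
exact: zclosure_closed.
Qed.

Lemma not_closed_polyfun (Z : set M) A : zariski_closed Z -> A \in unitmx -> ~ Z A ->
  exists phi, [/\ polyfun phi, vanishes Z phi & phi A != 0].
Proof.
move=> cZ uA nZ; apply: contrapT => h; apply: nZ; apply: (zariski_closedP cZ) => // phi pphi vphi.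
by apply/eqP; apply: contraT => pA; exfalso; apply: h; exists phi.
Qed.

Lemma zariski_closed_lmul (Z : set M) B : zariski_closed Z -> B \in unitmx ->
  zariski_closed [set A | A \in unitmx /\ Z (B *m A)].
Proof.
move=> cZ uB; apply: closed_of_zclosure => [A []//|A [uA hA]]; split=> //.
apply: (zariski_closedP cZ) => [|phi pphi vphi]; first by rewrite unitmx_mul uB.
apply: (hA (fun A => phi (B *m A))); last by move=> D [_]; apply: vphi.
apply: polyfun_comp pphi; apply: polyfun_mulmx => i j; [exact: polyfun_cst | exact: polyfun_entry].
Qed.

Lemma connected_zclosure (H : set M) : H `<=` [set A | A \in unitmx] ->
  zariski_connected H -> zariski_connected (zclosure H).
Proof.
move=> Hu cH Z1 Z2 c1 c2 h12 h0; have HcH := sub_zclosure Hu.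
have [||h|h] := cH Z1 Z2 c1 c2.
- by apply: subset_trans h12.
- rewrite -subset0 => A [[HA Z1A] Z2A]; rewrite -h0; split=> //; split=> //.
  exact: HcH.
- by left; apply: zclosure_min.
- by right; apply: zclosure_min.
Qed.

(* The product of two connected subgroups is covered by translates of the second
   meeting the first. *)
Lemma connected_mul (B N : set M) : subgroup B -> subgroup N ->
  zariski_connected B -> zariski_connected N ->
  zariski_connected [set g | exists b m, [/\ B b, N m & g = b *m m]].
Proof.
move=> [Bu B1 _ _] [Nu N1 _ _] cB cN; set H := [set g | _].
have BH b : B b -> H b by move=> Bb; exists b, 1%:M; rewrite mulmx1.
have main Z1 Z2 : zariski_closed Z1 -> zariski_closed Z2 -> H `<=` Z1 `|` Z2 ->
    H `&` Z1 `&` Z2 = set0 -> Z1 1%:M -> H `<=` Z1.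
  move=> c1 c2 h12 h0 Z11.
  have no A : H A -> Z1 A -> Z2 A -> False.
    move=> HA Z1A Z2A; suff : (H `&` Z1 `&` Z2) A by rewrite h0.
    by [].
  have BZ1 : B `<=` Z1.
    have [||//|h] := cB Z1 Z2 c1 c2.
    - by move=> b /BH /h12.
    - by rewrite -subset0 => A [[/BH HA Z1A] Z2A]; case: (no A).
    - by case: (no 1%:M) => //; [exact: BH | exact: h].
  move=> g [b [m [Bb Nm ->]]]; have ub := Bu _ Bb.
  have bNH m' : N m' -> H (b *m m') by move=> Nm'; exists b, m'.
  have [||h|h] := cN _ _ (zariski_closed_lmul c1 ub) (zariski_closed_lmul c2 ub).
  - by move=> m' Nm'; have um' := Nu _ Nm'; case: (h12 _ (bNH _ Nm')) => h; [left|right].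
  - rewrite -subset0 => m' [[Nm' [_ Z1m]] [_ Z2m]]; by case: (no (b *m m')) => //; apply: bNH.
  - by case: (h m Nm).
  - case: (no b); [exact: BH | exact: BZ1 |].
    by have [_] := h _ N1; rewrite mulmx1.
move=> Z1 Z2 c1 c2 h12 h0.
case: (h12 _ (BH _ B1)) => Z11; [left; exact: (main _ _ c1 c2) | right].
apply: (main _ _ c2 c1) => //; first by rewrite setUC.
by rewrite -setIA [_ `&` Z1]setIC setIA.
Qed.

End ZariskiClosure.

(** * Unipotent groups attached to a flag *)

Section FlagGroups.
Variables (R : realType) (n : nat).
Local Notation C := R[i].
Local Notation M := 'M[C]_n.

(** The group of interest is the one for [k = 1]. The larger [k] filter it so that commutators add
    the indices, which gives solvability. *)
Definition flag_group (G : set M) (m : set M) (k : nat) : set M :=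
  [set A | G A /\ forall j v, flag m j v -> flag m (j + k) (v *m A - v)].

Variables (G m : set M).
Hypothesis (sG : subgroup G) (fn : flag_nil m).

Lemma flag_group_stable k A j v : flag_group G m k A -> flag m j v -> flag m j (v *m A).
Proof.
move=> [_ hA] hv; rewrite -[v *m A](subrK v); apply: (linsubD (flag_linsub m j)) => //.
exact: (flag_le (leq_addr k j)) (hA _ _ hv).
Qed.

(** Induction from the bottom of the flag: [v A^-1 - v = - (v A - v) A^-1], and [v A - v] lies [k]
    steps further. *)
Lemma flag_group_inv k A j v : (0 < k)%N -> flag_group G m k A -> flag m j v ->
  flag m j (v *m invmx A) /\ flag m (j + k) (v *m invmx A - v).
Proof.
move=> k0 hA; have [K hK] := fn.
have uA : A \in unitmx by case: sG => h _ _ _; apply: h; case: hA.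
have [N leN] := ubnP (K - j)%N; elim: N => // N IH in j v leN *; move=> hv.
have [Kj|jK] := leqP K j.
  have -> : v = 0 by apply: hK; apply: (flag_le Kj).
  by rewrite mul0mx subrr; split; apply: linsub0 (flag_linsub _ _).
have hd := hA.2 _ _ hv; set d := v *m A - v in hd.
have lt : (K - (j + k) < N)%N by lia.
have [hdA _] := IH (j + k)%N d lt hd.
have e : v *m invmx A - v = - (d *m invmx A).
  by rewrite /d mulmxBl mulmxK // opprB.
split; last by rewrite e; apply: (linsubN (flag_linsub _ _)).
rewrite -[v *m invmx A](subrK v) e; apply: (linsubD (flag_linsub m j)) => //.
apply: (linsubN (flag_linsub _ _)); exact: (flag_le (leq_addr k j)).
Qed.

Lemma flag_group_subgroup k : (0 < k)%N -> subgroup (flag_group G m k).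
Proof.
move=> k0; have [Gu G1 GM GV] := sG; split.
- by move=> A [/Gu].
- by split=> // j v hv; rewrite mulmx1 subrr; apply: linsub0 (flag_linsub _ _).
- move=> A B hA hB; split; first by apply: GM; [case: hA | case: hB].
  move=> j v hv.
  have -> : v *m (A *m B) - v = (v *m A *m B - v *m A) + (v *m A - v).
    by rewrite addrA subrK mulmxA.
  apply: (linsubD (flag_linsub _ _)); last exact: hA.2.
  by apply: hB.2; apply: flag_group_stable hA hv.
- move=> A hA; split; first by apply: GV; case: hA.
  by move=> j v hv; case: (flag_group_inv k0 hA hv).
Qed.

Lemma flag_group_closed k : zariski_closed G -> zariski_closed (flag_group G m k).
Proof.
move=> cG; have [Gu _ _ _] := sG.
apply: closed_of_zclosure => [A [/Gu]//|A [uA hA]]; split.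
  by apply: (zariski_closedP cG) => // phi pphi vphi; apply: hA => // B [GB _]; apply: vphi.
move=> j v hv; apply: contrapT => nf.
have [l [l0 /negP]] := linsub_sep (flag_linsub m (j + k)) nf; apply; apply/eqP.
apply: (hA (fun A => l (v *m A - v))); last by move=> B [_ hB]; apply: l0; apply: hB.
apply: (@polyfun_ext _ _ (fun A => l (v *m A) + - l v)); first by move=> B; rewrite linearB.
apply: polyfunD; last exact: polyfun_cst.
by apply: polyfun_scalar => a x y; rewrite mulmxDr -scalemxAr linearP.
Qed.

Lemma flag_group_unipotent k : (0 < k)%N -> unipotent_group (flag_group G m k).
Proof.
move=> k0 A hA; have [K hK] := fn; exists K.
apply: mulmx_row_eq0 => v; apply: hK.
elim: K => [//|K IH].
have -> : v *m (A - 1%:M) ^+ K.+1 = v *m (A - 1%:M) ^+ K *m A - v *m (A - 1%:M) ^+ K.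
  have -> : (A - 1%:M) ^+ K.+1 = (A - 1%:M) ^+ K *m (A - 1%:M) by rewrite exprSr.
  by rewrite mulmxA mulmxBr mulmx1.
have le : (K.+1 <= K + k)%N by lia.
by apply: (flag_le le); apply: hA.2.
Qed.

Lemma flag_group_conj k A B : G B -> (forall w, m w -> m (invmx B *m w *m B)) ->
  (forall w, m w -> m (B *m w *m invmx B)) -> flag_group G m k A -> flag_group G m k (Ad B A).
Proof.
have [Gu _ GM GV] := sG.
move=> GB h1 h2 [GA hA]; have uB := Gu _ GB; split.
  by apply: subgroup_Ad.
have VB j v : flag m j v -> flag m j (v *m invmx B).
  by apply: flag_conj_stable; rewrite ?unitmx_inv // invmxK.
move=> j v hv; rewrite /Ad.
have -> : v *m (B *m A *m invmx B) - v = (v *m B *m A - v *m B) *m invmx B.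
  by rewrite mulmxBl !mulmxA mulmxK.
by apply: VB; apply: hA; apply: flag_conj_stable.
Qed.

Lemma flag_group_nexp X K t : G (nexp idfun K.+1 X t) -> m X ->
  flag_group G m 1 (nexp idfun K.+1 X t).
Proof.
move=> GE mX; split=> // j v hv; rewrite addn1.
have -> : v *m nexp idfun K.+1 X t - v =
    \sum_(k < K) v *m (t ^+ k.+1 *: map_mx idfun ((k.+1)`!%:R^-1 *: (X ^+ k.+1 : M))).
  rewrite /nexp big_ord_recl mulmxDr mulmx_sumr expr0 scale1r fact0 invr1 scale1r.
  by rewrite map_mx_id // mulmx1 addrAC subrr add0r.
apply: (linsub_sum (flag_linsub m j.+1)) => k _.
have -> : map_mx idfun ((k.+1)`!%:R^-1 *: (X ^+ k.+1 : M)) = (k.+1)`!%:R^-1 *: (X ^+ k.+1 : M).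
  by rewrite map_mx_id.
rewrite -!scalemxAr; do 2!apply: (linsubZ (flag_linsub m j.+1)).
elim: (k : nat) => [|i IH]; first by rewrite expr1; apply: flagM.
have -> : X ^+ i.+2 = X ^+ i.+1 *m X by rewrite exprSr.
by rewrite mulmxA; apply: flag_dec; apply: flagM.
Qed.

End FlagGroups.

(** * Solvable groups, their closures, and maximality of Borel subgroups *)

Section SolvableGroups.
Variables (R : realType) (n : nat).
Local Notation C := R[i].
Local Notation M := 'M[C]_n.

Lemma generated_sub (S H : set M) : subgroup H -> S `<=` H -> generated S `<=` H.
Proof.
move=> [_ H1 HM HV] SH A; elim=> [B /SH //|//|B D _ HB _ HD|B _ HB]; [exact: HM | exact: HV].
Qed.

Lemma derived_subgroupS (H K : set M) : H `<=` K -> derived_subgroup H `<=` derived_subgroup K.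
Proof.
move=> HK A; elim=> [B [x [y [Hx Hy ->]]]||B D _ hB _ hD|B _ hB].
- by apply: Gen_in; exists x, y; split=> //; apply: HK.
- exact: Gen_one.
- exact: Gen_mul.
- exact: Gen_inv.
Qed.

Lemma derived_subgroup_sub (H : set M) : subgroup H -> derived_subgroup H `<=` H.
Proof.
move=> sH; apply: generated_sub => // A [x [y [Hx Hy ->]]]; case: (sH) => _ _ HM HV.
by apply: (HM _ _ (HM _ _ (HM _ _ Hx Hy) (HV _ Hx)) (HV _ Hy)).
Qed.

Lemma derived_subgroup_group (H : set M) : subgroup H -> subgroup (derived_subgroup H).
Proof.
move=> sH; split.
- by move=> A /(derived_subgroup_sub sH); case: sH => h _ _ _; apply: h.
- exact: Gen_one.
- by move=> A B; exact: Gen_mul.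
- by move=> A; exact: Gen_inv.
Qed.

Lemma iter_derived_group (H : set M) k : subgroup H -> subgroup (iter k (@derived_subgroup R n) H).
Proof. by move=> sH; elim: k => //= k IH; apply: derived_subgroup_group. Qed.

Lemma iter_derived_sub (H : set M) k : subgroup H -> iter k (@derived_subgroup R n) H `<=` H.
Proof.
move=> sH; elim: k => //= k IH A /(derived_subgroup_sub (iter_derived_group k sH)).
exact: IH.
Qed.

(** Inversion is not a polynomial map, so a power of the determinant is allowed as denominator. This
    does not affect vanishing at invertible matrices. *)
Definition regular (u : M -> C) : Prop := exists (d : nat) (psi : M -> C),
  polyfun psi /\ forall A, A \in unitmx -> u A * (\det A) ^+ d = psi A.

Lemma regular_polyfun u : polyfun u -> regular u.
Proof. by move=> pu; exists 0%N, u; split=> // A _; rewrite expr0 mulr1. Qed.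

Lemma polyfun_det1 : polyfun (fun A : M => \det A).
Proof. by apply: polyfun_det => i j; exact: polyfun_entry. Qed.

Lemma regularD u v : regular u -> regular v -> regular (fun A => u A + v A).
Proof.
move=> [d [f [pf hf]]] [d' [g [pg hg]]].
exists (d + d')%N, (fun A => f A * \det A ^+ d' + g A * \det A ^+ d); split.
  by apply: polyfunD; apply: polyfunM => //; apply: polyfunX; exact: polyfun_det1.
by move=> A uA; rewrite -hf // -hg // exprD; ring.
Qed.

Lemma regularM u v : regular u -> regular v -> regular (fun A => u A * v A).
Proof.
move=> [d [f [pf hf]]] [d' [g [pg hg]]].
exists (d + d')%N, (fun A => f A * g A); split; first exact: polyfunM.
by move=> A uA; rewrite -hf // -hg // exprD; ring.
Qed.

Lemma regular_sum (I : Type) (r : seq I) (u : I -> M -> C) :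
  (forall i, regular (u i)) -> regular (fun A => \sum_(i <- r) u i A).
Proof.
move=> h; elim: r => [|i r IH].
  have -> : (fun A => \sum_(i <- [::]) u i A) = (fun _ => 0) by apply: funext => A; rewrite big_nil.
  by apply: regular_polyfun; exact: polyfun_cst.
have -> : (fun A => \sum_(j <- i :: r) u j A) = (fun A => u i A + \sum_(j <- r) u j A).
  by apply: funext => A; rewrite big_cons.
exact: regularD.
Qed.

Lemma regular_mulmx (Phi Psi : M -> M) :
  (forall i j, regular (fun A => Phi A i j)) -> (forall i j, regular (fun A => Psi A i j)) ->
  forall i j, regular (fun A => (Phi A *m Psi A) i j).
Proof.
move=> h1 h2 i j.
have -> : (fun A => (Phi A *m Psi A) i j) = (fun A => \sum_k Phi A i k * Psi A k j).
  by apply: funext => A; rewrite mxE.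
by apply: regular_sum => k; apply: regularM.
Qed.

Lemma regular_inv i j : regular (fun A : M => (invmx A) i j).
Proof.
exists 1%N, (fun A => (\adj A) i j); split.
  by apply: polyfun_adj => a b; exact: polyfun_entry.
move=> A uA; rewrite /invmx uA mxE expr1 mulrC mulrA mulfV ?mul1r //.
Qed.

Lemma regular_comp (Phi : M -> M) phi : (forall i j, regular (fun A => Phi A i j)) ->
  polyfun phi -> regular (fun A => phi (Phi A)).
Proof.
move=> h; apply: polyfun_ind; [|exact: regularD|exact: regularM|exact: h].
by move=> c; apply: regular_polyfun; exact: polyfun_cst.
Qed.

Lemma regular_zclosure (S T : set M) (Phi : M -> M) :
  S `<=` [set A | A \in unitmx] -> (forall i j, regular (fun A => Phi A i j)) ->
  (forall A, A \in unitmx -> Phi A \in unitmx) -> (forall A, S A -> zclosure T (Phi A)) ->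
  forall A, zclosure S A -> zclosure T (Phi A).
Proof.
move=> Su hPhi uPhi hST A [uA hA]; split=> [|phi pphi vphi]; first exact: uPhi.
have [d [psi [ppsi hpsi]]] := regular_comp hPhi pphi.
have /eqP : phi (Phi A) * \det A ^+ d = 0.
  rewrite hpsi // hA // => B SB; rewrite -hpsi ?Su //.
  by have [_ ->] := hST B SB; rewrite ?mul0r.
rewrite mulf_eq0 expf_eq0 => /orP [/eqP //|/andP [_ detA]].
by move: uA; rewrite unitmxE unitfE detA.
Qed.

Lemma regular_cst (B : M) i j : regular (fun _ => B i j).
Proof. by apply: regular_polyfun; exact: polyfun_cst. Qed.

Lemma regular_entry i j : regular (fun A : M => A i j).
Proof. by apply: regular_polyfun; exact: polyfun_entry. Qed.

Lemma zclosure_subgroup (H : set M) : subgroup H -> subgroup (zclosure H).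
Proof.
move=> [Hu H1 HM HV]; have HcH := sub_zclosure Hu; split.
- by move=> A [].
- exact: HcH.
- move=> A B cA cB.
  apply: (regular_zclosure (S := H) (Phi := fun A => A *m B)) cA => //.
  + by apply: regular_mulmx => i j; [exact: regular_entry | exact: regular_cst].
  + by move=> D uD; rewrite unitmx_mul uD; case: cB.
  move=> D HD; apply: (regular_zclosure (S := H) (Phi := fun B => D *m B)) cB => //.
  + by apply: regular_mulmx => i j; [exact: regular_cst | exact: regular_entry].
  + by move=> E uE; rewrite unitmx_mul uE Hu.
  + by move=> E HE; apply: HcH; apply: HM.
- apply: regular_zclosure => //.
  + exact: regular_inv.
  + by move=> A; rewrite unitmx_inv.
  + by move=> A HA; apply: HcH; apply: HV.
Qed.

(** The commutator is treated as a function of one matrix at a time: first [x] is moved from the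
    closure to [H] with [y] fixed, then [y]. *)
Lemma derived_zclosure (H : set M) : subgroup H ->
  derived_subgroup (zclosure H) `<=` zclosure (derived_subgroup H).
Proof.
move=> sH; have [Hu H1 HM HV] := sH.
have sD := derived_subgroup_group sH; have sDc := zclosure_subgroup sD.
apply: generated_sub => // A [x [y [cx cy ->]]].
have Du : derived_subgroup H `<=` [set A | A \in unitmx] by case: sD.
apply: (regular_zclosure (S := H) (Phi := fun x => x *m y *m invmx x *m invmx y)) cx => //.
- apply: regular_mulmx => [|i j]; last exact: regular_cst.
  apply: regular_mulmx => [|i j]; last exact: regular_inv.
  by apply: regular_mulmx => i j; [exact: regular_entry | exact: regular_cst].
- by move=> z uz; rewrite !unitmx_mul !unitmx_inv uz; case: cy => ->.
move=> z Hz; have uz := Hu _ Hz.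
apply: (regular_zclosure (S := H) (Phi := fun y => z *m y *m invmx z *m invmx y)) cy => //.
- apply: regular_mulmx => [|i j]; last exact: regular_inv.
  apply: regular_mulmx => [|i j]; last exact: regular_cst.
  by apply: regular_mulmx => i j; [exact: regular_cst | exact: regular_entry].
- by move=> w uw; rewrite !unitmx_mul !unitmx_inv uz uw.
- by move=> w Hw; apply: (sub_zclosure Du); apply: Gen_in; exists z, w.
Qed.

Lemma zclosure1 : zclosure [set (1%:M : M)] `<=` [set 1%:M].
Proof.
move=> A [uA hA] /=; apply/matrixP => i j; apply/eqP; rewrite -subr_eq0; apply/eqP.
apply: (hA (fun A => A i j + - ((1%:M : M) i j))).
  by apply: polyfunD; [exact: polyfun_entry | exact: polyfun_cst].
by move=> _ ->; rewrite subrr.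
Qed.

Lemma solvable_zclosure (H : set M) : subgroup H -> solvable_group H -> solvable_group (zclosure H).
Proof.
move=> sH [k hk]; exists k; apply: subset_trans zclosure1.
apply: (@subset_trans _ (zclosure (iter k (@derived_subgroup R n) H))); last exact: zclosureS.
elim: k {hk} => //= k IH; apply: subset_trans (derived_zclosure (iter_derived_group k sH)).
exact: derived_subgroupS.
Qed.

(** By [commutator_mul] the [k]-th derived subgroup of [B N] lies in [D N], with [D] the [k]-th
    derived subgroup of [B]. Once [D] is trivial, the derived series continues inside [N]. *)
Lemma solvable_mul (B N : set M) : subgroup B -> subgroup N -> 
  (forall b m, B b -> N m -> N (Ad b m)) -> solvable_group B -> solvable_group N ->
  subgroup [set g | exists b m, [/\ B b, N m & g = b *m m]] /\
  solvable_group [set g | exists b m, [/\ B b, N m & g = b *m m]].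
Proof.
move=> sB sN BN [k hk] [l hl].
have [Bu B1 BM BV] := sB; have [Nu N1 NM NV] := sN.
have NB b m : B b -> N m -> N (invmx b *m m *m b).
  by move=> Bb Nm; have := BN _ _ (BV _ Bb) Nm; rewrite /Ad invmxK.
have subg D : subgroup D -> D `<=` B -> subgroup [set g | exists b m, [/\ D b, N m & g = b *m m]].
  move=> [Du D1 DM DV] DB; split.
  - by move=> _ [b [m [Db Nm ->]]] /=; rewrite unitmx_mul (Du _ Db) (Nu _ Nm).
  - by exists 1%:M, 1%:M; rewrite mulmx1.
  - move=> _ _ [b [m [Db Nm ->]]] [b' [m' [Db' Nm' ->]]].
    exists (b *m b'), ((invmx b' *m m *m b') *m m'); split; first exact: DM.
      by apply: NM => //; apply: NB => //; apply: DB.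
    by rewrite !mulmxA mulmxK // (Du _ Db').
  - move=> _ [b [m [Db Nm ->]]].
    have ub := Du _ Db; have um := Nu _ Nm.
    exists (invmx b), (Ad b (invmx m)); split; first exact: DV.
      by apply: BN; [exact: DB | exact: NV].
    by rewrite /Ad !mulmxA mulVmx // mul1mx invmx_mul.
split; first exact: subg.
exists (l + k)%N; rewrite iterD.
apply: (@subset_trans _ (iter l (@derived_subgroup R n) N)) => //.
elim: l {hl} => [|l IH] /=; last exact: derived_subgroupS.
apply: (@subset_trans _ [set g | exists b m, [/\ iter k (@derived_subgroup R n) B b, N m & g = b *m m]]);
  last by move=> _ [b [m [/hk -> Nm ->]]] /=; rewrite mul1mx.
elim: k {hk} => [//|k IH]; rewrite [X in X `<=` _]iterS.
have sDk := iter_derived_group k sB.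
have DkB := @iter_derived_sub B k sB.
apply: (subset_trans (derived_subgroupS IH)).
apply: generated_sub.
  by apply: subg; [exact: iter_derived_group | exact: iter_derived_sub].
move=> _ [_ [_ [[b [m [Db Nm ->]]] [b' [m' [Db' Nm' ->]]] ->]]].
have Bb := DkB _ Db; have Bb' := DkB _ Db'.
have ub := Bu _ Bb; have ub' := Bu _ Bb'; have um := Nu _ Nm; have um' := Nu _ Nm'.
exists (b *m b' *m invmx b *m invmx b').
exists (Ad b' (Ad b ((invmx b' *m m *m b') *m m' *m invmx m) *m invmx m')).
split.
- by rewrite iterS; apply: Gen_in; exists b, b'.
- have n1 := NM _ _ (NM _ _ (NB _ _ Bb' Nm) Nm') (NV _ Nm).
  exact: (BN _ _ Bb' (NM _ _ (BN _ _ Bb n1) (NV _ Nm'))).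
exact: commutator_mul.
Qed.

(** The closure of [B N] is again closed, connected, solvable and contained in [G], so it equals [B]
    by maximality. *)
Lemma borel_absorb (G B N : set M) : closed_subgroup G -> borel_subgroup G B ->
  subgroup N -> N `<=` G -> zariski_connected N -> solvable_group N ->
  (forall b m, B b -> N m -> N (Ad b m)) -> N `<=` B.
Proof.
move=> [sG cG] [[cB kB solB BG] maxB] sN NG kN solN BN.
have [sB _] := cB; set H := [set g | exists b m, [/\ B b, N m & g = b *m m]].
have [sH solH] := solvable_mul sB sN BN solB solN; rewrite -/H in sH solH.
have [Bu B1 BM BV] := sB; have [Nu N1 NM NV] := sN; have [Gu G1 GM GV] := sG.
have [Hu _ _ _] := sH.
have kH : zariski_connected H by exact: connected_mul.
have HG : H `<=` G by move=> _ [b [m [Bb Nm ->]]]; apply: GM; [exact: BG | exact: NG].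
have BH : B `<=` H by move=> b Bb; exists b, 1%:M; rewrite mulmx1.
have NH : N `<=` H by move=> m Nm; exists 1%:M, m; rewrite mul1mx.
have <- : zclosure H = B.
  apply: maxB; last by apply: subset_trans (sub_zclosure Hu).
  split.
  - by split; [exact: zclosure_subgroup | exact: zclosure_closed].
  - exact: connected_zclosure.
  - exact: solvable_zclosure.
  - exact: zclosure_min.
exact: subset_trans (sub_zclosure Hu).
Qed.

Lemma flag_group_le (G m : set M) k l : (k <= l)%N -> flag_group G m l `<=` flag_group G m k.
Proof.
move=> kl A [GA hA]; split=> // j v hv; apply: (flag_le _ (hA _ _ hv)).
by rewrite leq_add2l.
Qed.

(** [A B - B A] is the additive commutator of [A - 1] and [B - 1], which moves each vector [k + l]
    steps down. *)
Lemma flag_group_comm (G m : set M) k l A B : subgroup G -> flag_nil m -> (0 < k)%N -> (0 < l)%N ->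
  flag_group G m k A -> flag_group G m l B ->
  flag_group G m (k + l) (A *m B *m invmx A *m invmx B).
Proof.
move=> sG fn k0 l0 hA hB; have [Gu G1 GM GV] := sG.
have [GA hA2] := hA; have [GB hB2] := hB.
have uA := Gu _ GA; have uB := Gu _ GB.
split; first exact: (GM _ _ (GM _ _ (GM _ _ GA GB) (GV _ GA)) (GV _ GB)).
move=> j v hv; set w := v *m A *m B - v *m B *m A.
have -> : v *m (A *m B *m invmx A *m invmx B) - v = w *m invmx A *m invmx B.
  by rewrite /w !mulmxBl !mulmxA !mulmxK.
have wE : w = ((v *m A - v) *m B - (v *m A - v)) - ((v *m B - v) *m A - (v *m B - v)).
  rewrite /w !mulmxBl; set a := v *m A *m B; set b := v *m B *m A.
  by clearbody a b; apply/matrixP => s t; rewrite !mxE; ring.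
have hw : flag m (j + (k + l)) w.
  rewrite wE; apply: (linsubB (flag_linsub _ _)); first by rewrite addnA; apply: hB2; apply: hA2.
  by rewrite [(k + l)%N]addnC addnA; apply: hA2; apply: hB2.
have [h1 _] := flag_group_inv sG fn k0 hA hw.
by have [] := flag_group_inv sG fn l0 hB h1.
Qed.

Lemma flag_group_solvable (G m : set M) : subgroup G -> flag_nil m ->
  solvable_group (flag_group G m 1).
Proof.
move=> sG fn; have [K hK] := fn; exists K.
have h i : iter i (@derived_subgroup R n) (flag_group G m 1) `<=` flag_group G m i.+1.
  elim: i => [//|i IH]; rewrite [X in X `<=` _]iterS.
  apply: (subset_trans (derived_subgroupS IH)); apply: generated_sub; first exact: flag_group_subgroup.
  move=> _ [A [B [hA hB ->]]].
  by apply: (@flag_group_le G m i.+2 (i.+1 + i.+1)); [lia | exact: flag_group_comm].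
move=> A /h [_ hA] /=; apply/eqP; rewrite -subr_eq0; apply/eqP/mulmx_row_eq0 => v.
rewrite mulmxBr mulmx1; apply: hK; apply: (flag_le (leqnSn K)).
by have := hA 0%N v I; rewrite add0n.
Qed.

End SolvableGroups.

(** * Closed unipotent groups *)

Section UnipotentGroups.
Variables (R : realType) (n : nat).
Local Notation C := R[i].
Local Notation M := 'M[C]_n.

(** The powers of [A] and of its inverse extend to polynomial curves that are inverse to each other
    at the naturals, hence everywhere. A polynomial vanishing on [H] vanishes at the natural
    parameters, hence along the whole curve. *)
Lemma unipotent_one_parameter (H : set M) A : closed_subgroup H -> unipotent_group H -> H A ->
  exists Bt : 'M[{poly C}]_n, (forall t, H (mxat Bt t)) /\ forall m : nat, mxat Bt m%:R = A ^+ m.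
Proof.
move=> [sH cH] uH HA; have [Hu H1 HM HV] := sH.
have [K1 h1] := uH _ HA; have [K2 h2] := uH _ (HV _ HA).
have [Bt hB] := unipotent_curve h1; have [Dt hD] := unipotent_curve h2.
have uA := Hu _ HA.
have HX m : H (A ^+ m) by elim: m => [|m IH]; rewrite ?expr0 // exprS; apply: HM.
have BD t : mxat Bt t *m mxat Dt t = 1%:M.
  have BDt s : mxat (Bt *m Dt) s = mxat Bt s *m mxat Dt s by rewrite /mxat map_mxM.
  rewrite -BDt; apply/matrixP => i j; rewrite mxatE.
  have -> : (Bt *m Dt) i j = ((1%:M : M) i j)%:P.
    apply: poly_nat_inj => k; rewrite -mxatE BDt /mxat hB hD hornerC.
    by rewrite exp_invmx.
  by rewrite hornerC.
exists Bt; split=> // t; apply: (zariski_closedP cH).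
  by have /mulmx1_unit [] := BD t.
move=> phi pphi vphi; have [q hq] := polyfun_curve Bt pphi.
rewrite hq (_ : q = 0) ?horner0 //; apply: poly_nat_eq0 => k.
by rewrite -hq /mxat hB vphi.
Qed.

(** Every element is joined to 1 by a polynomial curve inside [H], and a product of two nonzero
    polynomials in one variable is not 0. *)
Lemma unipotent_connected (H : set M) : closed_subgroup H -> unipotent_group H ->
  zariski_connected H.
Proof.
move=> cH uH; have [sH _] := cH; have [Hu H1 HM HV] := sH.
have main Z1 Z2 : zariski_closed Z1 -> zariski_closed Z2 -> H `<=` Z1 `|` Z2 ->
    H `&` Z1 `&` Z2 = set0 -> Z1 1%:M -> H `<=` Z1.
  move=> c1 c2 h12 h0 Z11 A HA; apply: contrapT => nZ1.
  have no B : H B -> Z1 B -> Z2 B -> False.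
    move=> HB Z1B Z2B; suff : (H `&` Z1 `&` Z2) B by rewrite h0.
    by [].
  have [Bt [HB hB]] := unipotent_one_parameter cH uH HA.
  have nZ2 : ~ Z2 1%:M by move=> Z21; apply: (no 1%:M).
  have [f1 [p1 v1 n1]] := not_closed_polyfun c1 (Hu _ HA) nZ1.
  have [f2 [p2 v2 n2]] := not_closed_polyfun c2 (unitmx1 _ _) nZ2.
  have [q1 hq1] := polyfun_curve Bt p1; have [q2 hq2] := polyfun_curve Bt p2.
  have q10 : q1 != 0.
    by apply: contra n1 => /eqP q0; rewrite -[A]expr1 -hB hq1 q0 horner0.
  have q20 : q2 != 0.
    apply: contra n2 => /eqP q0; have -> : 1%:M = A ^+ 0 by rewrite expr0.
    by rewrite -hB hq2 q0 horner0.
  have : q1 * q2 = 0.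
    apply: poly_nat_eq0 => k; rewrite hornerM -hq1 -hq2.
    by case: (h12 _ (HB k%:R)) => h; [rewrite v1 ?mul0r | rewrite v2 ?mulr0].
  by move/eqP; rewrite mulf_eq0 (negPf q10) (negPf q20).
move=> Z1 Z2 c1 c2 h12 h0; case: (h12 _ H1) => Z11; [left; exact: (main _ _ c1 c2) | right].
apply: (main _ _ c2 c1) => //; first by rewrite setUC.
by rewrite -setIA [_ `&` Z1]setIC setIA.
Qed.

(* Modulo the next step of the flag, the orbit of a vector under a one-parameter
   subgroup of [U] has zero derivative. *)
Lemma unipotent_flag (G U m : set M) : subgroup G -> U `<=` G ->
  closed_subgroup U -> unipotent_group U -> Lie U `<=` m -> flag_nil m ->
  U `<=` flag_group G m 1.
Proof.
move=> sG UG cU uU Um [K hK] A0 UA0; split; first exact: UG.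
suff h j A v : U A -> flag m j v -> flag m j.+1 (v *m A - v).
  by move=> j v hv; rewrite addn1; apply: h.
have [N leN] := ubnP (K - j)%N; elim: N => // N IH in j A v leN * => UA hv.
have [Kj|jK] := leqP K j.
  have -> : v = 0 by apply: hK; apply: (flag_le Kj).
  by rewrite mul0mx subrr; apply: linsub0 (flag_linsub _ _).
have stab B w : U B -> flag m j.+1 w -> flag m j.+1 (w *m B).
  move=> UB hw; rewrite -[w *m B](subrK w); apply: (linsubD (flag_linsub m j.+1)) => //.
  by apply: flag_dec; apply: IH => //; lia.
have [Bt [UB hB]] := unipotent_one_parameter cU uU UA.
have La : Lie U (mxat (map_mx deriv Bt) 0).
  by apply: Lie_curve => //; rewrite -[0]/(0%:R) hB expr0.
set a := mxat _ 0 in La.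
apply: contrapT => nf.
have [l [l0 /negP]] := linsub_sep (flag_linsub m j.+1) nf; apply; apply/eqP.
have scal (B : M) : scalar (fun Z : M => l (v *m (Z *m B))).
  by move=> c x y; rewrite mulmxDl mulmxDr -scalemxAl -scalemxAr linearP.
have lin (B : M) : exists q : {poly C},
    (forall t, q.[t] = l (v *m (mxat Bt t *m B))) /\ q^`().[0] = l (v *m (a *m B)).
  have [L hL] := scalar_ex (scal B).
  by have [q [h1 h2]] := scalar_curve L Bt; exists q; split=> [t|]; rewrite -hL.
have [q [hq _]] := lin 1%:M.
have [qs hqs] := choice (fun m' : nat => lin (A ^+ m')).
have qc := @horner_shift_const _ q qs.
have : q.[1] = q.[0].
  apply: qc => [i k|i].
    rewrite hq (hqs i).1 mulmx1 !hB.
    by have -> : A ^+ (k + i) = A ^+ k *m A ^+ i by rewrite exprD.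
  rewrite (hqs i).2 mulmxA; apply: l0.
  have : U (A ^+ i) by rewrite -hB.
  by move=> UAi; apply: stab => //; apply: flagM => //; apply: Um.
have h1 : mxat Bt 1 = A by have := hB 1%N; rewrite expr1.
have h0 : mxat Bt 0 = 1%:M by have := hB 0%N; rewrite expr0.
by rewrite !hq !mulmx1 h1 h0 mulmx1 linearB => ->; rewrite subrr.
Qed.

End UnipotentGroups.

(** * Toral elements, the trace form and parabolic subgroups *)

Section ToralElements.
Variables (F : numFieldType) (n : nat).
Local Notation M := 'M[F]_n.
Variables (Q : M) (lam : 'rV[F]_n).
Hypothesis Qu : Q \in unitmx.
Let t0 := invmx Q *m diag_mx lam *m Q.

Lemma toral_entry x c : mbr t0 x = c *: x <->
  forall i j, (lam 0 i - lam 0 j - c) * (Q *m x *m invmx Q) i j = 0.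
Proof.
have conjE : Q *m (mbr t0 x - c *: x) *m invmx Q =
    \matrix_(i, j) ((lam 0 i - lam 0 j - c) * (Q *m x *m invmx Q) i j).
  rewrite /mbr /t0; set y := Q *m x *m invmx Q.
  have -> : x = invmx Q *m y *m Q by rewrite /y !mulmxA mulVmx // mul1mx mulmxKV.
  have -> : Q *m (invmx Q *m diag_mx lam *m Q *m (invmx Q *m y *m Q) -
     invmx Q *m y *m Q *m (invmx Q *m diag_mx lam *m Q) - c *: (invmx Q *m y *m Q)) *m invmx Q
    = diag_mx lam *m y - y *m diag_mx lam - c *: y.
    rewrite !mulmxBr !mulmxBl -!scalemxAr -!scalemxAl !mulmxA.
    by rewrite !mulmxV // !mul1mx !mulmxK.
  rewrite mul_mx_diag mul_diag_mx; clearbody y.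
  by apply/matrixP => i j; rewrite !mxE; ring.
split=> [e i j|h].
  have /matrixP /(_ i j) := conjE.
  by rewrite e subrr mulmx0 mul0mx !mxE => <-.
apply/eqP; rewrite -subr_eq0; apply/eqP.
have : Q *m (mbr t0 x - c *: x) *m invmx Q = 0.
  by rewrite conjE; apply/matrixP => i j; rewrite [LHS]mxE h [RHS]mxE.
move/(congr1 (fun A => invmx Q *m A *m Q)).
by rewrite !mulmxA mulVmx // mul1mx mulmxKV // mulmx0 mul0mx.
Qed.

(** The projection onto the eigenspace of [ad t0] for the eigenvalue [c]. *)
Definition wcomp (c : F) (x : M) : M :=
  invmx Q *m (\matrix_(i, j) ((Q *m x *m invmx Q) i j *+ (lam 0 i - lam 0 j == c))) *m Q.

Definition wdiffs : seq F := undup [seq lam 0 p.1 - lam 0 p.2 | p : 'I_n * 'I_n].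

Lemma wcomp_sum x : x = \sum_(c <- wdiffs) wcomp c x.
Proof.
rewrite /wcomp -mulmx_suml -mulmx_sumr.
have -> : \sum_(c <- wdiffs) (\matrix_(i, j) ((Q *m x *m invmx Q) i j *+ (lam 0 i - lam 0 j == c)))
   = Q *m x *m invmx Q.
  apply/matrixP => i j; rewrite summxE (bigD1_seq (lam 0 i - lam 0 j)) /=.
  - rewrite mxE eqxx mulr1n big1 ?addr0 // => c.
    by rewrite mxE eq_sym => /negPf ->.
  - by rewrite mem_undup; apply/mapP; exists (i, j); rewrite ?mem_enum.
  - exact: undup_uniq.
by rewrite !mulmxA mulVmx // mul1mx mulmxKV.
Qed.

Lemma wcomp_eigen c x : mbr t0 (wcomp c x) = c *: wcomp c x.
Proof.
apply/toral_entry => i j; rewrite /wcomp !mulmxA mulmxV // mul1mx mulmxK // mxE.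
by case: eqP => [->|_]; rewrite ?subrr ?mul0r // mulr0n mulr0.
Qed.

(** A polynomial in [ad t0] that vanishes at all the other eigenvalues isolates the component up to
    a nonzero scalar. *)
Lemma wcomp_mem (S : set M) c x : linsub S -> (forall y, S y -> S (mbr t0 y)) ->
  S x -> S (wcomp c x).
Proof.
move=> hS St Sx.
have pow k : S (\sum_(d <- wdiffs) d ^+ k *: wcomp d x).
  elim: k => [|k IH].
    by under eq_bigr do rewrite expr0 scale1r; rewrite -wcomp_sum.
  have := St _ IH.
  have -> : mbr t0 (\sum_(d <- wdiffs) d ^+ k *: wcomp d x) =
     \sum_(d <- wdiffs) mbr t0 (d ^+ k *: wcomp d x).
    by rewrite /mbr mulmx_sumr mulmx_suml -sumrB.
  have -> : \sum_(d <- wdiffs) mbr t0 (d ^+ k *: wcomp d x) =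
     \sum_(d <- wdiffs) d ^+ k.+1 *: wcomp d x; last by [].
  apply: eq_bigr => d _.
  by rewrite /mbr -scalemxAr -scalemxAl -scalerBr -/(mbr _ _) wcomp_eigen scalerA exprSr.
have hp (p : {poly F}) : S (\sum_(d <- wdiffs) p.[d] *: wcomp d x).
  under eq_bigr do rewrite horner_coef scaler_suml.
  rewrite exchange_big; apply: (linsub_sum hS) => k _ /=.
  under eq_bigr do rewrite -scalerA.
  by rewrite -scaler_sumr; apply: (linsubZ hS).
have [cs|ncs] := boolP (c \in wdiffs); last first.
  have -> : wcomp c x = 0; last exact: (linsub0 hS).
  rewrite /wcomp (_ : \matrix_(i, j) _ = 0) ?mulmx0 ?mul0mx //.
  apply/matrixP => i j; rewrite !mxE; case: eqP => [e|_]; last by rewrite mulr0n.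
  by case/negP: ncs; rewrite mem_undup; apply/mapP; exists (i, j); rewrite ?mem_enum.
pose p := \prod_(d <- wdiffs | d != c) ('X - d%:P).
have pc : p.[c] != 0.
  rewrite horner_prod prodf_seq_neq0; apply/allP => d _; apply/implyP => dc.
  by rewrite !hornerE subr_eq0 eq_sym.
have := hp p; rewrite (bigD1_seq c) ?undup_uniq //= big_seq_cond big1 ?addr0 => [h|d].
  by have := linsubZ hS p.[c]^-1 h; rewrite scalerA mulVf // scale1r.
move=> /andP [ds dc]; suff -> : p.[d] = 0 by rewrite scale0r.
by apply/eqP; rewrite horner_prod prodf_seq_eq0; apply/hasP; exists d; rewrite ?dc ?hornerE ?subrr //=.
Qed.

(** A product of [k] vectors of weight [c] has weight [k c], and for a suitable [k] this is no
    difference of two entries of [lam]. *)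
Lemma toral_word_nil (c : F) : c != 0 ->
  exists r, forall p, word [set x | mbr t0 x = c *: x] r p -> p = 0.
Proof.
move=> c0.
pose P := \prod_(q : 'I_n * 'I_n) ((lam 0 q.1 - lam 0 q.2)%:P - c *: 'X : {poly F}).
have Pn0 : P != 0.
  apply/prodf_neq0 => q _; apply: contra c0 => /eqP e.
  have := congr1 (fun s : {poly F} => s`_1) e.
  by rewrite coefB coefC coefZ coefX /= sub0r mulr1 coef0 => /eqP; rewrite oppr_eq0.
have [k Pk] : exists k : nat, P.[k%:R] != 0.
  apply: contra_neqP Pn0 => /forallNP h; apply: poly_nat_eq0 => k.
  by have /negP := h k; rewrite negbK => /eqP.
exists k => p hp.
have /toral_entry h : mbr t0 p = (k%:R * c) *: p.
  elim: k p hp {Pk} => [p ->|k IH p [q [w [hq hw ->]]]].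
    by rewrite mul0r scale0r /mbr mulmx1 mul1mx subrr.
  have -> : mbr t0 (q *m w) = mbr t0 q *m w + q *m mbr t0 w.
    by rewrite /mbr mulmxBl mulmxBr !mulmxA addrA subrK.
  rewrite (IH _ hq) hw -scalemxAl -scalemxAr -scalerDl; congr (_ *: _).
  by rewrite -natr1 mulrDl mul1r.
have : Q *m p *m invmx Q = 0.
  apply/matrixP => i j; rewrite [RHS]mxE; have /eqP := h i j.
  rewrite mulf_eq0 => /orP [e|/eqP //]; exfalso; move: Pk; rewrite horner_prod.
  move/prodf_neq0 => /(_ (i, j) isT) /=; rewrite !hornerE [c * _]mulrC.
  by rewrite (eqP e) eqxx.
move/(congr1 (fun A => invmx Q *m A *m Q)).
by rewrite !mulmxA mulVmx // mul1mx mulmxKV // mulmx0 mul0mx.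
Qed.

Lemma toral_nilpotent x (c : F) : c != 0 -> mbr t0 x = c *: x -> exists k, x ^+ k.+1 = 0.
Proof.
move=> c0 hx; have [r hr] := toral_word_nil c0; exists r.
have : word [set x | mbr t0 x = c *: x] r (x ^+ r).
  elim: r {hr} => [|r IH]; first by rewrite expr0.
  by exists (x ^+ r), x; rewrite exprSr.
by move/hr => h; rewrite exprS h mulr0.
Qed.

Lemma toral_char_conj (chi : F -> F) x c : is_char chi -> mbr t0 x = c *: x ->
  let z := invmx Q *m diag_mx (\row_j chi (lam 0 j)) *m Q in
  z *m x *m invmx z = chi c *: x.
Proof.
move=> [chi0 chiD chiN] /toral_entry hx z.
have uz : z \in unitmx.
  rewrite /z !unitmx_mul unitmx_inv Qu /= andbT unitmxE det_diag unitfE.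
  by apply/prodf_neq0 => j _; rewrite mxE.
suff -> : z *m x = (chi c *: x) *m z by rewrite mulmxK.
pose y := Q *m x *m invmx Q.
have -> : x = invmx Q *m y *m Q by rewrite /y !mulmxA mulVmx // mul1mx mulmxKV.
rewrite /z; set D := diag_mx _.
have -> : invmx Q *m D *m Q *m (invmx Q *m y *m Q) = invmx Q *m (D *m y) *m Q.
  by rewrite !mulmxA mulmxK.
have -> : chi c *: (invmx Q *m y *m Q) *m (invmx Q *m D *m Q) = invmx Q *m (chi c *: (y *m D)) *m Q.
  by rewrite -!scalemxAl -scalemxAr -scalemxAl !mulmxA mulmxK.
congr (_ *m _ *m _); rewrite /D mul_diag_mx mul_mx_diag; have hy i j := hx i j.
rewrite -/y in hy; clearbody y; apply/matrixP => i j; rewrite !mxE.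
have /eqP := hy i j; rewrite mulf_eq0 => /orP [|/eqP ->]; last by rewrite !(mulr0, mul0r).
rewrite subr_eq0 => /eqP <-.
have -> : chi (lam 0 i) = chi (lam 0 i - lam 0 j) * chi (lam 0 j) by rewrite -chiD subrK.
by ring.
Qed.

End ToralElements.

(** * Curves made of exponentials *)

Section NexpCurve.
Variables (F : numFieldType) (n : nat).

Lemma nexp_curve (N : 'M[F]_n) K : N ^+ K.+1 = 0 -> exists Mt : 'M[{poly F}]_n,
  (forall t, map_mx (horner_eval t) Mt = nexp idfun K.+1 N t) /\
  map_mx (horner_eval 0) (map_mx (@deriv F) Mt) = N.
Proof.
move=> NK; exists (nexp (@polyC F) K.+1 N 'X).
have hC t (A : 'M[F]_n) : map_mx (horner_eval t) (map_mx (@polyC F) A) = A.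
  by apply/matrixP => i j; rewrite !mxE /horner_eval hornerC.
have ev t : map_mx (horner_eval t) (nexp (@polyC F) K.+1 N 'X) = nexp idfun K.+1 N t.
  have hs : horner_eval t 'X = t by rewrite /horner_eval hornerX.
  rewrite !nexp_map /nexp /= hs; apply: eq_bigr => k _; congr (_ *: _); apply/matrixP => i j.
  by rewrite !mxE /= /horner_eval hornerC.
split=> //.
have dD : {morph @deriv F : x y / x + y} by move=> x y; rewrite derivD.
have dM (x y : {poly F}) : deriv (x * y) = deriv x * y + x * deriv y by rewrite derivM.
have dC c : deriv (polyC c : {poly F}) = 0 by rewrite derivC.
have dT : deriv ('X : {poly F}) = 1 by rewrite derivX.
have -> := @nexp_deriv F n _ (@polyC F) (@deriv F) K.+1 N 'X dD dM dC dT NK.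
by rewrite map_mxM ev hC nexp0 mul1mx.
Qed.

(** If conjugation by [z] multiplies [N] by [a], this curve is the commutator of [z] with
    [exp (t N)]; for [a != 1] its tangent vector recovers [N]. *)
Lemma nexp2_curve (N : 'M[F]_n) K a : N ^+ K.+1 = 0 -> exists Mt : 'M[{poly F}]_n,
  (forall t, map_mx (horner_eval t) Mt = nexp idfun K.+1 (a *: N) t *m nexp idfun K.+1 (- N) t) /\
  map_mx (horner_eval 0) (map_mx (@deriv F) Mt) = (a - 1) *: N.
Proof.
move=> NK; have aNK : (a *: N) ^+ K.+1 = 0.
  have pow k : (a *: N) ^+ k = a ^+ k *: (N ^+ k : 'M_n).
    elim: k => [|k IH]; first by rewrite !expr0 scale1r.
    have -> : (a *: N) ^+ k.+1 = (a *: N) *m (a *: N) ^+ k by rewrite exprS.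
    have -> : N ^+ k.+1 = N *m N ^+ k by rewrite exprS.
    by rewrite IH -scalemxAl -scalemxAr scalerA exprS.
  by rewrite pow NK scaler0.
have NNK : (- N) ^+ K.+1 = 0 by rewrite exprNn NK mulr0.
have [M1 [h1 d1]] := nexp_curve aNK; have [M2 [h2 d2]] := nexp_curve NNK.
exists (M1 *m M2); split=> [t|]; first by rewrite map_mxM h1 h2.
have dD : {morph @deriv F : x y / x + y} by move=> x y; rewrite derivD.
have dM (x y : {poly F}) : deriv (x * y) = deriv x * y + x * deriv y by rewrite derivM.
rewrite (derivation_mulmx dD dM) map_mxD !map_mxM d1 d2 h1 h2 !nexp0.
by rewrite mulmx1 mul1mx scalerBl scale1r.
Qed.

Lemma nexp_conj (z N : 'M[F]_n) K t : z \in unitmx ->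
  z *m nexp idfun K N t *m invmx z = nexp idfun K (z *m N *m invmx z) t.
Proof.
move=> uz; rewrite /nexp mulmx_sumr mulmx_suml; apply: eq_bigr => k _.
rewrite -scalemxAr -scalemxAl !map_mx_id // -scalemxAr -scalemxAl; congr (_ *: (_ *: _)).
elim: (k : nat) => [|i IH]; first by rewrite !expr0 mulmx1 mulmxV.
have -> : N ^+ i.+1 = N ^+ i *m N by rewrite exprSr.
have -> : (z *m N *m invmx z) ^+ i.+1 = (z *m N *m invmx z) ^+ i *m (z *m N *m invmx z).
  by rewrite exprSr.
by rewrite -IH !mulmxA mulmxKV.
Qed.

End NexpCurve.

(** * Nondegeneracy of the trace form on a semisimple Lie algebra *)

Section TraceForm.
Variables (R : realType) (n : nat).
Local Notation C := R[i].
Local Notation M := 'M[C]_n.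

Lemma mxtrace_Ad (g x y : M) : \tr (Ad g x *m y) = \tr (x *m Ad (invmx g) y).
Proof. by rewrite /Ad invmxK -!mulmxA mxtrace_mulC !mulmxA. Qed.

Lemma AdK (g x : M) : g \in unitmx -> Ad g (Ad (invmx g) x) = x.
Proof. by move=> gu; rewrite /Ad invmxK !mulmxA mulmxV // mul1mx mulmxK. Qed.

Lemma linsub_orthogonal (S : set M) : linsub [set x | forall y, S y -> \tr (x *m y) = 0].
Proof.
split=> [y _|a x y hx hy z Sz]; first by rewrite mul0mx mxtrace0.
by rewrite mulmxDl mxtraceD -scalemxAl mxtraceZ hx // hy // mulr0 addr0.
Qed.

Lemma linsubI (S T : set M) : linsub S -> linsub T -> linsub (S `&` T).
Proof.
move=> hS hT; split=> [|a x y [Sx Tx] [Sy Ty]]; first by split; [exact: linsub0 hS | exact: linsub0 hT].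
by split; [exact: hS.2 | exact: hT.2].
Qed.

Lemma nilpotent_pos (x : M) : nilpotent_mx x -> exists K, x ^+ K.+1 = 0.
Proof. by move=> [k hk]; exists k; rewrite exprS hk mulr0. Qed.

Lemma nexp_tangent (H : set M) (x : M) K : x ^+ K.+1 = 0 -> (forall t, H (nexp idfun K.+1 x t)) ->
  Lie H x.
Proof.
move=> xK hx; have [Mt [hM dM]] := nexp_curve xK.
have <- : mxat (map_mx deriv Mt) 0 = x by exact: dM.
by apply: Lie_curve => [|k]; rewrite /mxat hM // nexp0.
Qed.

Lemma Lie_trivial (x : M) : Lie [set 1%:M] x -> x = 0.
Proof.
move=> hx; apply/matrixP => i j; rewrite [RHS]mxE.
apply: (Lie_scalar (l := fun A : M => A i j) (c := (1%:M : M) i j)) hx.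
  by move=> a A B; rewrite !mxE.
by move=> A ->.
Qed.

(* The radical of the form is a [G]-stable ideal of nilpotent elements; it
   exponentiates into a connected unipotent normal subgroup of [G]. *)
Lemma trace_form_nondeg (G : set M) x : connected_semisimple G -> Lie G x ->
  (forall y, Lie G y -> \tr (x *m y) = 0) -> x = 0.
Proof.
move=> [cG kG ssG] Gx trx; have [sG zG] := cG; have [Gu G1 GM GV] := sG.
pose I : set M := Lie G `&` [set x | forall y, Lie G y -> \tr (x *m y) = 0].
have hI : linsub I by apply: linsubI (Lie_linsub G) (linsub_orthogonal _).
have GAd g y : G g -> Lie G y -> Lie G (Ad g y).
  by move=> Gg; apply: Lie_Ad => [|A GA]; [exact: Gu | exact: subgroup_Ad].
have IAd g y : G g -> I y -> I (Ad g y).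
  move=> Gg [Gy ty]; split; first exact: GAd.
  by move=> z Gz; rewrite mxtrace_Ad; apply: ty; apply: GAd => //; apply: GV.
have Gbr y z : Lie G y -> Lie G z -> Lie G (br y z).
  by apply: Lie_bracket => // A B; exact: subgroup_Ad.
have Inil : flag_nil I.
  apply: engel => //.
    move=> y z [Gy ty] [Gz tz]; split; first exact: Gbr.
    move=> w Gw; rewrite -[mbr y z]/(br y z) mxtrace_br tz ?oppr0 //.
    exact: Gbr.
  by move=> y [Gy ty]; exact: (Lie_nilpotent G1 GM Gy ty).
have ugrp : unipotent_group (flag_group G I 1) by exact: flag_group_unipotent.
have cgrp : closed_subgroup (flag_group G I 1).
  by split; [exact: flag_group_subgroup | exact: flag_group_closed].
have triv : flag_group G I 1 = [set 1%:M].
  apply: ssG => //; [exact: unipotent_connected | exact: flag_group_solvable |].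
  split; first by move=> A [].
  move=> g A Gg; apply: flag_group_conj => //.
    by move=> w Iw; have := IAd _ _ (GV _ Gg) Iw; rewrite /Ad invmxK.
  by move=> w; exact: IAd.
have Ix : I x by [].
have [K xK] := nilpotent_pos (Lie_nilpotent G1 GM Gx trx).
apply: Lie_trivial; rewrite -triv; apply: (nexp_tangent xK) => t.
by apply: flag_group_nexp => //; exact: nexp_mem.
Qed.

End TraceForm.

(** * Weights on the Lie algebra of a parabolic subgroup *)

Section Parabolic.
Variables (R : realType) (n : nat).
Local Notation C := R[i].
Local Notation M := 'M[C]_n.
Variables (G P U : set M) (te : set M).
Hypothesis hG : connected_semisimple G.
Hypothesis hP : parabolic_subgroup G P.
Hypothesis hU : unipotent_radical P U.
Hypothesis hL : levi_factor P U (group_centralizer G te).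
Variables (Q t0 : M) (lam : 'rV[C]_n).
Hypothesis Qu : Q \in unitmx.
Hypothesis t0E : t0 = invmx Q *m diag_mx lam *m Q.
Hypothesis teG : te `<=` Lie G.
Hypothesis tet0 : te t0.
Hypothesis te_comm : forall x, br t0 x = 0 -> forall t, te t -> br t x = 0.
Hypothesis te_diag : forall t, te t -> exists mu, t = invmx Q *m diag_mx mu *m Q.

Local Notation g := (Lie G).
Local Notation p := (Lie P).
Local Notation u := (Lie U).

Let cG : closed_subgroup G. Proof. by case: hG. Qed.
Let cP : closed_subgroup P. Proof. by case: hP. Qed.
Let PG : P `<=` G. Proof. by case: hP. Qed.
Let cU : closed_subgroup U. Proof. by case: hU => -[]. Qed.
Let uU : unipotent_group U. Proof. by case: hU => -[]. Qed.
Let UP : U `<=` P. Proof. by case: hU => -[_ _ _ []]. Qed.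
Let UN g x : P g -> U x -> U (Ad g x). Proof. by case: hU => -[_ _ _ [_ h]] _; exact: h. Qed.
Let sG : subgroup G. Proof. by case: cG. Qed.
Let sP : subgroup P. Proof. by case: cP. Qed.
Let sU : subgroup U. Proof. by case: cU. Qed.
Let Gu : G `<=` [set A | A \in unitmx]. Proof. by case: sG. Qed.
Let Pu : P `<=` [set A | A \in unitmx]. Proof. by case: sP. Qed.
Let pg : p `<=` g. Proof. exact: LieS. Qed.
Let up : u `<=` p. Proof. exact: LieS. Qed.

Let pbr x y : p x -> p y -> p (br x y).
Proof. by apply: Lie_bracket => // A B; exact: subgroup_Ad. Qed.
Let gbr x y : g x -> g y -> g (br x y).
Proof. by apply: Lie_bracket => // A B; exact: subgroup_Ad. Qed.
Let pubr x y : p x -> u y -> u (br x y).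
Proof. by apply: Lie_bracket => // A B; exact: UN. Qed.

Lemma br_t0_toral c x : br t0 x = c *: x <->
  mbr (invmx Q *m diag_mx lam *m Q) x = c *: x.
Proof. by rewrite t0E. Qed.

(** By [te_comm], centralising [t0] means centralising [te], so [x] is tangent to the Levi
    factor. *)
Lemma centralizer_sub_parabolic x : g x -> br t0 x = 0 -> p x.
Proof.
move=> gx tx; have [_ LP _ _] := hL.
apply: (Lie_centralizer (S := te) cG gx).
  by move=> t tet; have /eqP := te_comm tx tet; rewrite subr_eq0 => /eqP.
move=> A GA hA; apply: LP; split=> // t tet.
by apply: (conj_fixP _ (Gu GA)).2; rewrite hA.
Qed.

Let t0p : p t0.
Proof. by apply: centralizer_sub_parabolic; [exact: teG | rewrite /br subrr]. Qed.

Lemma t0_char_point (chi : C -> C) : is_char chi ->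
  let z := invmx Q *m diag_mx (\row_j chi (lam 0 j)) *m Q in
  group_centralizer G te z.
Proof.
move=> hchi z.
have hd : expdata t0 Q lam 0 1.
  split; rewrite ?mulmx0 ?mul0mx ?addr0 ?expr1 //.
  by rewrite t0E => B ->; rewrite mulmx0 mul0mx.
have Gz : G z.
  have := exp_mem 0 cG (teG tet0) hd hchi.
  by rewrite /exppoint nexp0 mulmx1.
split=> // t tet; have [mu ->] := te_diag tet.
apply: (conj_fixP _ (Gu Gz)).2; exact: conj_diag_comm.
Qed.

(* The exponential of such a vector is a commutator of an element of [P] with a
   point of the central torus of the Levi factor. *)
Lemma weight_vector_radical c x : c != 0 -> p x -> br t0 x = c *: x -> u x.
Proof.
move=> c0 px hx; have [_ LP LU PLU] := hL.
have htx : mbr (invmx Q *m diag_mx lam *m Q) x = c *: x by apply/br_t0_toral.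
have [K xK] := toral_nilpotent Qu c0 htx.
have [chi hchi inj] := char_separating [:: 0; c].
have chi0 : chi 0 = 1 by case: hchi.
have chic : chi c - 1 != 0.
  rewrite subr_eq0 -chi0; apply: contra c0 => /eqP e.
  by apply/eqP/inj; rewrite ?inE ?eqxx ?orbT.
have Lz := t0_char_point hchi; have zx := toral_char_conj Qu hchi htx.
set z := invmx Q *m diag_mx _ *m Q in Lz zx.
have uz : z \in unitmx by apply: Gu; case: Lz.
have Pz : P z by exact: LP.
have [_ P1 PM PV] := sP; have [_ U1 UM UV] := sU.
have zL l : group_centralizer G te l -> z *m l = l *m z.
  move=> [Gl hl]; apply/esym; apply: (conj_comm_fun (lam := lam)) => //.
    by move=> i j; rewrite !mxE => ->.
  by rewrite -t0E; apply: (conj_fixP _ (Gu Gl)).1; exact: hl.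
(* Write [A = l v] with [l] in the Levi factor and [v] in [U]: [z] commutes with [l], so only the
   commutator with [v] remains. *)
have commU A : P A -> U (Ad z A *m invmx A).
  move=> PA; have [l [v [Ll Uv AE]]] := PLU A PA.
  have ul : l \in unitmx by apply: Gu; case: Ll.
  have uv : v \in unitmx by apply: Pu; apply: UP.
  have -> : Ad z A *m invmx A = Ad l (Ad z v *m invmx v).
    by rewrite AE; apply: commutator_comm => //; exact: zL.
  by apply: UN; [exact: LP | apply: UM; [exact: UN | exact: UV]].
have [Mt [hM dM]] := nexp2_curve (chi c) xK.
have : u ((chi c - 1) *: x).
  have <- : mxat (map_mx deriv Mt) 0 = (chi c - 1) *: x by exact: dM.
  apply: Lie_curve => [|k]; first by rewrite /mxat hM !nexp0 mulmx1.
  rewrite /mxat hM; set E := nexp idfun K.+1 x k%:R.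
  have PE : P E by exact: nexp_mem.
  have e1 : nexp idfun K.+1 (- x) k%:R = invmx E.
    have := nexpN k%:R xK (ltn0Sn K) => h.
    by rewrite -[LHS](mulKmx (Pu PE)) h mulmx1.
  by rewrite e1 -zx -nexp_conj //; exact: commU.
move/(linsubZ (Lie_linsub U) (chi c - 1)^-1); by rewrite scalerA mulVf // scale1r.
Qed.

Definition pperp : set M := Lie G `&` [set x | forall y, Lie P y -> \tr (x *m y) = 0].

Let hN : linsub pperp. Proof. exact: linsubI (Lie_linsub G) (linsub_orthogonal _). Qed.

Let pN y x : p y -> pperp x -> pperp (br y x).
Proof.
move=> py [gx tx]; split; first by apply: gbr => //; apply: pg.
by move=> z pz; rewrite mxtrace_br tx ?oppr0 //; apply: pbr.
Qed.

Lemma weight_orthogonal c d (x y : M) : br t0 x = c *: x -> br t0 y = d *: y -> c + d != 0 ->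
  \tr (x *m y) = 0.
Proof.
move=> hx hy cd; have := mxtrace_br t0 x y; rewrite hx hy -scalemxAl -scalemxAr !mxtraceZ.
move/eqP; rewrite -addr_eq0 -mulrDl mulf_eq0 (negPf cd) /= => /eqP //.
Qed.

Let wc c x := wcomp Q lam c x.

Let wc_eigen c x : br t0 (wc c x) = c *: wc c x.
Proof. by apply/br_t0_toral; exact: wcomp_eigen. Qed.

Let wc_mem (S : set M) c x : linsub S -> (forall y, S y -> S (br t0 y)) -> S x -> S (wc c x).
Proof. by rewrite t0E => hS St; exact: (@wcomp_mem _ _ Q lam Qu S c x hS St). Qed.

Let wc_sum x : x = \sum_(c <- wdiffs lam) wc c x. Proof. exact: wcomp_sum. Qed.

Let g_wc c x : g x -> g (wc c x).
Proof. by apply: wc_mem => [|y]; [exact: Lie_linsub | apply: gbr; exact: teG]. Qed.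
Let p_wc c x : p x -> p (wc c x).
Proof. by apply: wc_mem => [|y]; [exact: Lie_linsub | exact: pbr]. Qed.
Let N_wc c x : pperp x -> pperp (wc c x).
Proof. by apply: wc_mem => [|y]; [exact: hN | exact: pN]. Qed.

(** The zero weight space of [g] is contained in [p], and the other weight spaces are orthogonal to
    [x], so [x] is orthogonal to all of [g]. *)
Lemma pperp_weight0 x : pperp x -> br t0 x = 0 -> x = 0.
Proof.
move=> [gx tx] t0x; apply: (trace_form_nondeg hG gx) => y gy.
rewrite [y]wc_sum mulmx_sumr raddf_sum big1 //= => c _.
have [->|c0] := eqVneq c 0.
  apply: tx; apply: centralizer_sub_parabolic; first exact: g_wc.
  by rewrite wc_eigen scale0r.
apply: (weight_orthogonal (c := 0) _ (wc_eigen c y)); last by rewrite add0r.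
by rewrite scale0r.
Qed.

Lemma pperp_radical x : pperp x -> p x -> u x.
Proof.
move=> Nx px; rewrite [x]wc_sum; apply: (linsub_sum (Lie_linsub U)) => c _.
have [->|c0] := eqVneq c 0.
  have -> : wc 0 x = 0 by apply: pperp_weight0; [exact: N_wc | rewrite wc_eigen scale0r].
  exact: linsub0 (Lie_linsub U).
exact: (weight_vector_radical c0 (p_wc c px) (wc_eigen c x)).
Qed.

Let u_nil : flag_nil u.
Proof.
apply: engel; first exact: Lie_linsub.
  by move=> x y ux uy; apply: pubr => //; exact: up.
by move=> x ux; exact: (Lie_unipotent cU uU ux).
Qed.

(* Otherwise take a weight vector [x] outside [p] with [br u x] in [p], hence in
   [u].  With [u], the vectors of this kind of a given weight span a nilpotent
   algebra [m] normalised by [L], and the subgroup of [G] acting unipotently on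
   the flag of [m] is connected, solvable and normalised by [P].  By maximality it
   is contained in each Borel subgroup of [P]; but it contains [exp x]. *)
Lemma pperp_sub_parabolic x : pperp x -> p x.
Proof.
move=> Nx; apply: contrapT => npx.
have [||x1 [Nx1 npx1] hx1] := @ad_fixed _ _ u (fun y => pperp y /\ ~ p y) x u_nil.
- by [].
- by case=> _; apply; exact: linsub0 (Lie_linsub P).
(* [M0] is linear and stable under [ad t0], so the bracket condition on [x1] passes to its weight
   components. *)
pose M0 : set M := [set y | pperp y /\ forall w, u w -> p (br w y)].
have hM0 : linsub M0.
  split=> [|a y z [Ny hy] [Nz hz]].
    split; first exact: linsub0 hN.
    by move=> w _; rewrite br0; exact: linsub0 (Lie_linsub P).
  split; first exact: hN.2.
  by move=> w uw; rewrite brDr brZr; apply: (Lie_linsub P).2; [exact: hy | exact: hz].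
have M0x1 : M0 x1.
  split=> // w uw; apply: contrapT => h; apply: (hx1 w uw); split=> //.
  by apply: pN => //; exact: up.
have M0t y : M0 y -> M0 (br t0 y).
  move=> [Ny hy]; split; first exact: pN.
  move=> w uw; rewrite brA; apply: (linsubD (Lie_linsub P)).
    apply: hy; rewrite brC; apply: (linsubN (Lie_linsub U)); exact: pubr.
  by apply: pbr => //; exact: hy.
have [c hc] : exists c, ~ p (wc c x1).
  apply: contrapT => h; apply: npx1; rewrite [x1]wc_sum.
  apply: (linsub_sum (Lie_linsub P)) => c _; apply: contrapT => hc; apply: h.
  by exists c.
set x2 := wc c x1 in hc.
have [Nx2 hx2] : M0 x2 by exact: wc_mem.
have t0x2 : br t0 x2 = c *: x2 by exact: wc_eigen.
have c0 : c != 0.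
  apply/eqP => c0; apply: hc; rewrite c0 scale0r in t0x2.
  by rewrite (pperp_weight0 Nx2 t0x2); exact: linsub0 (Lie_linsub P).
(* All the vectors of this kind, and not only the line of [x2], because [m] has to be stable under
   the Levi factor. *)
pose X : set M := [set y | [/\ pperp y, br t0 y = c *: y & forall w, u w -> p (br w y)]].
have uX w y : u w -> X y -> u (br w y).
  move=> uw [Ny _ hy]; apply: pperp_radical; last exact: hy.
  by apply: pN => //; exact: up.
pose m : set M := [set y | exists w z, [/\ u w, X z & y = w + z]].
have X0 : X 0.
  split; [exact: linsub0 hN|by rewrite br0 scaler0|].
  by move=> w _; rewrite br0; exact: linsub0 (Lie_linsub P).
have m_nil : flag_nil m.
  have [r hr] := toral_word_nil lam Qu c0.
  apply: (@flag_nil_extend _ _ u X r) => //; first exact: Lie_linsub.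
  move=> q hq; apply: hr; apply: (wordS _ hq) => y [_ hy _].
  exact: (br_t0_toral c y).1 hy.
have Adbr A y z : A \in unitmx -> br (Ad A y) (Ad A z) = Ad A (br y z).
  by move=> uA; rewrite /Ad /br !(conj_mulmx _ _ uA) mulmxBr mulmxBl.
have LAd A y : group_centralizer G te A -> m y -> m (Ad A y).
  move=> LA [w [z [uw [Nz t0z hz] ->]]]; have [_ LP _ _] := hL.
  have PA : P A := LP _ LA; have uA : A \in unitmx := Pu PA; have [_ _ _ PV] := sP.
  have PAd B v : P B -> p v -> p (Ad B v).
    by move=> PB; apply: Lie_Ad => [|D PD]; [exact: Pu | exact: subgroup_Ad].
  have UAd B v : P B -> u v -> u (Ad B v).
    by move=> PB; apply: Lie_Ad => [|D UD]; [exact: Pu | exact: UN].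
  have GAd B v : G B -> g v -> g (Ad B v).
    by move=> GB; apply: Lie_Ad => [|D GD]; [exact: Gu | exact: subgroup_Ad].
  exists (Ad A w), (Ad A z); split.
  - exact: UAd.
  - split.
    + split; first by apply: GAd; [exact: PG | case: Nz].
      move=> v pv; rewrite mxtrace_Ad; case: Nz => _; apply.
      by apply: PAd => //; apply: PV.
    + have <- : Ad A t0 = t0 by case: LA => _; apply.
      by rewrite Adbr // t0z /Ad -scalemxAr -scalemxAl.
    + move=> v uv; rewrite -[v](AdK _ uA) Adbr //; apply: PAd => //; apply: hz.
      by apply: UAd => //; apply: PV.
  - by rewrite /Ad mulmxDr mulmxDl.
pose N := flag_group G m 1.
have sN : subgroup N by exact: flag_group_subgroup.
have uN : unipotent_group N by exact: flag_group_unipotent.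
have cN : closed_subgroup N by split=> //; apply: flag_group_closed => //; case: cG.
have UN' : U `<=` N.
  apply: unipotent_flag => //; first by apply: subset_trans PG.
  by move=> w uw; exists w, 0; rewrite addr0.
have PN A k : P A -> N k -> N (Ad A k).
  move=> PA Nk; have [_ LP _ PLU] := hL; have [l [v [Ll Uv ->]]] := PLU A PA.
  have Gl : G l by case: Ll.
  have -> : Ad (l *m v) k = Ad l (Ad v k).
    by rewrite /Ad invmx_mul ?Gu // ?mulmxA //; apply: PG; apply: UP.
  apply: flag_group_conj => //.
  - move=> w mw; have := @LAd (invmx l) w; rewrite /Ad invmxK; apply=> //.
    have [Lc _ _ _] := hL; have [[_ _ _ LV] _] := Lc; exact: LV.
  - by move=> w; exact: LAd.
  - by apply: subgroup_Ad => //; exact: UN'.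
have [_ _ [B bB BP]] := hP.
have NB : N `<=` B.
  apply: (borel_absorb cG bB) => //; first by move=> A [].
  - exact: unipotent_connected.
  - exact: flag_group_solvable.
  - by move=> b k Bb; apply: PN; exact: BP.
have [K xK] := toral_nilpotent Qu c0 ((br_t0_toral c x2).1 t0x2).
apply: hc; apply: (nexp_tangent xK) => t; apply: BP; apply: NB.
apply: flag_group_nexp; first by apply: (nexp_mem t cG _ xK) => //; case: Nx2.
exists 0, x2; split; [exact: linsub0 (Lie_linsub U) | exact: And3 Nx2 t0x2 hx2 | exact: esym (add0r x2)].
Qed.

(** If [- c] does not occur on [u], it does not occur on [p] either, so [x] is orthogonal to [p]. By
    [pperp_sub_parabolic] it then lies in [p], hence in [u]. *)
Lemma weight_or_opposite c x : c != 0 -> g x -> x != 0 -> br t0 x = c *: x ->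
  u x \/ exists2 y, u y & y != 0 /\ br t0 y = (- c) *: y.
Proof.
move=> c0 gx x0 hx; have [?|no] := pselect (exists2 y, u y & y != 0 /\ br t0 y = (- c) *: y).
  by right.
left; apply: (weight_vector_radical c0) => //; apply: pperp_sub_parabolic; split=> // y py.
rewrite [y]wc_sum mulmx_sumr raddf_sum big1 //= => d _.
have [cd|cd] := eqVneq (c + d) 0; last exact: (weight_orthogonal hx (wc_eigen d y)).
have dE : d = - c by apply/eqP; rewrite -addr_eq0 addrC cd.
have [->|w0] := eqVneq (wc d y) 0; first by rewrite mulmx0 mxtrace0.
exfalso; apply: no; exists (wc d y); last by rewrite -dE wc_eigen.
apply: (weight_vector_radical (c := d)); [by rewrite dE oppr_eq0|exact: p_wc|exact: wc_eigen].
Qed.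

End Parabolic.

(** * Representations of sl2 *)

Lemma subr_swap (V : zmodType) (x a b e : V) : x - a - (b - e) = x - b - (a - e).
Proof.
rewrite !opprB -!addrA; congr (x + _).
by rewrite addrCA [RHS]addrCA [- a - b]addrC.
Qed.

Section Eigenvectors.
Variables (F : fieldType) (V : lmodType F) (T : V -> V).
Hypothesis Tlin : linear T.

Let T0 : T 0 = 0. Proof. by have := Tlin (-1) 0 0; rewrite scaler0 addr0 scaleN1r addNr. Qed.
Let TD x y : T (x + y) = T x + T y. Proof. by have := Tlin 1 x y; rewrite !scale1r. Qed.
Let TZ a x : T (a *: x) = a *: T x. Proof. by have := Tlin a x 0; rewrite T0 !addr0. Qed.

Let TB x y : T (x - y) = T x - T y. Proof. by rewrite -scaleN1r TD TZ scaleN1r. Qed.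

Fixpoint opprod (cs : seq F) (v : V) : V :=
  if cs is c :: cs' then T (opprod cs' v) - c *: opprod cs' v else v.

Lemma opprod_lin cs : linear (opprod cs).
Proof.
elim: cs => //= c cs IH a x y; rewrite IH TD TZ scalerDr scalerBr !scalerA [c * a]mulrC.
by rewrite -scalerA opprD addrACA.
Qed.

Lemma opprod_stable (S : set V) cs v : linsub S -> (forall x, S x -> S (T x)) ->
  S v -> S (opprod cs v).
Proof.
move=> hS ST Sv; elim: cs => //= c cs IH; apply: (linsubB hS); first exact: ST.
exact: (linsubZ hS).
Qed.

Lemma opprod_swap c cs v : opprod cs (T v - c *: v) = T (opprod cs v) - c *: opprod cs v.
Proof.
elim: cs => //= d cs ->; set w := opprod cs v; rewrite !TB !TZ !scalerBr !scalerA subr_swap.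
by rewrite [d * c]mulrC.
Qed.

Lemma opprod_cat cs ds v : opprod (cs ++ ds) v = opprod cs (opprod ds v).
Proof. by elim: cs => //= c cs ->. Qed.

Lemma opprodC cs ds v : opprod cs (opprod ds v) = opprod ds (opprod cs v).
Proof. by elim: ds v => //= d ds IH v; rewrite opprod_swap IH. Qed.

(** The product of the [T - d] over the other eigenvalues that occur sends [y] into [Z], and
    multiplies it by a nonzero scalar. *)
Lemma eigen_lspan_mod (Z : set V) (Pc : F -> Prop) c y : linsub Z -> (forall z, Z z -> Z (T z)) ->
  ~ Pc c -> lspan [set z | Z z \/ exists2 mu, Pc mu & T z = mu *: z] y ->
  T y = c *: y -> Z y.
Proof.
move=> hZ ZT nPc hy Ty.
have [cs hcs Zcs] : exists2 cs, (forall d, d \in cs -> d != c) & Z (opprod cs y).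
  apply: (hy [set y | exists2 cs, (forall d, d \in cs -> d != c) & Z (opprod cs y)]).
    split=> [|a u v [cs hcs Zu] [ds hds Zv]]; first by exists [::] => //; exact: (linsub0 hZ).
    exists (cs ++ ds); first by move=> d; rewrite mem_cat => /orP [/hcs|/hds].
    rewrite opprod_lin; apply: hZ.2.
      by rewrite opprod_cat opprodC; apply: opprod_stable.
    by rewrite opprod_cat; apply: opprod_stable.
  move=> z [Zz|[mu Pmu Tz]]; first by exists [::].
  exists [:: mu]; last by rewrite /= Tz subrr; exact: (linsub0 hZ).
  by move=> d; rewrite inE => /eqP ->; apply/eqP => e; apply: nPc; rewrite -e.
have e : opprod cs y = (\prod_(d <- cs) (c - d)) *: y.
  elim: cs {hcs Zcs} => [|d cs IH] /=; first by rewrite big_nil scale1r.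
  by rewrite IH TZ Ty scalerA scalerA -scalerBl big_cons mulrBl mulrC.
have p0 : \prod_(d <- cs) (c - d) != 0.
  by rewrite prodf_seq_neq0; apply/allP => d /hcs dc; rewrite subr_eq0 eq_sym.
by have := linsubZ hZ (\prod_(d <- cs) (c - d))^-1 Zcs; rewrite e scalerA mulVf // scale1r.
Qed.

Lemma eigen_lspan_eq0 (Pc : F -> Prop) c y : ~ Pc c ->
  lspan [set z | exists2 mu, Pc mu & T z = mu *: z] y -> T y = c *: y -> y = 0.
Proof.
move=> nPc hy Ty; apply: (@eigen_lspan_mod [set 0] Pc c y) => //.
- by split=> // a x z -> ->; rewrite scaler0 addr0.
- by move=> z ->; rewrite T0.
- move=> U hU hsub; apply: hy => // z hz; apply: hsub; by right.
Qed.

Lemma eigen_sum_eq0 (I : eqType) (r : seq I) (mu : I -> F) (y : I -> V) : uniq r ->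
  {in r &, injective mu} -> (forall i, i \in r -> T (y i) = mu i *: y i) ->
  \sum_(i <- r) y i = 0 -> forall i, i \in r -> y i = 0.
Proof.
move=> ur inj hy s0 i ir.
apply: (@eigen_lspan_eq0 (fun m => exists2 j, j \in r & j != i /\ m = mu j) (mu i)) => //.
- by move=> [j jr [/negP ji e]]; apply: ji; apply/eqP; apply: inj.
- move: s0; rewrite (bigD1_seq i) //= => /eqP; rewrite addr_eq0 => /eqP ->.
  apply: (linsubN (lspan_linsub _)); rewrite big_seq_cond.
  apply: (linsub_sum (lspan_linsub _)) => j /andP [jr ji]; apply: sub_lspan.
  by exists (mu j); [exists j | exact: hy].
- exact: hy.
Qed.

(** By induction [(T - c) v] is a sum of eigenvectors for the other eigenvalues, on which [T - c] is
    invertible. Subtracting a preimage [u] taken in this sum leaves [v - u] in the kernel of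
    [T - c]. *)
Lemma opprod_decomp (cs : seq F) (S : set V) v : uniq cs -> linsub S ->
  (forall x, S x -> S (T x)) -> S v -> opprod cs v = 0 ->
  lspan [set x | S x /\ exists2 c, c \in cs & T x = c *: x] v.
Proof.
move=> + hS ST; elim: cs v => [v _ _ /= ->|c cs IH v /= /andP [ccs ucs] Sv hv].
  exact: linsub0 (lspan_linsub _).
have Sw : S (T v - c *: v) by apply: (linsubB hS); [exact: ST | exact: (linsubZ hS)].
have := IH _ ucs Sw; rewrite opprod_swap => /(_ hv) hw.
pose Sp := lspan [set x | S x /\ exists2 d, d \in c :: cs & T x = d *: x].
have hSp : linsub Sp by exact: lspan_linsub.
have key : exists2 u, lspan [set x | S x /\ exists2 d, d \in cs & T x = d *: x] u &
    T u - c *: u = T v - c *: v.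
  apply: (hw [set w | exists2 u, lspan [set x | S x /\ exists2 d, d \in cs & T x = d *: x] u &
    T u - c *: u = w]).
    split=> [|a x y [u hu <-] [u' hu' <-]].
      by exists 0; [exact: linsub0 (lspan_linsub _) | rewrite T0 scaler0 subrr].
    exists (a *: u + u'); first exact: (lspan_linsub _).2.
    rewrite TD TZ scalerDr scalerBr opprD addrACA; congr (_ - _ + _).
    by rewrite !scalerA mulrC.
  move=> x [Sx [d dcs Tx]].
  have dc : d - c != 0 by rewrite subr_eq0; apply: contraNneq ccs => <-.
  exists ((d - c)^-1 *: x).
    apply: (linsubZ (lspan_linsub _)); apply: sub_lspan; split=> //; by exists d.
  by rewrite TZ Tx !scalerA -scalerBl [c * _]mulrC -mulrBr mulVf // scale1r.
have [u hu e] := key.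
have hSu : S u by apply: (hu S) => // x [].
rewrite -[v](subrK u); apply: (linsubD hSp); last first.
  apply: (hu Sp) => // x [Sx [d dcs Tx]]; apply: sub_lspan; split=> //.
  by exists d => //; rewrite inE dcs orbT.
apply: sub_lspan; split; first exact: (linsubB hS).
exists c; first by rewrite mem_head.
rewrite TB scalerBr; apply/eqP; rewrite -subr_eq0 subr_swap -e.
by rewrite opprB addrC addrA subrK subrr.
Qed.

End Eigenvectors.

Lemma iter_lin (F : fieldType) (V : lmodType F) (T : V -> V) k : linear T -> linear (iter k T).
Proof. by move=> Tl; elim: k => [//|k IH] a x y; rewrite !iterS IH Tl. Qed.

(** * Highest weight vectors and complete reducibility *)

Section SL2.
Variables (F : numFieldType) (V : lmodType F) (E H D : V -> V).
Hypothesis (Elin : linear E) (Hlin : linear H) (Dlin : linear D).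
Hypothesis hHE : forall v, H (E v) = E (H v) + 2%:R *: E v.
Hypothesis hHD : forall v, H (D v) = D (H v) - 2%:R *: D v.
Hypothesis hED : forall v, E (D v) = D (E v) + H v.
Variables (NE ND : nat).
Hypothesis (Enil : forall v, iter NE E v = 0) (Dnil : forall v, iter ND D v = 0).

Let lin0 (T : V -> V) : linear T -> T 0 = 0.
Proof. by move=> Tl; have := Tl (-1) 0 0; rewrite scaler0 addr0 scaleN1r addNr. Qed.
Let linD (T : V -> V) : linear T -> forall x y, T (x + y) = T x + T y.
Proof. by move=> Tl x y; have := Tl 1 x y; rewrite !scale1r. Qed.
Let linZ (T : V -> V) : linear T -> forall a x, T (a *: x) = a *: T x.
Proof. by move=> Tl a x; have := Tl a x 0; rewrite (lin0 Tl) !addr0. Qed.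
Let linB (T : V -> V) : linear T -> forall x y, T (x - y) = T x - T y.
Proof. by move=> Tl x y; rewrite -scaleN1r (linD Tl) (linZ Tl) scaleN1r. Qed.
Lemma H_iterD k v : H (iter k D v) = iter k D (H v) - (2 * k)%:R *: iter k D v.
Proof.
elim: k => [|k IH]; first by rewrite muln0 scale0r subr0.
rewrite !iterS hHD IH (linB Dlin) (linZ Dlin) -addrA -opprD -scalerDl -natrD.
by rewrite mulnS addnC.
Qed.

Lemma E_iterD k v : E (iter k.+1 D v) =
  iter k.+1 D (E v) + k.+1%:R *: iter k D (H v - k%:R *: v).
Proof.
elim: k => [|k IH]; first by rewrite /= hED scale0r subr0 scale1r.
have comb (a b : V) (k1 c d e : F) : k1 * c + d = (k1 + 1) * e ->
    k1 *: (a - c *: b) + (a - d *: b) = (k1 + 1) *: (a - e *: b).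
  move=> h; rewrite !scalerBr addrACA -opprD !scalerA -h !scalerDl scale1r.
  by [].
rewrite iterS hED IH (linD Dlin) (linZ Dlin) H_iterD -[D (iter k.+1 _ _)]iterS -addrA; congr (_ + _).
rewrite -[D (iter k D _)]iterS !(linB (iter_lin _ Dlin)) !(linZ (iter_lin _ Dlin)).
rewrite -[in RHS]natr1; apply: comb.
by rewrite natrM -![_.+1%:R]natr1; ring.
Qed.

Fixpoint natseq (k : nat) : seq F := if k is j.+1 then j%:R :: natseq j else [::].

Lemma mem_natseq k c : c \in natseq k -> exists i : nat, c = i%:R.
Proof. by elim: k => //= k IH; rewrite inE => /orP [/eqP ->|/IH //]; exists k. Qed.

Lemma natseq_uniq k : uniq (natseq k).
Proof.
elim: k => //= k ->; rewrite andbT.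
have h j c : c \in natseq j -> exists2 i, (i < j)%N & c = i%:R.
  elim: j => //= j IH; rewrite inE => /orP [/eqP ->|/IH [i ij ->]]; first by exists j.
  by exists i => //; exact: ltnW.
by apply/negP => /h [i ik /eqP]; rewrite eqr_nat => /eqP e; rewrite e ltnn in ik.
Qed.

(** For [S = 0] this is the classical formula for [E^k D^k] on the kernel of [E]. Working modulo a
    stable [S] gives it in the quotient without forming the quotient. *)
Lemma ED_mod (S : set V) : linsub S -> (forall x, S x -> S (E x)) -> (forall x, S x -> S (H x)) ->
  (forall x, S x -> S (D x)) -> forall k v, S (E v) ->
  S (iter k E (iter k D v) - k`!%:R *: opprod H (natseq k) v).
Proof.
move=> hS SE SH SD.
have itS (T : V -> V) k x : (forall x, S x -> S (T x)) -> S x -> S (iter k T x).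
  by move=> ST Sx; elim: k => //= k; exact: ST.
elim=> [|k IH] v SEv; first by rewrite fact0 scale1r subrr; exact: linsub0 hS.
have SEw : S (E (H v - k%:R *: v)).
  rewrite (linB Elin) (linZ Elin); apply: (linsubB hS); last exact: (linsubZ hS).
  have -> : E (H v) = H (E v) - 2%:R *: E v by rewrite hHE addrK.
  by apply: (linsubB hS); [exact: SH | exact: (linsubZ hS)].
have := IH _ SEw; rewrite (opprod_swap Hlin) => h.
rewrite iterSr E_iterD ((linD (iter_lin _ Elin))) (linZ (iter_lin _ Elin)) -addrA.
apply: (linsubD hS); first by apply: (itS E) => //; apply: (itS D).
by rewrite factS natrM -scalerA -scalerBr; exact: (linsubZ hS).
Qed.

(** For [k = ND] the term [E^k D^k v] of [ED_mod] vanishes. So, modulo [S], [H] is diagonalizable on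
    the kernel of [E], with natural numbers as eigenvalues. *)
Lemma hw_opprod (S : set V) v : linsub S -> (forall x, S x -> S (E x)) ->
  (forall x, S x -> S (H x)) -> (forall x, S x -> S (D x)) -> S (E v) ->
  S (opprod H (natseq ND) v).
Proof.
move=> hS SE SH SD SEv; have := ED_mod hS SE SH SD ND SEv.
rewrite Dnil (lin0 (iter_lin _ Elin)) sub0r => h.
have := linsubZ hS (ND`!%:R)^-1 (linsubN hS h).
by rewrite opprK scalerA mulVf ?scale1r // pnatr_eq0 -lt0n fact_gt0.
Qed.

Let zset : linsub [set (0 : V)].
Proof. by split=> // a x y -> ->; rewrite scaler0 addr0. Qed.

Lemma hw_opprod0 v : E v = 0 -> opprod H (natseq ND) v = 0.
Proof.
move=> Ev; apply: (hw_opprod zset) => //= x ->; exact: lin0.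
Qed.

Lemma hw_span (S : set V) v : linsub S -> (forall x, S x -> S (H x)) ->
  (forall x, S x -> E x = 0) -> S v ->
  lspan [set x | S x /\ exists i : nat, H x = i%:R *: x] v.
Proof.
move=> hS SH SE Sv.
have := opprod_decomp Hlin (natseq_uniq ND) hS SH Sv (hw_opprod0 (SE _ Sv)).
apply=> [|x [Sx [c /mem_natseq [i ->] Hx]]]; first exact: lspan_linsub.
by apply: sub_lspan; split=> //; exists i.
Qed.

Lemma hw_weight_nat v c : E v = 0 -> H v = c *: v -> v != 0 -> exists i : nat, c = i%:R.
Proof.
move=> Ev Hv v0; have := hw_opprod0 Ev.
have -> : opprod H (natseq ND) v = (\prod_(d <- natseq ND) (c - d)) *: v.
  elim: (natseq ND) => [|d cs IH] /=; first by rewrite big_nil scale1r.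
  by rewrite IH (linZ Hlin) Hv !scalerA -scalerBl big_cons mulrBl [_ * c]mulrC.
move/eqP; rewrite scaler_eq0 (negPf v0) orbF prodf_seq_eq0 => /hasP [d /mem_natseq [i ->]].
by rewrite subr_eq0 => /eqP ->; exists i.
Qed.

Section HighestWeight.
Variables (x : V) (i : nat).
Hypothesis (Ex : E x = 0) (Hx : H x = i%:R *: x).

Lemma hw_H k : H (iter k D x) = (i%:R - (2 * k)%:R) *: iter k D x.
Proof. by rewrite H_iterD Hx (linZ (iter_lin _ Dlin)) scalerBl. Qed.

Lemma hw_E k : E (iter k.+1 D x) = (k.+1%:R * (i%:R - k%:R)) *: iter k D x.
Proof.
rewrite E_iterD Ex (lin0 (iter_lin _ Dlin)) add0r Hx -scalerBl (linZ (iter_lin _ Dlin)).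
by rewrite scalerA.
Qed.

(** [D^(i+1) x] is killed by [E] and has the negative weight [- i - 2], which [hw_weight_nat]
    forbids for a nonzero vector. *)
Lemma hw_top k : (i < k)%N -> iter k D x = 0.
Proof.
have h : iter i.+1 D x = 0.
  apply/eqP; apply: contraT => y0.
  have Ey : E (iter i.+1 D x) = 0 by rewrite hw_E subrr mulr0 scale0r.
  have [j /eqP] := hw_weight_nat Ey (hw_H _) y0.
  rewrite subr_eq -natrD eqr_nat => /eqP e; exfalso; move: e; lia.
move/subnK <-; rewrite iterD h; exact: (lin0 (iter_lin _ Dlin)).
Qed.

Lemma hw_ED k : iter k E (iter k D x) = (\prod_(j < k) (j.+1%:R * (i%:R - j%:R))) *: x.
Proof.
elim: k => [|k IH]; first by rewrite big_ord0 scale1r.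
by rewrite iterSr hw_E (linZ (iter_lin _ Elin)) IH scalerA big_ord_recr /= mulrC.
Qed.

Lemma hw_coef k : (k <= i)%N -> \prod_(j < k) (j.+1%:R * (i%:R - j%:R)) != 0 :> F.
Proof.
move=> ki; apply/prodf_neq0 => j _; rewrite mulf_neq0 ?pnatr_eq0 // subr_eq0 eqr_nat.
by have := ltn_ord j; lia.
Qed.

Lemma hw_D_neq0 k : x != 0 -> (k <= i)%N -> iter k D x != 0.
Proof.
move=> x0 ki; apply: contra x0 => /eqP h; have := hw_ED k.
by rewrite h (lin0 (iter_lin _ Elin)) => /esym/eqP; rewrite scaler_eq0 (negPf (hw_coef ki)).
Qed.

End HighestWeight.

Definition strings (W : set V) : set V :=
  [set y | exists x i k, [/\ W x, E x = 0, H x = i%:R *: x & y = iter k D x]].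

(* Complete reducibility, in the form needed here. *)
Theorem sl2_span (W : set V) v : linsub W -> (forall x, W x -> W (E x)) ->
  (forall x, W x -> W (H x)) -> (forall x, W x -> W (D x)) -> W v -> lspan (strings W) v.
Proof.
move=> hW WE WH WD Wv; set S := lspan (strings W).
have hS : linsub S by exact: lspan_linsub.
have gen y : strings W y -> S y by exact: sub_lspan.
have pre (T : V -> V) : linear T -> linsub [set x | S (T x)].
  move=> Tl; split=> [|a x y hx hy] /=; first by rewrite (lin0 Tl); exact: linsub0 hS.
  by rewrite Tl; exact: hS.2.
have SE x : S x -> S (E x).
  apply: (lspan_sub (pre _ Elin)) => y [z [i [k [Wz Ez Hz ->]]]] /=.
  case: k => [|k]; first by rewrite /= Ez; exact: linsub0 hS.
  by rewrite (hw_E Ez Hz); apply: (linsubZ hS); apply: gen; exists z, i, k.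
have SH x : S x -> S (H x).
  apply: (lspan_sub (pre _ Hlin)) => y [z [i [k [Wz Ez Hz ->]]]] /=.
  by rewrite (hw_H Hz); apply: (linsubZ hS); apply: gen; exists z, i, k.
have SD x : S x -> S (D x).
  apply: (lspan_sub (pre _ Dlin)) => y [z [i [k [Wz Ez Hz ->]]]] /=.
  by apply: gen; exists z, i, k.+1.
have kerS x : W x -> E x = 0 -> S x.
  move=> Wx Ex.
  have hK : linsub [set x | W x /\ E x = 0].
    split=> [|a y z [Wy Ey] [Wz Ez]]; first by split; [exact: linsub0 hW | exact: lin0].
    by split; [exact: hW.2 | rewrite Elin Ey Ez scaler0 addr0].
  have KH y : W y /\ E y = 0 -> W (H y) /\ E (H y) = 0.
    move=> [Wy Ey]; split; first exact: WH.
    have -> : E (H y) = H (E y) - 2%:R *: E y by rewrite hHE addrK.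
    by rewrite Ey (lin0 Hlin) scaler0 subrr.
  have := @hw_span [set x | W x /\ E x = 0] x hK KH (fun y h => h.2) (conj Wx Ex).
  apply=> // y [[Wy Ey] [i Hy]]; apply: gen; exists y, i, 0%N; by [].
apply: contrapT => nSv.
have [w [Ww nSw SEw]] : exists w, [/\ W w, ~ S w & S (E w)].
  have : S (iter NE E v) by rewrite Enil; exact: linsub0 hS.
  elim: NE v Wv nSv => [v _ nSv /= Sv|N IH v Wv nSv h]; first by case: nSv.
  have [SEv|nSEv] := pselect (S (E v)); first by exists v.
  by apply: (IH (E v)) => //; [exact: WE | rewrite -iterSr].
(* The product of the [H - c] in [hw_opprod] sends [w] into [S]; stopping at the last vector outside
   [S] gives an eigenvector of [H] modulo [S]. *)
have [u [Wu nSu SEu [i Siu]]] : exists u, [/\ W u, ~ S u, S (E u) &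
    exists i : nat, S (H u - i%:R *: u)].
  have : S (opprod H (natseq ND) w) by exact: (hw_opprod hS SE SH SD SEw).
  have : forall c, c \in natseq ND -> exists i : nat, c = i%:R by move=> c; exact: mem_natseq.
  elim: (natseq ND) w Ww nSw SEw => [w _ nSw _ _ /= Sw|c cs IH w Ww nSw SEw hc h]; first by case: nSw.
  have [Sc|nSc] := pselect (S (H w - c *: w)).
    exists w; split=> //; have [i ci] := hc c (mem_head _ _); by exists i; rewrite -ci.
  apply: (IH (H w - c *: w)) => //.
  - by apply: (linsubB hW); [exact: WH | exact: (linsubZ hW)].
  - rewrite (linB Elin) (linZ Elin); apply: (linsubB hS); last exact: (linsubZ hS).
    have -> : E (H w) = H (E w) - 2%:R *: E w by rewrite hHE addrK.
    by apply: (linsubB hS); [exact: SH | exact: (linsubZ hS)].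
  - by move=> d dcs; apply: hc; rewrite inE dcs orbT.
  - by rewrite (opprod_swap Hlin).
(* It suffices that [E u] lies in [Z], the image of [S] under [E]: then [u] differs from an element
   of [S] by a vector of [W] killed by [E], and such vectors lie in [S]. *)
pose Z : set V := [set z | exists2 y, S y & z = E y].
have hZ : linsub Z.
  split=> [|a _ _ [y Sy ->] [z Sz ->]]; first by exists 0; [exact: linsub0 hS | rewrite (lin0 Elin)].
  by exists (a *: y + z); [exact: hS.2 | rewrite Elin].
have ZH z : Z z -> Z (H z).
  move=> [y Sy ->]; exists (H y + 2%:R *: y); last by rewrite hHE (linD Elin) (linZ Elin).
  by apply: (linsubD hS); [exact: SH | exact: (linsubZ hS)].
(* The lowest weight vectors of [S] have nonpositive weights, and span [S] modulo [E S]. *)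
have [cs hcs Zcs] : exists2 cs : seq F, (forall d, d \in cs -> exists m : nat, d = - m%:R) &
    Z (opprod H cs (E u)).
  apply: (SEu [set y | exists2 cs : seq F, (forall d, d \in cs -> exists m : nat, d = - m%:R) &
    Z (opprod H cs y)]).
    split=> [|a y z [cs hcs Zy] [ds hds Zz]]; first by exists [::] => //; exact: linsub0 hZ.
    exists (cs ++ ds); first by move=> d; rewrite mem_cat => /orP [/hcs|/hds].
    rewrite (opprod_lin Hlin); apply: hZ.2.
      by rewrite opprod_cat (opprodC Hlin); apply: opprod_stable.
    by rewrite opprod_cat; apply: opprod_stable.
  move=> _ [x [j [k [Wx Ex Hx ->]]]].
  have [kj|jk|->] := ltngtP k j.
  - exists [::] => //; exists ((k.+1%:R * (j%:R - k%:R))^-1 *: iter k.+1 D x).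
      by apply: (linsubZ hS); apply: gen; exists x, j, k.+1.
    rewrite (linZ Elin) (hw_E Ex Hx) scalerA mulVf ?scale1r //.
    by rewrite mulf_neq0 ?pnatr_eq0 // subr_eq0 eqr_nat; lia.
  - by exists [::] => //=; rewrite (hw_top Ex Hx jk); exact: linsub0 hZ.
  - exists [:: - j%:R]; first by move=> d; rewrite inE => /eqP ->; exists j.
    rewrite /= (hw_H Hx) -scalerBl natrM (_ : _ - _ - _ = 0); last by ring.
    by rewrite scale0r; exact: linsub0 hZ.
(* Modulo [Z], [E u] has the positive weight [i + 2], so the product over nonpositive weights that
   kills it also multiplies it by a nonzero scalar. *)
have Zi : Z (H (E u) - (i%:R + 2%:R) *: E u).
  exists (H u - i%:R *: u) => //; rewrite hHE (linB Elin) (linZ Elin) (scalerDl (E u) i%:R 2%:R).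
  by rewrite opprD addrACA subrr addr0.
have Ze : Z (opprod H cs (E u) - (\prod_(d <- cs) (i%:R + 2%:R - d)) *: E u).
  elim: cs {hcs Zcs} => [|d cs IH] /=; first by rewrite big_nil scale1r subrr; exact: linsub0 hZ.
  set w' := opprod H cs (E u) in IH *; set P := \prod_(d <- cs) _ in IH.
  rewrite big_cons -/P.
  have -> : H w' - d *: w' - ((i%:R + 2%:R - d) * P) *: E u =
    (H (w' - P *: E u) - d *: (w' - P *: E u)) + P *: (H (E u) - (i%:R + 2%:R) *: E u).
    rewrite (linB Hlin) (linZ Hlin) !scalerBr !scalerA.
    rewrite [RHS]addrAC [_ + (P *: H (E u) - _)]addrA subrK subr_swap mulrBl scalerBl; congr (_ - (_ - _)).
    by rewrite mulrC.
  apply: (linsubD hZ); last exact: (linsubZ hZ).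
  by apply: (linsubB hZ); [exact: ZH | exact: (linsubZ hZ)].
have P0 : \prod_(d <- cs) (i%:R + 2%:R - d) != 0.
  rewrite prodf_seq_neq0; apply/allP => d /hcs [m ->] /=.
  by rewrite opprK -!natrD pnatr_eq0; lia.
have [a Sa Ea] : Z (E u).
  have := linsubZ hZ (\prod_(d <- cs) (i%:R + 2%:R - d))^-1 (linsubB hZ Zcs Ze).
  by rewrite subKr scalerA mulVf // scale1r.
have WS y : S y -> W y.
  apply: (lspan_sub hW) => _ [x [j [k [Wx _ _ ->]]]].
  by elim: k => //= k; exact: WD.
apply: nSu; rewrite -[u](subrK a); apply: (linsubD hS) => //; apply: kerS.
  by apply: (linsubB hW) => //; exact: WS.
by rewrite (linB Elin) Ea subrr.
Qed.

End SL2.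

Lemma directv_ker (F : fieldType) (V : vectType F) r (Vs : 'I_r -> {vspace V})
    (T : V -> V) (x : 'I_r -> V) : linear T -> directv (\sum_(a < r) Vs a) ->
  (forall a v, v \in Vs a -> T v \in Vs a) -> (forall a, x a \in Vs a) ->
  T (\sum_(a < r) x a) = 0 -> forall a, T (x a) = 0.
Proof.
move=> Tl /directv_sum_independent dV TV xV.
have T0 : T 0 = 0 by have := Tl (-1) 0 0; rewrite scaler0 addr0 scaleN1r addNr.
have -> : T (\sum_(a < r) x a) = \sum_(a < r) T (x a).
  by apply: (big_morph T _ T0) => u v; have := Tl 1 u v; rewrite !scale1r.
move=> /(dV (fun a => T (x a)) (fun a _ => TV a _ (xV a))) h a; exact: h.
Qed.

Lemma linear_ex (F : fieldType) (V : lmodType F) (T : V -> V) : linear T ->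
  exists l : {linear V -> V}, l =1 T.
Proof.
move=> hT; pose m := GRing.isLinear.Build F V V *:%R T hT.
by exists (HB.pack_for {linear V -> V} T m).
Qed.

Lemma eigen_free (F : fieldType) (V : vectType F) (T : V -> V) r (mu : 'I_r -> F)
    (y : 'I_r -> V) : linear T -> injective mu -> (forall k, T (y k) = mu k *: y k) ->
  (forall k, y k != 0) -> free [seq y k | k <- enum 'I_r].
Proof.
move=> Tl inj Ty y0; have -> : [seq y k | k <- enum 'I_r] = [tuple y k | k < r] by [].
have TZ a v : T (a *: v) = a *: T v.
  have T0 : T 0 = 0 by have := Tl (-1) 0 0; rewrite scaler0 addr0 scaleN1r addNr.
  by have := Tl a v 0; rewrite T0 !addr0.
apply/freeP => c c0 k; have /eqP : c k *: y k = 0.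
  apply: (eigen_sum_eq0 Tl (r := enum 'I_r) (mu := mu) (y := fun k => c k *: y k)).
  - exact: enum_uniq.
  - by move=> a b _ _; exact: inj.
  - by move=> a _; rewrite TZ Ty !scalerA mulrC.
  - rewrite -[RHS]c0 big_enum /=; apply: eq_bigr => j _; congr (_ *: _).
    by rewrite /= (nth_map j) ?size_enum_ord // nth_ord_enum.
  - exact: mem_enum.
by rewrite scaler_eq0 (negPf (y0 k)) orbF => /eqP.
Qed.

(* The powers of [D] are eigenvectors of [ad H] for distinct eigenvalues. *)
Lemma ad_eigen_nil (F : numFieldType) (V : vectType F) (H D : V -> V) : linear H -> linear D ->
  (forall v, H (D v) = D (H v) - 2%:R *: D v) -> exists N, forall v, iter N D v = 0.
Proof.
move=> Hl Dl hHD; have [h hE] := linear_ex Hl.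
pose y k : 'End(V) := linfun (projT1 (cid (linear_ex (iter_lin k Dl)))).
have yE k v : y k v = iter k D v by rewrite lfunE /=; exact: (projT2 (cid (linear_ex (iter_lin k Dl)))).
apply: contrapT => no.
have y0 k : y k != 0.
  apply/eqP => yk; apply: no; exists k => v; by rewrite -yE yk lfunE.
pose T (X : 'End(V)) : 'End(V) := ((linfun h \o X) - (X \o linfun h))%VF.
have Tl : linear T.
  move=> a X Y; apply/lfunP => v; rewrite /T.
  rewrite !(add_lfunE, scale_lfunE, opp_lfunE, comp_lfunE) linearD linearZ /= scalerBr.
  by rewrite opprD addrACA.
have Ty k : T (y k) = - (2 * k)%:R *: y k.
  apply/lfunP => v; rewrite /T !(add_lfunE, scale_lfunE, opp_lfunE, comp_lfunE).
  rewrite ![linfun h _]lfunE /= !hE !yE (H_iterD Dl hHD).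
  by rewrite addrAC subrr add0r scaleNr.
pose N := (\dim {:'End(V)}).+1.
have := @eigen_free _ _ T N (fun k => - (2 * k)%:R) (fun k => y k) Tl _ (fun k => Ty k) (fun k => y0 k).
have inj : injective (fun k : 'I_N => - (2 * k)%:R : F).
  by move=> a b /oppr_inj /eqP; rewrite eqr_nat eqn_mul2l /= => /eqP; exact: val_inj.
move=> /(_ inj) /eqP hf.
have := dimvS (subvf <<[seq y (val k) | k : 'I_N]>>).
by rewrite hf size_map size_enum_ord ltnn.
Qed.

(** * Irreducible submodules and decompositions *)

Section SL2Vect.
Variables (F : numFieldType) (V : vectType F) (E H D : V -> V).
Hypothesis (Elin : linear E) (Hlin : linear H) (Dlin : linear D).
Hypothesis hHE : forall v, H (E v) = E (H v) + 2%:R *: E v.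
Hypothesis hHD : forall v, H (D v) = D (H v) - 2%:R *: D v.
Hypothesis hED : forall v, E (D v) = D (E v) + H v.
Variables (NE ND : nat).
Hypothesis (Enil : forall v, iter NE E v = 0) (Dnil : forall v, iter ND D v = 0).

Let lin0 (T : V -> V) : linear T -> T 0 = 0.
Proof. by move=> Tl; have := Tl (-1) 0 0; rewrite scaler0 addr0 scaleN1r addNr. Qed.

Definition sl2_stable (W : {vspace V}) : Prop :=
  forall x, x \in W -> [/\ E x \in W, H x \in W & D x \in W].

Definition sl2_irreducible (W : {vspace V}) : Prop :=
  [/\ W != 0%VS, sl2_stable W
    & forall W' : {vspace V}, (W' <= W)%VS -> sl2_stable W' -> W' = 0%VS \/ W' = W].

Lemma linsub_mem (W : {vspace V}) : linsub [set x | x \in W].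
Proof. by split=> [|a x y hx hy]; rewrite /= ?mem0v // memvD // memvZ. Qed.

Lemma iterD_mem (W : {vspace V}) k x : sl2_stable W -> x \in W -> iter k D x \in W.
Proof. by move=> sW xW; elim: k => //= k /sW []. Qed.

Lemma stable_span (W : {vspace V}) x : sl2_stable W -> x \in W ->
  lspan (strings E H D [set y | y \in W]) x.
Proof.
move=> sW xW; apply: (sl2_span Elin Hlin Dlin hHE hHD hED Enil Dnil (linsub_mem W)) => //.
- by move=> y /sW [].
- by move=> y /sW [].
- by move=> y /sW [].
Qed.

Lemma stable_hw (W : {vspace V}) : sl2_stable W -> W != 0%VS ->
  exists x (i : nat), [/\ x \in W, x != 0, E x = 0 & H x = i%:R *: x].
Proof.
move=> sW W0; apply: contrapT => no.
have : vpick W = 0.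
  apply: (stable_span sW (memv_pick W) (U := [set 0])).
    by split=> // a x y -> ->; rewrite scaler0 addr0.
  move=> _ [x [i [k [/= Wx Ex Hx ->]]]]; have [->|x0] := eqVneq x 0.
    by rewrite /=; elim: k => //= k ->; exact: (lin0 Dlin).
  by case: no; exists x, i.
by move/eqP; rewrite vpick0 (negPf W0).
Qed.

Definition string (x : V) (i : nat) : {vspace V} := <<[seq iter k D x | k <- iota 0 i.+1]>>%VS.

Section HighestWeightString.
Variables (x : V) (i : nat).
Hypothesis (Ex : E x = 0) (Hx : H x = i%:R *: x).

Lemma string_iter k : iter k D x \in string x i.
Proof.
have [ki|ik] := leqP k i; last by rewrite (hw_top Elin Hlin Dlin hHE hHD hED Dnil Ex Hx ik) mem0v.
by apply: memv_span; apply/mapP; exists k; rewrite // mem_iota add0n ltnS.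
Qed.

Lemma string_hw : x \in string x i. Proof. exact: (string_iter 0). Qed.

Lemma string_ind (S : set V) : linsub S -> (forall k, S (iter k D x)) ->
  forall v, v \in string x i -> S v.
Proof.
move=> hS Sk v /coord_span ->; apply: (linsub_sum hS) => j _; apply: (linsubZ hS).
have hj : (j < size (iota 0 i.+1))%N by rewrite size_iota.
by rewrite (nth_map 0%N).
Qed.

Lemma string_stable : sl2_stable (string x i).
Proof.
have pre (T : V -> V) : linear T -> linsub [set v | T v \in string x i].
  by move=> Tl; split=> [|a u v /= hu hv] /=; rewrite ?(lin0 Tl) ?mem0v // Tl memvD // memvZ.
move=> v hv; split.
- apply: (string_ind (pre _ Elin)) hv => -[|k] /=; first by rewrite Ex mem0v.
  by rewrite -iterS (hw_E Dlin hHD hED Ex Hx) memvZ ?string_iter.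
- apply: (string_ind (pre _ Hlin)) hv => k /=.
  by rewrite (hw_H Dlin hHD Hx) memvZ ?string_iter.
- by apply: (string_ind (pre _ Dlin)) hv => k /=; rewrite -iterS string_iter.
Qed.

Lemma string_sub (W : {vspace V}) : sl2_stable W -> x \in W -> (string x i <= W)%VS.
Proof.
move=> sW xW; apply/subvP => v; apply: (string_ind (linsub_mem W)) => k /=.
exact: iterD_mem.
Qed.

Hypothesis x0 : x != 0.

Lemma string_dim : \dim (string x i) = i.+1.
Proof.
have : free [seq iter k D x | k <- iota 0 i.+1].
  rewrite (_ : [seq _ | k <- _] = [seq iter (val k) D x | k <- enum 'I_i.+1]); last first.
    by rewrite (map_comp (fun k => iter k D x) val) val_enum_ord.
  apply: (eigen_free (mu := fun k : 'I_i.+1 => i%:R - (2 * k)%:R) Hlin).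
  - by move=> a b /= /addrI /oppr_inj /eqP; rewrite eqr_nat eqn_mul2l /= => /eqP; exact: val_inj.
  - by move=> k; exact: (hw_H Dlin hHD Hx).
  - by move=> k; apply: (hw_D_neq0 Elin Dlin hHD hED Ex Hx x0); rewrite -ltnS ltn_ord.
by move/eqP; rewrite /string => ->; rewrite size_map size_iota.
Qed.

(** A highest weight vector of a nonzero submodule has a weight [i - 2j], so it is a multiple of
    [D^j x]; being killed by [E], it has [j = 0]. *)
Lemma string_irreducible : sl2_irreducible (string x i).
Proof.
split; [|exact: string_stable|].
  by rewrite -dimv_eq0 string_dim.
move=> W WS sW; have [->|W0] := eqVneq W 0%VS; [by left|right].
have [z [m [Wz z0 Ez Hz]]] := stable_hw sW W0.
apply/eqP; rewrite eqEsubv WS /=; apply: string_sub => //.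
have hz : z \in string x i by exact: (subvP WS).
have [j [ji hj]] : exists j, (j <= i)%N /\ m%:R = i%:R - (2 * j)%:R :> F.
  apply: contrapT => no; move/eqP: z0; apply.
  apply: (@eigen_lspan_eq0 _ _ H Hlin (fun c => exists j, (j <= i)%N /\ c = i%:R - (2 * j)%:R)
    m%:R) => //.
  apply: (string_ind (lspan_linsub _)) hz => k; have [ki|ik] := leqP k i; last first.
    rewrite (hw_top Elin Hlin Dlin hHE hHD hED Dnil Ex Hx ik); exact: linsub0 (lspan_linsub _).
  apply: sub_lspan; exists (i%:R - (2 * k)%:R); first by exists k.
  exact: hw_H.
have : z \in <[iter j D x]>%VS.
  apply: (@eigen_lspan_mod _ _ H Hlin [set v | v \in <[iter j D x]>%VS]
    (fun c => c != m%:R) m%:R).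
  - exact: linsub_mem.
  - move=> v /= /vlineP [a ->]; have := Hlin a (iter j D x) 0.
    rewrite (lin0 Hlin) !addr0 => ->; rewrite memvZ // (hw_H Dlin hHD Hx) memvZ //.
    exact: memv_line.
  - by rewrite eqxx.
  - apply: (string_ind (lspan_linsub _)) hz => k; apply: sub_lspan.
    have [->|kj] := eqVneq k j; first by left; exact: memv_line.
    right; exists (i%:R - (2 * k)%:R); last exact: hw_H.
    apply: contraNneq kj; rewrite hj => /addrI /oppr_inj /eqP.
    by rewrite eqr_nat eqn_mul2l.
  - exact: Hz.
move=> /vlineP [a za].
have a0 : a != 0 by apply: contraNneq z0 => a0; rewrite za a0 scale0r.
have Ej : E (iter j D x) = 0.
  have := Elin a (iter j D x) 0; rewrite (lin0 Elin) !addr0 -za Ez => /esym/eqP.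
  by rewrite scaler_eq0 (negPf a0) => /eqP.
case: j => [|j] in ji hj za Ej.
  by rewrite za in Wz; rewrite -[x]scale1r -(mulVf a0) -scalerA memvZ.
have := hw_E Dlin hHD hED Ex Hx j; rewrite Ej => /esym/eqP.
rewrite scaler_eq0 (negPf (hw_D_neq0 Elin Dlin hHD hED Ex Hx x0 (ltnW ji))) orbF.
by rewrite mulf_eq0 pnatr_eq0 /= subr_eq0 eqr_nat; lia.
Qed.

Lemma irreducible_string (W : {vspace V}) : sl2_irreducible W -> x \in W -> W = string x i.
Proof.
move=> [W0 sW hW] xW; have [e|//] := hW _ (string_sub sW xW) string_stable.
by have := string_dim; rewrite e dimv0.
Qed.

End HighestWeightString.

(* Any maximal direct sum of irreducible submodules is everything. *)
Lemma sl2_decomp (W : {vspace V}) (B : Type) (Lb : B -> set V) :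
  (forall b, linsub (Lb b)) -> (forall b x, Lb b x -> Lb b (D x)) ->
  (forall b x, Lb b x -> x \in W) ->
  (forall W' : {vspace V}, sl2_stable W' ->
    (forall b x (i : nat), Lb b x -> E x = 0 -> H x = i%:R *: x -> x \in W') -> (W <= W')%VS) ->
  exists r (beta : 'I_r -> B) (d : 'I_r -> nat) (Vs : 'I_r -> {vspace V}),
    [/\ forall a, [/\ forall x, x \in Vs a -> Lb (beta a) x, sl2_irreducible (Vs a)
          & \dim (Vs a) = (d a).+1],
        directv (\sum_(a < r) Vs a) & W = (\sum_(a < r) Vs a)%VS].
Proof.
move=> hL LD LW gen.
pose dec r (beta : 'I_r -> B) (d : 'I_r -> nat) (Vs : 'I_r -> {vspace V}) :=
  (forall a, [/\ forall x, x \in Vs a -> Lb (beta a) x, sl2_irreducible (Vs a)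
          & \dim (Vs a) = (d a).+1]) /\ directv (\sum_(a < r) Vs a).
suff grow k : exists r beta d Vs, @dec r beta d Vs /\
    (W = (\sum_(a < r) Vs a)%VS \/ (k <= \dim (\sum_(a < r) Vs a)%VS)%N).
  have [r [beta [d [Vs [[h1 h2] h3]]]]] := grow (\dim W).+1.
  exists r, beta, d, Vs; split=> //; case: h3 => // h.
  have /dimvS : ((\sum_(a < r) Vs a)%VS <= W)%VS.
    by apply/subv_sumP => a _; apply/subvP => x hx; have [+ _ _] := h1 a => /(_ x hx) /LW.
  by rewrite leqNgt h.
elim: k => [|k [r [beta [d [Vs [[hV dV] hk]]]]]].
  (* [B] may be empty, so the labels of the empty family come from the impossible index. *)
  exists 0%N, (fun a : 'I_0 => False_rect B (notF (ltn_ord a))), (fun a => 0%N), (fun a => 0%VS).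
  by split; [split=> [[]//|]; rewrite directvE /= !big_ord0 dimv0|right].
case: hk => [eW|hk]; first by exists r, beta, d, Vs; split=> //; left.
have [eW|neW] := eqVneq W (\sum_(a < r) Vs a)%VS; first by exists r, beta, d, Vs; split=> //; left.
set S := (\sum_(a < r) Vs a)%VS in dV hk neW *.
have sS : sl2_stable S.
  move=> x /memv_sumP [y hy ->].
  have sum (T : V -> V) : linear T -> (forall a, T (y a) \in Vs a) -> T (\sum_(a < r) y a) \in S.
    move=> Tl h; have TD u v : T (u + v) = T u + T v by have := Tl 1 u v; rewrite !scale1r.
    by rewrite (big_morph T TD (lin0 Tl)); apply: memv_sumr => a _.
  have st a : [/\ E (y a) \in Vs a, H (y a) \in Vs a & D (y a) \in Vs a].
    by have [_ [_ + _] _] := hV a; apply; exact: hy.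
  by split; apply: sum => // a; have [] := st a.
have SW : (S <= W)%VS.
  by apply/subv_sumP => a _; apply/subvP => x hx; have [+ _ _] := hV a => /(_ x hx) /LW.
have [b [x [i [Lx Ex Hx nSx]]]] : exists b x (i : nat),
    [/\ Lb b x, E x = 0, H x = i%:R *: x & x \notin S].
  apply: contrapT => no; case/negP: neW; rewrite eqEsubv SW andbT.
  apply: gen => // b x i Lx Ex Hx; apply: contraT => nSx; case: no; by exists b, x, i.
have x0 : x != 0 by apply: contraNneq nSx => ->; rewrite mem0v.
pose ext (A : Type) (u : A) (w : 'I_r -> A) (a : 'I_r.+1) := oapp w u (unlift ord0 a).
have ext0 A u w : @ext A u w ord0 = u by rewrite /ext unlift_none.
have extS A u w a : @ext A u w (lift ord0 a) = w a by rewrite /ext liftK.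
have cap0 : (string x i :&: S)%VS = 0%VS.
  have [_ _ irr] := string_irreducible Ex Hx x0.
  have st : sl2_stable (string x i :&: S)%VS.
    move=> v; rewrite !memv_cap => /andP [/(string_stable Ex Hx) [-> -> ->]] /sS [-> -> ->].
    by [].
  have [//|e] := irr _ (capvSl _ _) st.
  by have := string_hw Ex Hx; rewrite -e memv_cap (negPf nSx) andbF.
have dimS : \dim (string x i + S)%VS = (i.+1 + \dim S)%N.
  by rewrite dimv_disjoint_sum // (string_dim Ex Hx x0).
have bigE : (\sum_(a < r.+1) ext _ (string x i) Vs a)%VS = (string x i + S)%VS.
  rewrite big_ord_recl ext0; congr (_ + _)%VS; apply: eq_bigr => a _; exact: extS.
exists r.+1, (ext _ b beta), (ext _ i d), (ext _ (string x i) Vs); split; last first.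
  by right; rewrite bigE dimS; lia.
split=> [a|].
  have [a'|] := unliftP ord0 a => ->; rewrite ?ext0 ?extS; first exact: hV.
  split; [|exact: string_irreducible|exact: string_dim].
  move=> v; apply: (string_ind (hL b)) => l; elim: l => //= l; exact: LD.
rewrite directvE /= bigE dimS big_ord_recl ext0 (string_dim Ex Hx x0); apply/eqP; congr addn.
move: dV; rewrite directvE /= => /eqP ->; apply: eq_bigr => a _; by rewrite extS.
Qed.

End SL2Vect.

(** * Weights and good gradings *)

Section Torus.
Variables (R : realType) (n : nat).
Local Notation C := R[i].
Local Notation M := 'M[C]_n.

Lemma Lie_diagonalizable (T : set M) Q x : Q \in unitmx ->
  (forall A, T A -> is_diag_mx (Q *m A *m invmx Q)) -> Lie T x ->
  exists mu, x = invmx Q *m diag_mx mu *m Q.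
Proof.
move=> Qu hT Tx; have /diag_mxP [mu hmu] : is_diag_mx (Q *m x *m invmx Q).
  apply/is_diag_mxP => a b ab.
  apply: (Lie_scalar (H := T) (l := fun A => (Q *m A *m invmx Q) a b) (c := 0)) Tx.
    by move=> u X Y; rewrite mulmxDr mulmxDl -scalemxAr -scalemxAl !mxE.
  by move=> A /hT /is_diag_mxP; apply.
by exists mu; rewrite -hmu !mulmxA mulVmx // mul1mx mulmxKV.
Qed.

(** The condition [A z = z A] is linear in [A], so it passes to tangent vectors. *)
Lemma Lie_fixing (T : set M) z x : T `<=` [set A | A \in unitmx] ->
  (forall A, T A -> Ad A z = z) -> Lie T x -> br x z = 0.
Proof.
move=> Tu hT Tx; apply/matrixP => a b; rewrite [RHS]mxE.
apply: (Lie_scalar (H := T) (l := fun A => br A z a b) (c := 0)) Tx.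
  by move=> u X Y; rewrite brDl brZl !mxE.
move=> A TA; have Au : A \in unitmx := Tu _ TA.
by rewrite /br -{2}(hT _ TA) /Ad mulmxKV // subrr mxE.
Qed.

Variables (te : set M) (Q : M).
Hypothesis hte : linsub te.
Hypothesis Qu : Q \in unitmx.
Hypothesis te_diag : forall t, te t -> exists mu, t = invmx Q *m diag_mx mu *m Q.

(** These are the roots of the diagonal matrices in the basis given by [Q]; every weight of [te] on
    matrices is the restriction of one of them. *)
Definition eps (a : 'I_n * 'I_n) (t : M) : C :=
  (Q *m t *m invmx Q) a.1 a.1 - (Q *m t *m invmx Q) a.2 a.2.

Lemma eps_scalar a : scalar (eps a).
Proof.
move=> u X Y; rewrite /eps mulmxDr mulmxDl -scalemxAr -scalemxAl !mxE.
by rewrite opprD addrACA mulrBr.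
Qed.

Lemma eps_diag a mu : eps a (invmx Q *m diag_mx mu *m Q) = mu 0 a.1 - mu 0 a.2.
Proof. by rewrite /eps !mulmxA mulmxV // mul1mx mulmxK // !mxE !eqxx !mulr1n. Qed.

(** Finitely many proper hyperplanes, on which two roots with different restrictions to [te] agree,
    do not cover [te]. Eigenvectors of [ad t0] are then weight vectors for all of [te]. *)
Lemma generic_ex : exists t0 lam, [/\ te t0, t0 = invmx Q *m diag_mx lam *m Q &
  forall a b, eps a t0 = eps b t0 -> forall t, te t -> eps a t = eps b t].
Proof.
have [l hl] : exists l : ('I_n * 'I_n) * ('I_n * 'I_n) -> {scalar M},
    forall i t, l i t = eps i.1 t - eps i.2 t.
  suff : forall i : ('I_n * 'I_n) * ('I_n * 'I_n), exists li : {scalar M},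
      forall t, li t = eps i.1 t - eps i.2 t.
    by move=> /choice [l hl]; exists l.
  move=> i; have : scalar (fun t => eps i.1 t - eps i.2 t).
    by move=> u X Y; rewrite !eps_scalar opprD addrACA -mulrBr.
  by move=> /scalar_ex [li hli]; exists li.
pose r := [seq i <- enum {: ('I_n * 'I_n) * ('I_n * 'I_n)} | `[< exists2 x, te x & l i x != 0 >]].
have [i|t0 tt0 ht0] := @linsub_avoid _ _ te _ r l hte.
  by rewrite mem_filter => /andP [/asboolP].
have [lam t0E] := te_diag tt0; exists t0, lam; split=> // a b ab t tt.
apply/eqP; rewrite -subr_eq0; apply: contraT => nz.
have /ht0 : (a, b) \in r.
  by rewrite mem_filter mem_enum andbT; apply/asboolP; exists t => //; rewrite hl.
by rewrite hl /= ab subrr eqxx.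
Qed.

Variables (t0 : M) (lam : 'rV[C]_n).
Hypothesis t0E : t0 = invmx Q *m diag_mx lam *m Q.
Hypothesis generic : forall a b, eps a t0 = eps b t0 -> forall t, te t -> eps a t = eps b t.

Lemma te_weight x c : x != 0 -> br t0 x = c *: x ->
  exists a, c = eps a t0 /\ forall t, te t -> br t x = eps a t *: x.
Proof.
move=> x0 /(br_t0_toral t0E) /(toral_entry lam Qu) hx.
have [a [b ab]] : exists a b, (Q *m x *m invmx Q) a b != 0.
  apply: contrapT => no; case/eqP: x0.
  have y0 : Q *m x *m invmx Q = 0.
    apply/matrixP => a b; rewrite [RHS]mxE; apply/eqP; apply: contraT => h.
    by case: no; exists a, b.
  have -> : x = invmx Q *m (Q *m x *m invmx Q) *m Q by rewrite !mulmxA mulVmx // mul1mx mulmxKV.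
  by rewrite y0 mulmx0 mul0mx.
have lamE d e : (Q *m x *m invmx Q) d e != 0 -> lam 0 d - lam 0 e = c.
  move=> h; have /eqP := hx d e; rewrite mulf_eq0 (negPf h) orbF subr_eq0.
  by move/eqP.
exists (a, b); split; first by rewrite t0E eps_diag /= lamE.
move=> t tt; have [mu tE] := te_diag tt.
rewrite {1}tE; apply/(toral_entry mu Qu) => d e.
have [->|h] := eqVneq ((Q *m x *m invmx Q) d e) 0; first by rewrite mulr0.
have := @generic (d, e) (a, b); rewrite {1 2}t0E !eps_diag /= !lamE // => /(_ erefl t tt).
by rewrite [eps (d, e) t]/eps {1 2}tE => <-; rewrite -/(eps (d, e) _) eps_diag subrr mul0r.
Qed.

Lemma weight_form a : exists alpha : {scalar M}, forall t, alpha t = eps a t.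
Proof. by have [l hl] := scalar_ex (eps_scalar a); exists l. Qed.

End Torus.

(** * Highest weight vectors in the weight spaces of the torus *)

Section Sl2Weights.
Variables (R : realType) (n : nat).
Local Notation C := R[i].
Local Notation M := 'M[C]_n.
Variables (G : set M) (e h f : M) (te : set M) (Q t0 : M) (lam : 'rV[C]_n).
Hypothesis hG : connected_semisimple G.
Hypothesis (he : Lie G e) (hh : Lie G h) (hf : Lie G f).
Hypothesis hs : sl2_triple e h f.
Hypothesis teG : te `<=` Lie G.
Hypothesis te_e : forall t, te t -> br t e = 0.
Hypothesis te_h : forall t, te t -> br t h = 0.
Hypothesis Qu : Q \in unitmx.
Hypothesis te_diag : forall t, te t -> exists mu, t = invmx Q *m diag_mx mu *m Q.
Hypothesis tet0 : te t0.
Hypothesis t0E : t0 = invmx Q *m diag_mx lam *m Q.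
Hypothesis generic : forall a b, eps Q a t0 = eps Q b t0 ->
  forall t, te t -> eps Q a t = eps Q b t.

Local Notation g := (Lie G).

Let gL : linsub g. Proof. exact: Lie_linsub. Qed.
Let gbr x y : g x -> g y -> g (br x y).
Proof.
have [[sG _] _ _] := hG; have [Gu _ _ _] := sG.
by apply: Lie_bracket => // A B; exact: subgroup_Ad.
Qed.

Lemma br_linear (x : M) : linear (br x).
Proof. by move=> a y z; rewrite brDr brZr. Qed.

Let El := br_linear e. Let Hl := br_linear h. Let Dl := br_linear f.

Let hHE v : br h (br e v) = br e (br h v) + 2%:R *: br e v.
Proof. by rewrite brA; have [-> _ _] := hs; rewrite brZl addrC. Qed.
Let hHD v : br h (br f v) = br f (br h v) - 2%:R *: br f v.
Proof. by rewrite brA; have [_ -> _] := hs; rewrite brZl addrC scaleNr. Qed.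
Let hED v : br e (br f v) = br f (br e v) + br h v.
Proof. by rewrite brA; have [_ _ ->] := hs; rewrite addrC. Qed.

Let Dnil : exists N, forall v, iter N (br f) v = 0. Proof. exact: ad_eigen_nil hHD. Qed.
Let Enil : exists N, forall v, iter N (br e) v = 0.
Proof.
apply: (@ad_eigen_nil _ _ (fun v => - br h v)) El _ => [a x y|v].
  by rewrite brDr brZr opprD scalerN.
have -> : br e (- br h v) = - br e (br h v) by rewrite -scaleN1r brZr scaleN1r.
by rewrite hHE opprD.
Qed.

(** [br t f] is killed by [e] and has weight [-2] under [h], whereas nonzero vectors killed by [e]
    have natural weights. *)
Let te_f t : te t -> br t f = 0.
Proof.
move=> tt; have [ND hND] := Dnil; apply/eqP; apply: contraT => y0.
have Ey : br e (br t f) = 0.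
  have [_ _ ef] := hs.
  by rewrite brA ef (te_h tt) addr0 [br e t]brC (te_e tt) oppr0 brC br0 oppr0.
have Hy : br h (br t f) = (- 2%:R) *: br t f.
  have [_ hfE _] := hs.
  by rewrite brA hfE brZr [br h t]brC (te_h tt) oppr0 brC br0 oppr0 add0r.
have [i /eqP] := hw_weight_nat El Hl Dl hHE hHD hED hND Ey Hy y0.
by rewrite eq_sym -subr_eq0 opprK -natrD pnatr_eq0 addn2.
Qed.

Let te_br t x y : te t -> br t x = 0 -> br t (br x y) = br x (br t y).
Proof. by move=> tt tx; rewrite brA tx brC br0 oppr0 add0r. Qed.

Lemma wspace_linsub alpha : linsub (weight_space te g alpha).
Proof.
split=> [|a x y [gx hx] [gy hy]].
  by split=> [|t _]; [exact: linsub0 gL | rewrite br0 scaler0].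
split=> [|t tt]; first exact: gL.2.
by rewrite brDr brZr hx // hy // scalerDr !scalerA mulrC.
Qed.

Lemma wspace_br alpha z x : g z -> (forall t, te t -> br t z = 0) ->
  weight_space te g alpha x -> weight_space te g alpha (br z x).
Proof.
move=> gz tz [gx hx]; split=> [|t tt]; first exact: gbr.
by rewrite (te_br x tt (tz _ tt)) hx // brZr.
Qed.

Definition hw (alpha : {scalar M}) (i : nat) (x : M) : Prop :=
  [/\ weight_space te g alpha x, x != 0, br e x = 0 & br h x = i%:R *: x].

(** The eigenspaces of the single element [t0] stand for the weight spaces of [te], so that [g] can
    be decomposed without choosing linear forms on matrices. *)
Definition t0space (c : C) : set M := [set x | g x /\ br t0 x = c *: x].

Lemma t0space_linsub c : linsub (t0space c).
Proof.
split=> [|a x y [gx hx] [gy hy]].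
  by split; [exact: linsub0 gL | rewrite br0 scaler0].
by split; [exact: gL.2 | rewrite brDr brZr hx hy scalerDr !scalerA mulrC].
Qed.

Lemma t0space_br c z x : g z -> (forall t, te t -> br t z = 0) ->
  t0space c x -> t0space c (br z x).
Proof.
by move=> gz tz [gx hx]; split; [exact: gbr | rewrite (te_br x tet0 (tz _ tet0)) hx brZr].
Qed.

Lemma t0space_weight c x : t0space c x -> x != 0 ->
  exists alpha : {scalar M}, weight_space te g alpha x /\ alpha t0 = c.
Proof.
move=> [gx hx] x0; have [a [ca ha]] := te_weight Qu te_diag t0E generic x0 hx.
have [alpha al] := weight_form Q a; exists alpha; split; last by rewrite al ca.
by split=> // t tt; rewrite al; exact: ha.
Qed.

Lemma weight_eps alpha x : weight_space te g alpha x -> x != 0 ->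
  exists a, forall t, te t -> alpha t = eps Q a t.
Proof.
move=> [gx hx] x0; have [a [ca ha]] := te_weight Qu te_diag t0E generic x0 (hx _ tet0).
exists a => t tt; apply/eqP; rewrite -subr_eq0.
have /eqP := hx t tt; rewrite (ha t tt) eq_sym -subr_eq0 -scalerBl scaler_eq0.
by rewrite (negPf x0) orbF.
Qed.

Lemma weight_eq alpha beta x y : weight_space te g alpha x -> x != 0 ->
  weight_space te g beta y -> y != 0 -> alpha t0 = beta t0 ->
  forall t, te t -> alpha t = beta t.
Proof.
move=> ax x0 ay y0 ab t tt; have [a ha] := weight_eps ax x0; have [b hb] := weight_eps ay y0.
by rewrite ha // hb //; apply: generic => //; rewrite -ha // -hb.
Qed.

Lemma eps_opp (a : 'I_n * 'I_n) t : eps Q (a.2, a.1) t = - eps Q a t.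
Proof. by rewrite /eps opprB. Qed.

Lemma weight_opp alpha beta x y : weight_space te g alpha x -> x != 0 ->
  weight_space te g beta y -> y != 0 -> alpha t0 = - beta t0 ->
  forall t, te t -> alpha t = - beta t.
Proof.
move=> ax x0 ay y0 ab t tt; have [a ha] := weight_eps ax x0; have [b hb] := weight_eps ay y0.
rewrite ha // hb // -eps_opp; apply: generic => //.
by rewrite eps_opp -ha // -hb.
Qed.

Lemma weight_zero alpha x : weight_space te g alpha x -> x != 0 -> alpha t0 = 0 ->
  forall t, te t -> alpha t = 0.
Proof.
move=> ax x0 a0 t tt; have [a ha] := weight_eps ax x0.
have e0 s : eps Q (a.1, a.1) s = 0 by rewrite /eps subrr.
by rewrite ha // -(e0 t); apply: generic => //; rewrite e0 -ha.
Qed.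

Lemma te_comm0 x : br t0 x = 0 -> forall t, te t -> br t x = 0.
Proof.
move=> hx t tt; have [->|x0] := eqVneq x 0; first exact: br0.
have hx0 : br t0 x = 0 *: x by rewrite hx scale0r.
have [a [ca ha]] := te_weight Qu te_diag t0E generic x0 hx0.
have e0 s : eps Q (a.1, a.1) s = 0 by rewrite /eps subrr.
by rewrite ha // (_ : eps Q a t = 0) ?scale0r // -(e0 t); apply: generic => //; rewrite e0.
Qed.

Let wc c x := wcomp Q lam c x.

Lemma t0space_wc c x : g x -> t0space c (wc c x).
Proof.
move=> gx; split; last by apply/(br_t0_toral t0E); exact: wcomp_eigen.
by apply: (@wcomp_mem _ _ Q lam Qu g c x gL _ gx) => y gy; rewrite -t0E; apply: gbr => //; exact: teG.
Qed.

Lemma g_span (S : set M) : linsub S ->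
  (forall alpha i k x, hw alpha i x -> (k <= i)%N -> S (iter k (br f) x)) -> g `<=` S.
Proof.
move=> hS gen x gx; have [NE hNE] := Enil; have [ND hND] := Dnil.
rewrite [x](wcomp_sum lam Qu); apply: (linsub_sum hS) => c _.
apply: (sl2_span El Hl Dl hHE hHD hED hNE hND (t0space_linsub c) _ _ _
  (t0space_wc c gx) hS).
- by move=> y; apply: t0space_br.
- by move=> y; apply: t0space_br.
- by move=> y; apply: t0space_br.
move=> _ [y [i [k [Wy Ey Hy ->]]]].
have [ki|ik] := leqP k i; last first.
  by rewrite (hw_top El Hl Dl hHE hHD hED hND Ey Hy ik); exact: linsub0 hS.
have [->|y0] := eqVneq y 0.
  rewrite (_ : iter k (br f) 0 = 0); first exact: linsub0 hS.
  by elim: (k) => //= l ->; exact: br0.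
have [alpha [ay _]] := t0space_weight Wy y0.
exact: (gen alpha i).
Qed.

Lemma ker_span (S : set M) : linsub S ->
  (forall alpha i x, hw alpha i x -> S x) -> forall x, g x -> br e x = 0 -> S x.
Proof.
move=> hS gen x gx ex; have [ND hND] := Dnil.
rewrite [x](wcomp_sum lam Qu); apply: (linsub_sum hS) => c _.
pose K c' : set M := [set y | t0space c' y /\ br e y = 0].
have KL : linsub (K c).
  split=> [|a y z [Wy Ey] [Wz Ez]]; first by split; [exact: linsub0 (t0space_linsub c)|exact: br0].
  by split; [exact: (t0space_linsub c).2 | rewrite brDr brZr Ey Ez scaler0 addr0].
have Kx : K c (wc c x).
  split; first exact: t0space_wc.
  have hK : linsub [set y | g y /\ br e y = 0].
    split=> [|a y z [Wy Ey] [Wz Ez]]; first by split; [exact: linsub0 gL|exact: br0].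
    by split; [exact: gL.2 | rewrite brDr brZr Ey Ez scaler0 addr0].
  have := @wcomp_mem _ _ Q lam Qu _ c x hK _ (conj gx ex) => -[|//] y [gy ey].
  rewrite -t0E; split; first by apply: gbr => //; exact: teG.
  have -> : mbr t0 y = br t0 y by [].
  have := te_br y tet0 (te_e tet0); rewrite ey br0 => <-.
  by [].
apply: (hw_span El Hl Dl hHE hHD hED hND KL _ _ Kx hS).
- move=> y [Wy Ey]; split; first exact: t0space_br.
  have := hHE y; rewrite Ey br0 scaler0 addr0 => <-.
  by [].
- by move=> y [].
- move=> y [[Wy Ey] [i Hy]]; have [->|y0] := eqVneq y 0; first exact: linsub0 hS.
  have [alpha [ay _]] := t0space_weight Wy y0.
  exact: (gen alpha i).
Qed.

Lemma weight_hw alpha x : weight_space te g alpha x -> x != 0 -> exists i y, hw alpha i y.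
Proof.
move=> ax x0; have [NE hNE] := Enil; have [ND hND] := Dnil.
apply: contrapT => no; case/eqP: x0.
apply: (sl2_span El Hl Dl hHE hHD hED hNE hND (wspace_linsub alpha) _ _ _ ax (U := [set 0])).
- by move=> y; apply: wspace_br.
- by move=> y; apply: wspace_br.
- by move=> y; apply: wspace_br.
- by split=> // a y z -> ->; rewrite scaler0 addr0.
move=> _ [y [i [k [Wy Ey Hy ->]]]]; have [->|y0] := eqVneq y 0.
  by rewrite /=; elim: k => //= k ->; exact: br0.
by case: no; exists i, y.
Qed.

(** Otherwise the bottom [v] of the string of [y] would be orthogonal to [g]. Indeed [f v = 0] makes
    [v] orthogonal to the image of [ad f], and a top of weight other than [i] is orthogonal to [v]
    because the [h]-weights do not cancel. *)
Lemma hw_dual alpha i y : hw alpha i y ->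
  exists x, [/\ t0space (- alpha t0) x, br e x = 0, br h x = i%:R *: x
    & \tr (x *m iter i (br f) y) != 0].
Proof.
move=> [[gy ay] y0 ey hy]; have [NE hNE] := Enil; have [ND hND] := Dnil.
set v := iter i (br f) y.
have v0 : v != 0 by exact: (hw_D_neq0 El Dl hHD hED ey hy y0 (leqnn i)).
have gv : g v by rewrite /v; elim: (i) => //= k; exact: gbr.
have tv : br t0 v = alpha t0 *: v.
  rewrite /v; elim: (i) => [|k IH] /=; first exact: ay.
  by rewrite (te_br _ tet0 (te_f tet0)) IH brZr.
apply: contrapT => no; case/eqP: v0; apply: (trace_form_nondeg hG gv) => w gw.
rewrite mxtrace_mulC.
pose Z : set M := [set x | \tr (x *m v) = 0].
have hZ : linsub Z.
  split=> [|a x z hx hz]; rewrite /Z /=; first by rewrite mul0mx mxtrace0.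
  by rewrite mulmxDl -scalemxAl mxtraceD mxtraceZ hx hz mulr0 addr0.
suff : Z w by [].
rewrite [w](wcomp_sum lam Qu); apply: (linsub_sum hZ) => c _.
have Wc := t0space_wc c gw.
have [cE|cE] := eqVneq (c + alpha t0) 0; last exact: (weight_orthogonal Wc.2 tv cE).
have {cE}cE : c = - alpha t0 by apply/eqP; rewrite -addr_eq0 cE.
apply: (sl2_span El Hl Dl hHE hHD hED hNE hND (t0space_linsub c) _ _ _ Wc hZ).
- by move=> u; apply: t0space_br.
- by move=> u; apply: t0space_br.
- by move=> u; apply: t0space_br.
move=> _ [x [m [k [Wx Ex Hx ->]]]]; rewrite /Z /=; case: k => [|k]; last first.
  rewrite iterS mxtrace_br -iterS (hw_top El Hl Dl hHE hHD hED hND ey hy (ltnSn i)).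
  by rewrite mulmx0 mxtrace0 oppr0.
have hv : br h v = (- i%:R) *: v.
  rewrite /v (hw_H Dl hHD hy) (natrM _ 2) -{1}[i%:R]mul1r -mulrBl.
  by rewrite (_ : 1 - 2%:R = -1) ?mulN1r //; ring.
have [mi|mi] := eqVneq m i.
  apply/eqP; apply: contraT => nz; case: no; exists x; split=> //.
  - by rewrite -cE.
  - by rewrite -mi.
have := mxtrace_br h x v; rewrite Hx hv -scalemxAl -scalemxAr !mxtraceZ mulNr opprK.
move/eqP; rewrite -subr_eq0 -mulrBl mulf_eq0 subr_eq0 eqr_nat (negPf mi) /= => /eqP.
by [].
Qed.

Lemma hw_iter alpha i x k : hw alpha i x -> weight_space te g alpha (iter k (br f) x).
Proof. by move=> [ax _ _ _]; elim: k => //= k IH; apply: wspace_br => //; exact: te_f. Qed.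

Lemma norm_real_lt (s : R) (m : nat) :
  (`|(s%:C)%C| < m%:R :> C) = (- m%:R < s) && (s < m%:R).
Proof.
by rewrite normc_def /= expr0n addr0 sqrtr_sqr -(rmorph_nat (real_complex R)) ltcR ltr_norml.
Qed.

(** * Good gradings and lengths of strings *)

Section GoodGrading.
Variable p : M.
Hypothesis hp : real_form g te p.

Let tp : te p. Proof. by case: hp. Qed.
Let z := h + p.
Let zL : linear (br z). Proof. exact: br_linear. Qed.
Let gz : g z. Proof. by apply: (linsubD gL) => //; exact: teG. Qed.
Let Gam := ad_eigen_grading g z.

Lemma hw_real alpha i x : hw alpha i x -> exists s : R, alpha p = (s%:C)%C.
Proof. by move=> [[gx ax] x0 _ _]; have [_] := hp; apply; [exact: gx | exact: x0 | exact: ax]. Qed.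

Lemma hw_degree alpha i x s k : hw alpha i x -> alpha p = (s%:C)%C ->
  br z (iter k (br f) x) = ((i%:R - (2 * k)%:R + s)%:C)%C *: iter k (br f) x.
Proof.
move=> hx sE; have [_ hxk] := hw_iter k hx; case: hx => _ _ _ hx.
rewrite /z brDl (hxk _ tp) (hw_H Dl hHD hx) -scalerDl sE; congr (_ *: _).
by rewrite (rmorphD (real_complex R)) (rmorphB (real_complex R)) !(rmorph_nat (real_complex R)).
Qed.

Lemma br_z_e x c : br z x = (c%:C)%C *: x -> br z (br e x) = ((c + 2%:R)%:C)%C *: br e x.
Proof.
move=> hx; have hz : br z e = 2%:R *: e.
  by rewrite /z brDl (te_e tp) addr0; have [-> _ _] := hs.
by rewrite brA hz hx brZl brZr -scalerDl addrC (rmorphD (real_complex R)) (rmorph_nat (real_complex R)).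
Qed.

Lemma Gam_linsub j : linsub (Gam j).
Proof.
split=> [|a x y [gx hx] [gy hy]].
  by split; [exact: linsub0 gL | rewrite br0 scaler0].
by split; [exact: gL.2 | rewrite brDr brZr hx hy scalerDr !scalerA mulrC].
Qed.

Lemma Gam_hw alpha i x s k : hw alpha i x -> alpha p = (s%:C)%C ->
  Gam (i%:R - (2 * k)%:R + s) (iter k (br f) x).
Proof. by move=> hx sE; split; [case: (hw_iter k hx) | exact: hw_degree hx sE]. Qed.

Lemma Gam_grading : is_grading g Gam.
Proof.
split.
- move=> j; split; [by move=> x [] | exact: linsub0 (Gam_linsub j) | move=> c x y].
  by move=> hx hy; exact: (Gam_linsub j).2.
- move=> i j x y [gx hx] [gy hy]; split; first exact: gbr.
  by rewrite brA hx hy brZl brZr -scalerDl (rmorphD (real_complex R)).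
(* The degrees are kept distinct and the components are 0 off the list, so that two decompositions
   can be added over the union of their degrees. *)
- pose S : set M := [set x | exists (s : seq R) (y : R -> M), [/\ uniq s,
    forall j, Gam j (y j), forall j, j \notin s -> y j = 0 & x = \sum_(j <- s) y j]].
  suff gS : g `<=` S.
    by move=> x /gS [s [y [us hy y0 ->]]]; exists s, y.
  have ext (s s' : seq R) (y : R -> M) : uniq s -> uniq s' -> {subset s <= s'} ->
      (forall j, j \notin s -> y j = 0) -> \sum_(j <- s') y j = \sum_(j <- s) y j.
    move=> us us' ss' y0; rewrite (bigID (mem s)) /= [X in _ + X]big1 ?addr0 => [|j /y0 //].
    rewrite -big_filter; apply: perm_big; apply: uniq_perm; rewrite ?filter_uniq //.
    by move=> j; rewrite mem_filter; case: (boolP (j \in s)) => // /ss' ->.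
  have hS : linsub S.
    split=> [|a x x' [s [y [us hy y0 ->]]] [s' [y' [us' hy' y0' ->]]]].
      exists [::], (fun _ => 0); split=> //; last by rewrite big_nil.
      by move=> j; exact: linsub0 (Gam_linsub j).
    exists (undup (s ++ s')), (fun j => a *: y j + y' j); split.
    - exact: undup_uniq.
    - by move=> j; exact: (Gam_linsub j).2.
    - move=> j; rewrite mem_undup mem_cat negb_or => /andP [/y0 -> /y0' ->].
      by rewrite scaler0 addr0.
    - rewrite big_split -scaler_sumr; congr (_ *: _ + _); apply/esym; apply: ext => //;
        rewrite ?undup_uniq // => j js; by rewrite mem_undup mem_cat js ?orbT.
  apply: (g_span hS) => alpha i k x hx ki; have [s sE] := hw_real hx.
  set d := i%:R - (2 * k)%:R + s; set v := iter k (br f) x.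
  exists [:: d], (fun j => if j == d then v else 0); split=> //.
  - move=> j; case: eqP => [->|_]; [exact: Gam_hw hx sE | exact: linsub0 (Gam_linsub j)].
  - by move=> j; rewrite inE => /negPf ->.
  - by rewrite big_seq1 eqxx.
- move=> s y us hy s0 j js.
  apply: (eigen_sum_eq0 zL us (mu := fun j => (j%:C)%C)) s0 _ js => [a b _ _|a _].
  + exact: complexI.
  + by case: (hy a).
Qed.

Lemma good_gradingP : good_grading g e Gam <->
  forall alpha i x, hw alpha i x -> `|alpha p| < i.+1%:R.
Proof.
split=> [[_ _ inj surj] alpha i x hx|bnd].
  have [s sE] := hw_real hx; rewrite sE norm_real_lt.
  apply/andP; split; rewrite ltNge; apply/negP => hle.
    (* Here [alpha p <= - (i + 1)]: the top [x] has degree at most [-1], where [ad e] is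
       injective. *)
    have x0 : x = 0.
      apply: (inj (i%:R - (2 * 0)%:R + s)).
      - by rewrite muln0 subr0; move: hle; rewrite -natr1; lra.
      - exact: (Gam_hw 0 hx sE).
      - exact: linsub0 (Gam_linsub _).
      - by rewrite br0; case: hx.
    by case: hx => _; rewrite x0 eqxx.
  (* Here [alpha p >= i + 1]: the bottom has degree at least 1, so it would be some [br e x'], and
     its pairing with a vector killed by [e] would vanish. *)
  have [x0 [_ ex0 _ nz]] := hw_dual hx.
  have [||x' _ ex'] := surj (i%:R - (2 * i)%:R + s - 2%:R) _ (iter i (br f) x).
  - by move: hle; rewrite natrM -natr1; lra.
  - by rewrite subrK; exact: Gam_hw hx sE.
  case/eqP: nz; rewrite -ex' mxtrace_mulC mxtrace_br ex0 mulmx0 mxtrace0 oppr0.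
  by [].
split; first exact: Gam_grading.
- split=> //; rewrite /z brDl (te_e tp) addr0 (rmorph_nat (real_complex R)); by case: hs.
- move=> j j1 x y [gx hx] [gy hy] exy.
  apply/eqP; rewrite -subr_eq0; apply/eqP.
  have gw : g (x - y) by exact: (linsubB gL).
  (* The kernel of [ad e] is spanned by tops, whose degrees all exceed [-1], so it has no nonzero
     vector of degree [j]. *)
  apply: (eigen_lspan_eq0 zL (Pc := fun c => exists2 s : R, -1 < s & c = (s%:C)%C)
    (c := (j%:C)%C)).
  + by move=> [s hs1 /complexI ej]; move: j1 hs1; rewrite ej; lra.
  + apply: (ker_span (lspan_linsub _)) gw _ => [alpha i w hw'|].
      have [s sE] := hw_real hw'; have := bnd _ _ _ hw'; rewrite sE norm_real_lt => /andP [h1 _].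
      apply: sub_lspan; exists ((i%:R - (2 * 0)%:R + s)%:C)%C; last exact: (hw_degree 0 hw' sE).
      exists (i%:R - (2 * 0)%:R + s) => //.
      by rewrite muln0 subr0; move: h1; rewrite -natr1; lra.
    have -> : br e (x - y) = br e x - br e y by rewrite -scaleN1r brDr brZr scaleN1r.
    by rewrite exy subrr.
  + by rewrite -scaleN1r brDr brZr hx hy scalerDr !scalerA mulrC.
- move=> j j1 y [gy hy].
  suff [x hx <-] : [set v | exists2 x, Gam j x & br e x = v] y by exists x.
  (* A string vector of degree other than [j + 2] is an eigenvector for another eigenvalue. One of
     degree [j + 2 >= 1] is not a bottom, since bottoms have degree below 1, so it is in the image
     of [ad e]. *)
  apply: (eigen_lspan_mod zL (Pc := fun c => c != ((j + 2%:R)%:C)%C) (c := ((j + 2%:R)%:C)%C)).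
  + split=> [|a _ _ [u hu <-] [v hv <-]].
      by exists 0; [exact: linsub0 (Gam_linsub j) | exact: br0].
    by exists (a *: u + v); [exact: (Gam_linsub j).2 | rewrite brDr brZr].
  + move=> _ [u hu <-]; have [_ hu'] := hu; rewrite (br_z_e hu').
    by exists (((j + 2%:R)%:C)%C *: u); [exact: (linsubZ (Gam_linsub j)) | rewrite brZr].
  + by rewrite eqxx.
  + apply: (g_span (lspan_linsub _)) gy => alpha i k x hx ki; apply: sub_lspan.
    have [s sE] := hw_real hx; have := bnd _ _ _ hx; rewrite sE norm_real_lt => /andP [_ h1].
    have hd := hw_degree k hx sE.
    have [dE|dE] := eqVneq (i%:R - (2 * k)%:R + s) (j + 2%:R); last first.
      by right; exists ((i%:R - (2 * k)%:R + s)%:C)%C => //; rewrite (inj_eq (@complexI R)).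
    left; have ki' : (k < i)%N.
      rewrite ltn_neqAle ki andbT; apply/eqP => kiE; move: dE h1 j1.
      by rewrite kiE natrM -natr1; lra.
    have [_ _ ex hxx] := hx.
    exists ((k.+1%:R * (i%:R - k%:R))^-1 *: iter k.+1 (br f) x).
      apply: (linsubZ (Gam_linsub j)).
      have -> : j = i%:R - (2 * k.+1)%:R + s; last exact: Gam_hw hx sE.
      move: dE; rewrite mulnS natrD; lra.
    rewrite brZr (hw_E Dl hHD hED ex hxx) scalerA mulVf ?scale1r //.
    by rewrite mulf_neq0 ?pnatr_eq0 // subr_eq0 eqr_nat gtn_eqF.
  + exact: hy.
Qed.

End GoodGrading.

(** * Multiplicities and the minimal dimension *)

Lemma irreducible_hw (alpha : {scalar M}) (V : {vspace M}) : s_irreducible e h f V ->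
  (forall x, x \in V -> weight_space te g alpha x) ->
  exists x i, [/\ hw alpha i x, x \in V & \dim V = i.+1].
Proof.
move=> irr hV; have [NE hNE] := Enil; have [ND hND] := Dnil; have [V0 sV _] := irr.
have [x [i [xV x0 ex hx]]] := stable_hw El Hl Dl hHE hHD hED hNE hND sV V0.
exists x, i; split=> //; first by split=> //; exact: hV.
rewrite (irreducible_string El Hl Dl hHE hHD hED hND ex hx x0 irr xV).
exact: (string_dim El Hl Dl hHD hED ex hx x0).
Qed.

Lemma hw_string (alpha : {scalar M}) i x : hw alpha i x -> exists V : {vspace M},
  [/\ s_irreducible e h f V, forall y, y \in V -> weight_space te g alpha y & \dim V = i.+1].
Proof.
move=> hw'; have [ax x0 ex hx] := hw'; have [NE hNE] := Enil; have [ND hND] := Dnil.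
exists (string (br f) x i); split.
- exact: (string_irreducible El Hl Dl hHE hHD hED hNE hND ex hx x0).
- by apply: (string_ind (wspace_linsub alpha)) => k; exact: hw_iter hw'.
- exact: (string_dim El Hl Dl hHD hED ex hx x0).
Qed.

(** A nonzero component of a highest weight vector in a summand is again one, for the same weights,
    and it determines the type of the summand. So whether a multiplicity vanishes does not depend on
    the decomposition. *)
Lemma summand_hw r (beta : 'I_r -> {scalar M}) (d : 'I_r -> nat) (Vs : 'I_r -> {vspace M})
    (alpha : {scalar M}) i : (forall a, is_L g te e h f (beta a) (d a) (Vs a)) ->
  directv (\sum_(a < r) Vs a) -> (forall x, g x <-> x \in (\sum_(a < r) Vs a)%VS) ->
  (exists a, (forall t, te t -> beta a t = alpha t) /\ d a = i) <-> exists x, hw alpha i x.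
Proof.
move=> hL dV gV; split=> [[a [ba da]]|[x [[gx ax] x0 ex hx]]].
  have [bV irr dimV] := hL a; have [x [j [hx _]]] := irreducible_hw irr bV.
  rewrite dimV da => -[ij]; exists x; rewrite ij; case: hx => -[gx bx] x0 ex hx.
  by split=> //; split=> // t tt; rewrite -ba //; exact: bx.
have [y hy xE] := memv_sumP ((gV x).1 gx).
have {}hy a : y a \in Vs a by exact: hy.
have [a ya0] : exists a, y a != 0.
  apply: contrapT => no; case/eqP: x0; rewrite xE big1 // => a _.
  by apply/eqP; apply: contraT => ya; case: no; exists a.
have st b : s_stable e h f (Vs b) by have [_ [_]] := hL b.
have key (z : M) c : (forall b v, v \in Vs b -> br z v \in Vs b) -> br z x = c *: x ->
    br z (y a) = c *: y a.
  move=> zV hz; apply/eqP; rewrite -subr_eq0; apply/eqP.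
  apply: (@directv_ker _ _ r Vs (fun v => br z v - c *: v) y) => //.
  - by move=> u v w; rewrite /= brDr brZr (scalerDr c) (scalerBr u (br z v)) !scalerA opprD addrACA [c * u]mulrC.
  - by move=> b v vb; rewrite rpredB ?rpredZ //; exact: zV.
  - by rewrite -xE hz subrr.
have ea : br e (y a) = 0.
  rewrite -[RHS](scale0r (y a)); apply: key; last by rewrite ex scale0r.
  by move=> b v /st [].
have ha : br h (y a) = i%:R *: y a by apply: key => // b v /st [].
have ta t : te t -> br t (y a) = alpha t *: y a.
  move=> tt; apply: key; last exact: ax.
  move=> b v vb; have [bV _ _] := hL b; have [_ ->] := bV v vb; last exact: tt.
  by rewrite memvZ.
have [bV irr dimV] := hL a; have [NE hNE] := Enil; have [ND hND] := Dnil.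
exists a; split=> [t tt|].
  have [_ hb] := bV _ (hy a); have /eqP := hb t tt.
  rewrite (ta _ tt) -subr_eq0 -scalerBl scaler_eq0 (negPf ya0) orbF subr_eq0.
  by move/eqP.
have := irreducible_string El Hl Dl hHE hHD hED hND ea ha ya0 irr (hy a).
move/(congr1 (fun V : {vspace M} => \dim V)).
by rewrite dimV (string_dim El Hl Dl hHD hED ea ha ya0) => -[].
Qed.

(** Some decomposition exists, so [multiplicity] is not the default value of [xget]. *)
Lemma multiplicity_ex (alpha : {scalar M}) i : exists k, is_multiplicity g te e h f alpha i k.
Proof.
have [W hW] := linsub_vspace gL; have [NE hNE] := Enil; have [ND hND] := Dnil.
have [||||r [beta [d [Vs [hV dV WE]]]]] := sl2_decomp El Hl Dl hHE hHD hED hNE hND (W := W)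
    (Lb := fun beta : {scalar M} => weight_space te g beta).
- exact: wspace_linsub.
- by move=> b x; apply: wspace_br => //; exact: te_f.
- by move=> b x [/hW].
- move=> W' sW' gen; apply/subvP => x /hW.
  apply: (g_span (linsub_mem W')) => alpha' j k y hy _.
  apply: (iterD_mem _ sW'); case: hy => ay _ ey hy; exact: (gen alpha' y j).
eexists; exists r, beta, d, Vs; split=> // x; by rewrite hW WE.
Qed.

Lemma multiplicity_neq0 (alpha : {scalar M}) i :
  multiplicity g te e h f alpha i != 0%N <-> exists x, hw alpha i x.
Proof.
have := xgetPex 0%N (multiplicity_ex alpha i); rewrite -/(multiplicity g te e h f alpha i).
move=> [r [beta [d [Vs [hL dV gV ->]]]]].
rewrite -(summand_hw alpha i hL dV gV) -lt0n; split=> [/card_gt0P [a]|[a [ba da]]].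
  by rewrite inE => /andP [/asboolP ba /eqP da]; exists a.
by apply/card_gt0P; exists a; rewrite inE da eqxx andbT; apply/asboolP.
Qed.

Lemma dminP (alpha : {scalar M}) : is_weight te g alpha -> exists m,
  [/\ dmin g te e h f alpha = m.+1, exists x, hw alpha m x &
      forall j x, hw alpha j x -> (m <= j)%N].
Proof.
move=> [x ax x0]; have [i0 [y0 hy0]] := weight_hw ax x0.
pose A : set nat := [set i | multiplicity g te e h f alpha i != 0%N].
have ne : exists j, [set i | A i /\ forall j, A j -> (i <= j)%N] j.
  have ex : exists j, `[< A j >] by exists i0; apply/asboolP; apply/multiplicity_neq0; exists y0.
  case: (ex_minnP ex) => j /asboolP Aj hj; exists j; split=> // k Ak.
  by apply: hj; exact/asboolP.
have [Am hm] := xgetPex 0%N ne.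
exists (min_nat A); split=> //; first exact/multiplicity_neq0.
by move=> j w hw'; apply: hm; apply/multiplicity_neq0; exists w.
Qed.

Lemma min_irreducible_dim_dmin (alpha : {scalar M}) : is_weight te g alpha ->
  min_irreducible_dim g te e h f alpha (dmin g te e h f alpha).
Proof.
move=> /dminP [m [-> [x hx] hm]]; split.
  by have [V [irr aV dimV]] := hw_string hx; exists V.
move=> V [irr aV]; have [y [j [hy _ ->]]] := irreducible_hw irr aV.
by rewrite ltnS; exact: (hm j y).
Qed.

(** * Reduction to the weights on the Lie algebra of the unipotent radical *)

Variables P U : set M.
Hypothesis hP : parabolic_subgroup G P.
Hypothesis hU : unipotent_radical P U.
Hypothesis hL : levi_factor P U (group_centralizer G te).

Let UG : Lie U `<=` g.
Proof.
have [_ PG _] := hP; have [[_ _ _ [UP _]] _] := hU.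
by apply: LieS => A /UP /PG.
Qed.

Lemma is_weight_radical alpha : is_weight te (Lie U) alpha -> is_weight te g alpha.
Proof. by move=> [x [ux ax] x0]; exists x => //; split=> //; exact: UG. Qed.

Lemma good_grading_radicalP p : real_form g te p ->
  good_grading g e (ad_eigen_grading g (h + p)) <->
  forall alpha : {scalar M}, is_weight te (Lie U) alpha ->
    `|alpha p| < (dmin g te e h f alpha)%:R.
Proof.
move=> hp; have [tp _] := hp; rewrite (good_gradingP hp); split=> [bnd alpha wa|bnd alpha i x hx].
  have [m [-> [x hx] _]] := dminP (is_weight_radical wa); exact: (bnd alpha m x).
(* The bound at the minimal length implies the bound at every other length of the same weight. *)
have bndU beta j y : is_weight te (Lie U) beta -> hw beta j y -> `|beta p| < j.+1%:R.
  move=> wb hy; have := bnd _ wb; have [m [-> _ hm]] := dminP (is_weight_radical wb).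
  by move=> h1; apply: (lt_le_trans h1); rewrite ler_nat ltnS; exact: (hm j y).
have [ax x0 ex hx'] := hx; have [gx tx] := ax.
have [a0|a0] := eqVneq (alpha t0) 0.
  by rewrite (weight_zero ax x0 a0 tp) normr0 ltr0Sn.
have [ux|[y uy [y0 hy]]] :=
  weight_or_opposite hG hP hU hL Qu t0E teG tet0 te_comm0 te_diag a0 gx x0 (tx _ tet0).
  by apply: (bndU _ _ x) => //; exists x.
have ty : t0space (- alpha t0) y by split; [exact: UG |].
have [beta [by' b0]] := t0space_weight ty y0.
have ab : alpha t0 = - beta t0 by rewrite b0 opprK.
have wb : is_weight te (Lie U) beta by exists y => //; split=> //; case: by'.
rewrite (weight_opp ax x0 by' y0 ab tp) normrN.
(* The vector [y] shows only that [- alpha] is a weight on [u]; the dual vector [w] gives a string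
   of weight [- alpha] with the same length [i], to which [bndU] applies. *)
have [w [[gw hw0] ew hw' nz]] := hw_dual hx.
have w0 : w != 0 by apply: contraNneq nz => ->; rewrite mul0mx mxtrace0.
have [gamma [wg g0]] := t0space_weight (conj gw hw0) w0.
have gb : gamma t0 = beta t0 by rewrite g0 b0.
apply: (bndU _ _ w wb); split=> //; split=> // t tt.
by rewrite -(weight_eq wg w0 by' y0 gb tt); case: wg => _; apply.
Qed.

End Sl2Weights.

Theorem theorem20 (R : realType) (n : nat) (G : set 'M[R[i]]_n)
    (hG : connected_semisimple G)
    (e h f : 'M[R[i]]_n)
    (he : Lie G e) (hh : Lie G h) (hf : Lie G f)
    (enil : nilpotent_mx e) (hs : sl2_triple e h f)
    (T : set 'M[R[i]]_n) (hT : maximal_torus G T)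
    (hTC : T `<=` group_centralizer G [set h])
    (hTe : exists2 S : set 'M[R[i]]_n,
       maximal_torus (group_centralizer (group_centralizer G [set h]) [set e]) S
       & S `<=` T)
    (te : set 'M[R[i]]_n) (hte : te = lie_centralizer (Lie T) e)
    (P U : set 'M[R[i]]_n) (hP : parabolic_subgroup G P)
    (hU : unipotent_radical P U)
    (hL : levi_factor P U (group_centralizer G te)) :
  (forall p : 'M[R[i]]_n, real_form (Lie G) te p ->
     (good_grading (Lie G) e (ad_eigen_grading (Lie G) (h + p)) <->
      forall alpha : {scalar 'M[R[i]]_n}, is_weight te (Lie U) alpha ->
        `|alpha p| < (dmin (Lie G) te e h f alpha)%:R)) /\
  (forall alpha : {scalar 'M[R[i]]_n}, is_weight te (Lie U) alpha ->
     min_irreducible_dim (Lie G) te e h f alpha (dmin (Lie G) te e h f alpha)).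
Proof.
have [[_ _ [Q Qu hQ]] TG _] := hT.
have [[[Gu _ _ _] _] _ _] := hG.
have Tu : T `<=` [set A | A \in unitmx] by move=> A /TG /Gu.
have teG : te `<=` Lie G by rewrite hte => t [Tt _]; exact: (LieS TG).
have te_e t : te t -> br t e = 0 by rewrite hte => -[].
have te_h t : te t -> br t h = 0.
  rewrite hte => -[Tt _]; apply: (Lie_fixing Tu) Tt => A TA.
  by have [_] := hTC _ TA; apply.
have te_diag t : te t -> exists mu, t = invmx Q *m diag_mx mu *m Q.
  by rewrite hte => -[Tt _]; exact: (Lie_diagonalizable Qu hQ).
have te_lin : linsub te.
  rewrite hte; split=> [|a x y [Tx ex] [Ty ey]].
    by split; [exact: linsub0 (Lie_linsub T) | rewrite brC br0 oppr0].
  by split; [exact: (Lie_linsub T).2 | rewrite brDl brZl ex ey scaler0 addr0].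
have [t0 [lam [tet0 t0E generic]]] := generic_ex te_lin te_diag.
split=> [p hp|alpha wa].
  exact: (good_grading_radicalP hG he hh hf hs teG te_e te_h Qu te_diag tet0 t0E generic hP hU hL hp).
apply: (min_irreducible_dim_dmin hG he hh hf hs teG te_e te_h Qu te_diag tet0 t0E generic).
exact: (is_weight_radical hP hU wa).
Qed.
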